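(* Let $K$ be an arbitrary field and let $I\subset R:=K[x_1,\ldots,x_n]$ be an ideal generated by monomials of degree two. Let $G(I)$ be the graph associated to $I$, let $G(I)^c$ be its (simple) complement, let $\beta_{i,j}$ be the graded Betti numbers of $I$, and let $p$ be the length of the minimal graded free resolution of $I$. For all $d\geq 3$, set $i_d:=\min_{1\leq i\leq p}\{i:\ \beta_{i,i+d}\neq 0\}$ if $\beta_{i,i+d}\neq 0$ for some $i\geq 1$, and $i_d:=0$ otherwise. Then: (1) $i_3=1$ if and only if $G(I)$ has at least one induced subgraph consisting of two disjoint edges. When this occurs, $\beta_{1,4}$ is the number of such induced subgraphs of $G(I)$, and $\beta_{1,j}=0$ for all $j>4$. (2) $i_3>1$ if and only if $G(I)$ has no induced subgraph consisting of two disjoint edges and $G(I)^c$ has at least one induced cycle of length $\geq 5$. When this occurs, $i_3=r-3$ where $r$ is the smallest integer $\geq 5$ such that $G(I)^c$ has an induced $r$-cycle, $\beta_{i_3,i_3+3}$ is the number of induced $r$-cycles in $G(I)^c$, and $\beta_{i,j}=0$ for all $i\leq i_3$ and $j>i_3+3$. (3) $i_3=0$ if and only if $G(I)$ has no induced subgraph consisting of two disjoint edges and $G(I)^c$ is chordal. When this occurs, $I$ has a linear resolution.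
   Context: $R=K[x_1,\ldots,x_n]$ has its standard grading. The minimal graded free resolution of $I$ is written $0\to\bigoplus_j R(-j)^{\beta_{p,j}}\to\cdots\to\bigoplus_j R(-j)^{\beta_{0,j}}\to I\to 0$; the resolution is of $I$ (not of $R/I$), so $\beta_{0,j}$ counts minimal generators of $I$ of degree $j$. $I$ has a linear resolution if $\beta_{i,j}=0$ whenever $j\neq i+2$. Graphs: $G(I)$ has vertex set $\{(1),\ldots,(n)\}$ and edge set $\{(i,j):1\le i\le j\le n,\ x_ix_j\in I\}$; it may have loops ($(i,i)$ is an edge iff $x_i^2\in I$). $G(I)^c$ is the simple graph on the same vertices with edges the $(i,j)$, $i<j$, that are not edges of $G(I)$. A subgraph of $G$ is induced if its edge set contains all the edges of $G$ joining two distinct elements of its vertex set (loops of $G$ need not be included). An induced subgraph of $G(I)$ consisting of two disjoint edges is thus a pair of edges of $G(I)$ (each possibly a loop), with no common vertex, such that no edge of $G(I)$ joins a vertex of one to a vertex of the other; its vertex set is the set of endpoints of the two edges. For $t\ge3$, a $t$-cycle is a subgraph with edges $(v_1,v_2),(v_2,v_3),\ldots,(v_t,v_1)$, $v_1,\ldots,v_t$ distinct; it is induced if it has no chord, i.e. no edge of the graph other than those of the cycle joins two of the $v_i$. Cycles are counted as subgraphs. A graph is chordal if it has no induced $t$-cycle with $t\geq 4$. *)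

(* Defs.v *)
From HB Require Import structures.
From mathcomp Require Import all_boot all_order all_algebra.
From mathcomp Require Import mpoly.

Set Implicit Arguments.
Unset Strict Implicit.
Unset Printing Implicit Defensive.

Import GRing.Theory.
Local Open Scope ring_scope.

Section Ideals.
Variables (K : fieldType) (n : nat).
Implicit Types (I : {pred {mpoly K[n]}}) (f : {mpoly K[n]}).

(* The generating set M may be empty, so the zero ideal is included.          *)
Definition generated_by_quadratic_monomials I : Prop :=
  exists M : {pred 'X_{1..n}},
    (forall m, m \in M -> mdeg m = 2) /\
    (forall f, f \in I <->
       exists s : seq ({mpoly K[n]} * 'X_{1..n}),
         all (fun q => q.2 \in M) s /\ f = \sum_(q <- s) q.1 * 'X_[q.2]).

(* f, as an entry of a matrix of a degree-0 map R(-a) -> R(-b), is            *)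
(* homogeneous of degree a - b (hence 0 if a < b).                            *)
Definition homog_shift f (a b : nat) : Prop :=
  forall m, m \in msupp f -> (mdeg m + b)%N = a.

(* A minimal graded free resolution  0 -> F_p -> ... -> F_0 -> I -> 0  with   *)
(* F_i = \bigoplus_(a < rank i) R(- shift i a) and p = res_length.  Elements  *)
(* of F_i are row vectors and maps act by right multiplication.  Every shift  *)
(* occurring in such a resolution of an ideal is nonnegative, so the shifts   *)
(* are natural numbers.                                                       *)
Record min_graded_resolution I : Type := MinGradedResolution {
  res_rank : nat -> nat;
  res_shift : forall i, 'I_(res_rank i) -> nat;
  res_aug : 'cV[{mpoly K[n]}]_(res_rank 0);
  res_diff : forall i, 'M[{mpoly K[n]}]_(res_rank i.+1, res_rank i);
  res_length : nat;
  _ : forall a, homog_shift (res_aug a 0) (res_shift a) 0;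
  _ : forall i a b,
        homog_shift (res_diff i a b) (res_shift a) (res_shift b);
  _ : forall f, f \in I <-> exists u : 'rV_(res_rank 0), u *m res_aug = f%:M;
  _ : forall u : 'rV_(res_rank 0),
        u *m res_aug = 0 <-> exists v, u = v *m res_diff 0;
  _ : forall i (u : 'rV_(res_rank i.+1)),
        u *m res_diff i = 0 <-> exists v, u = v *m res_diff i.+1;
  (* minimality: the image of F_(i+1) lies in (x_1, ..., x_n) F_i             *)
  _ : forall i a b, (res_diff i a b)@_0%MM = 0;
  (* the length is the largest p with F_p != 0, and 0 for the zero ideal      *)
  _ : forall i, (res_length < i)%N -> res_rank i = 0%N;
  _ : (0 < res_length)%N -> (0 < res_rank res_length)%N
}.

Definition betti I (F : min_graded_resolution I) (i j : nat) : nat :=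
  #|[set a : 'I_(res_rank F i) | res_shift a == j]|.

(* The list [iota 1 p] is 1, ..., p in increasing order, so [head 0] returns  *)
(* the minimum of the selected indices, or 0 if there is none.                *)
Definition first_index I (F : min_graded_resolution I) (d : nat) : nat :=
  head 0%N [seq i <- iota 1 (res_length F) | betti F i (i + d) != 0%N].

Definition linear_resolution I (F : min_graded_resolution I) : Prop :=
  forall i j, j <> (i + 2)%N -> betti F i j = 0%N.

Definition Gedge I : rel 'I_n := fun i j => 'X_i * 'X_j \in I.

Definition Gedge_compl I : rel 'I_n := fun i j => (i != j) && ~~ Gedge I i j.

End Ideals.

Section Graphs.
Variable T : finType.
Implicit Types (e : rel T) (c : seq T).

(* An edge is the set of its endpoints; a loop is a singleton.                *)
Definition edges e : {set {set T}} := [set [set u.1; u.2] | u : T * T & e u.1 u.2].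

(* A subgraph without isolated vertices is represented by its set of edges.   *)
Definition induced_disjoint_edge_pairs e : {set {set {set T}}} :=
  [set P : {set {set T}} | [&& P \subset edges e, #|P| == 2 &
     [forall A in P, forall B in P, (A != B) ==>
        [disjoint A & B] &&
        [forall x in A, forall y in B, ~~ e x y && ~~ e y x]]]].

Definition cycle_edges c : {set {set T}} :=
  [set [set x; next c x] | x in c].

Definition chordless e c : bool :=
  [forall x in c, forall y in c, e x y ==> ([set x; y] \in cycle_edges c)].

(* Only meaningful for t >= 3 and e symmetric and irreflexive.                *)
Definition induced_cycles e (t : nat) : {set {set {set T}}} :=
  [set cycle_edges c | c : t.-tuple T & ucycleb e c && chordless e c].

Definition chordal e : Prop :=
  forall t, (4 <= t)%N -> induced_cycles e t = set0.

End Graphs.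

Definition is_least (P : nat -> Prop) (r : nat) : Prop :=
  P r /\ forall t, P t -> (r <= t)%N.

(* Main.v *)
Require Import Defs.
From HB Require Import structures.
From mathcomp Require Import all_boot all_order all_algebra.
From mathcomp Require Import mpoly.
From mathcomp Require Import zify ring.

(** Let 0 <- I <- F_0 <- F_1 <- ... be the resolution and M_p its p-th syzygy
    module (M_0 = I).  Tensoring 0 -> M_(p+1) -> F_p -> M_p -> 0 with the Koszul
    complex K, which is acyclic on free modules, gives
    H_(q+1)(K (x) M_p) = H_q(K (x) M_(p+1)); minimality makes this valid for
    q = 0 too and gives dim H_0(K (x) M_p)_j = beta_(p,j).  Hence beta_(p,j) is
    the dimension of H_(p+1)(K (x) R/I)_j, which is multigraded.

    In multidegree b the complex K (x) R/I has as basis the squarefree t <= b with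
    x^(b-t) not in I.  It is acyclic if b_v >= 2 at a vertex v without loop, and
    zero if b_v >= 3 at a loop; otherwise it is the reduced cochain complex of the
    clique complex of G(I)^c restricted to the link of the doubled vertices, and
    vertex removal (deletion and link) bounds its cohomology: an induced cycle of
    G(I)^c is needed to produce H^1, and a shortest one produces a line. *)

Set Implicit Arguments.
Unset Strict Implicit.
Unset Printing Implicit Defensive.

Import GRing.Theory.

(** * Induced cycles, and walks between two neighbours of a vertex *)

Section InducedCycles.
Variables (T : finType) (e : rel T).
Hypothesis e_sym : ssrbool.symmetric e.
Hypothesis e_irr : irreflexive e.
Implicit Types (c p : seq T) (x y v : T).

(** The constants come from one count: in a squarefree multidegree of total degree [j], Koszul
    degree [i + 1] leaves faces with [j - (i + 1)] vertices, so [j = i + 3] is where edges, hence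
    H^1, decide. A doubled vertex adds two to the degree but one to the support; so a pair of edges
    containing loops shows up as H^0 of two points or as the class of the empty face, beside the
    four-cycle given by two proper edges, all in Koszul degree 2. No homology space is formed.
    Fixing [j] makes the chain spaces finite-dimensional, and each isomorphism becomes an additive
    identity between dimensions of cycles and boundaries. The Betti numbers of the theorem are zero
    or counts, so a multidegree is only ever shown to be acyclic or to carry a line spanned by an
    explicit cocycle. The delicate case is [i = i_3], [j > i_3 + 3], where removing vertices one at
    a time misses the bound by one. It is regained because a vertex adjacent to all others makes the
    complex a cone, and the link of any other vertex has at least two vertices fewer. *)

Definition induced_cycle c := [&& ucycleb e c, chordless e c & 4 <= size c].

Definition no_induced_cycle (A : {set T}) :=
  forall c, induced_cycle c -> {subset c <= A} -> False.

Lemma no_induced_cycleS (A A' : {set T}) :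
    A' \subset A -> no_induced_cycle A -> no_induced_cycle A'.
Proof. by move=> /subsetP AA' ac c cc cA; apply: (ac c cc) => x /cA/AA'. Qed.

Lemma next_nth_uniq c i x0 :
  uniq c -> i.+1 < size c -> next c (nth x0 c i) = nth x0 c i.+1.
Proof.
move=> uc ic; rewrite next_nth mem_nth ?(ltnW ic) //.
case: c uc ic => // y p uc ic; rewrite index_uniq ?(ltnW ic) //=.
exact: set_nth_default.
Qed.

Lemma next_last_uniq y p : uniq (y :: p) -> next (y :: p) (last y p) = y.
Proof.
by move=> uc; rewrite next_nth mem_last index_last // nth_default.
Qed.

Lemma cycle_edges_nth c i x0 : uniq c -> i.+1 < size c ->
  [set nth x0 c i; nth x0 c i.+1] \in cycle_edges c.
Proof.
move=> uc ic; rewrite -next_nth_uniq //; apply/imsetP; exists (nth x0 c i) => //.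
by rewrite mem_nth // ltnW.
Qed.

Lemma cycle_edges_last y p : uniq (y :: p) ->
  [set y; last y p] \in cycle_edges (y :: p).
Proof.
move=> uc; apply/imsetP; exists (last y p); first exact: mem_last.
by rewrite next_last_uniq // setUC.
Qed.

Lemma chordless_nth y p : uniq (y :: p) ->
  (forall i k, i < k <= size p -> e (nth y (y :: p) i) (nth y (y :: p) k) ->
     k = i.+1 \/ i = 0 /\ k = size p) ->
  chordless e (y :: p).
Proof.
move=> uc h.
have main i k : i < k <= size p -> e (nth y (y :: p) i) (nth y (y :: p) k) ->
    [set nth y (y :: p) i; nth y (y :: p) k] \in cycle_edges (y :: p).
  move=> ik eik; have [ki|[i0 kp]] := h _ _ ik eik.
    by rewrite ki; apply: cycle_edges_nth => //=; move: ik; rewrite ki; lia.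
  by rewrite i0 kp /= -last_nth; apply: cycle_edges_last.
apply/forall_inP=> x xc; apply/forall_inP=> z zc; apply/implyP=> exz.
move: exz; rewrite -(nth_index y xc) -(nth_index y zc).
move: xc zc; rewrite -!index_mem => xc zc.
case: (ltngtP (index x (y :: p)) (index z (y :: p))) => [lt|lt|->].
- by move=> exz; apply: main; rewrite // lt -ltnS.
- by rewrite e_sym setUC => exz; apply: main; rewrite // lt -ltnS.
by rewrite e_irr.
Qed.

Lemma set2_eq x y x' y' : x != y -> [set x; y] = [set x'; y'] ->
  x = x' /\ y = y' \/ x = y' /\ y = x'.
Proof.
move=> xy S; have : x \in [set x'; y'] by rewrite -S set21.
have : y \in [set x'; y'] by rewrite -S set22.
rewrite !in_set2 => /orP[]/eqP yE /orP[]/eqP xE; [|by right|by left|];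
  by rewrite xE yE eqxx in xy.
Qed.

Lemma cycle_edgesP y p S : uniq (y :: p) -> S \in cycle_edges (y :: p) ->
  (exists2 i, i < size p & S = [set nth y (y :: p) i; nth y (y :: p) i.+1]) \/
  S = [set y; last y p].
Proof.
move=> uc /imsetP[w wc ->].
have [ip|ip] := eqVneq (index w (y :: p)) (size p).
  have wE : w = last y p by rewrite (last_nth y) -ip nth_index.
  by right; rewrite wE next_last_uniq // setUC.
have {}ip : index w (y :: p) < size p.
  by rewrite ltn_neqAle ip -ltnS (_ : (size p).+1 = size (y :: p)) // index_mem.
left; exists (index w (y :: p)) => //.
by rewrite -next_nth_uniq // nth_index.
Qed.

Lemma chordless_index y p i k : uniq (y :: p) -> chordless e (y :: p) ->
  i < k <= size p -> e (nth y (y :: p) i) (nth y (y :: p) k) ->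
  k = i.+1 \/ i = 0 /\ k = size p.
Proof.
move=> uc ch /andP[ik kp] eik; have ip : i < size (y :: p) by apply: ltn_trans ik _.
have inj a b : a <= size p -> b <= size p -> nth y (y :: p) a = nth y (y :: p) b -> a = b.
  by move=> ap bp /eqP; rewrite nth_uniq // => /eqP.
have ne : nth y (y :: p) i != nth y (y :: p) k.
  by rewrite nth_uniq // neq_ltn ik.
have : [set nth y (y :: p) i; nth y (y :: p) k] \in cycle_edges (y :: p).
  have /forall_inP/(_ _ (mem_nth y ip))/forall_inP/(_ _ (mem_nth y (kp : k < size (y :: p)))) := ch.
  by rewrite eik.
case/(cycle_edgesP uc) => [[a ap]|] /(set2_eq ne).
  case=> -[/inj h1 /inj h2].
    by left; rewrite (h1 ip (ltnW ap)) (h2 kp ap).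
  by move: ik; rewrite (h1 ip ap) (h2 kp (ltnW ap)) ltnNge leqnSn.
rewrite (last_nth y) => -[] [e1 e2].
  by right; rewrite (inj i 0 ip (leq0n _) e1) (inj k _ kp (leqnn _) e2).
by move: ik; rewrite (inj k 0 kp (leq0n _) e2).
Qed.

Lemma last_take_nth x p k : k <= size p -> last x (take k p) = nth x (x :: p) k.
Proof.
by move=> kp; rewrite (last_nth x) size_takel // -[x :: take k p]/(take k.+1 (x :: p)) nth_take.
Qed.

Lemma drop_path x p k : k <= size p -> path e x p -> path e (nth x (x :: p) k) (drop k p).
Proof.
by move=> kp; rewrite -{1}(cat_take_drop k p) cat_path last_take_nth // => /andP[].
Qed.

Lemma last_drop_nth x p k : k <= size p -> last (nth x (x :: p) k) (drop k p) = last x p.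
Proof.
by move=> kp; rewrite -{3}(cat_take_drop k p) last_cat last_take_nth.
Qed.

Lemma shortcut x p i k : path e x p -> i.+1 < k <= size p ->
  e (nth x (x :: p) i) (nth x (x :: p) k) ->
  exists p', [/\ path e x p', last x p' = last x p, {subset p' <= p} & size p' < size p].
Proof.
move=> xp /andP[ik kp] eik; exists (take i p ++ nth x (x :: p) k :: drop k p).
have ip : i <= size p by lia.
split.
- rewrite cat_path last_take_nth //= eik drop_path // !andbT.
  by move: xp; rewrite -{1}(cat_take_drop i p) cat_path => /andP[].
- by rewrite last_cat /= last_drop_nth.
- move=> y; rewrite mem_cat inE => /or3P[/mem_take //|/eqP->|/mem_drop //].
  by case: k ik kp {eik} => // k _ kp /=; apply: mem_nth.
by rewrite size_cat size_takel //= size_drop; lia.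
Qed.

(* Otherwise a shortest walk avoiding v closes up, through v, to an induced cycle. *)
Lemma link_constant (C : Type) (c : T -> C) (A : {set T}) v :
    v \in A ->
    no_induced_cycle A ->
    (forall x y, x \in A -> y \in A -> e v x -> e v y -> e x y -> c x = c y) ->
  forall x p, path e x p -> {subset x :: p <= A :\ v} -> e v x -> e v (last x p) ->
  c x = c (last x p).
Proof.
move=> vA noc loc x p; have [m] := ubnP (size p); elim: m x p => // m IH x p pm.
case/shortenP=> p' xp' up' sub' sub vx; set z := last x p' => vz.
have p'm : size p' < m.+1.
  by apply: leq_ltn_trans pm; apply: uniq_leq_size; [case/andP: up'|].
have {sub sub'}sub : {subset x :: p' <= A :\ v}.
  move=> y; rewrite inE => /orP[/eqP->|/sub' yp]; apply: sub; rewrite inE ?eqxx //.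
  by rewrite yp orbT.
case/lastP: p' => [//|p1 z'] in xp' up' z vz p'm sub *.
have zE : z = z' by rewrite /z last_rcons.
(* An inner vertex adjacent to [v] cuts the walk into two shorter walks between neighbours of
   [v]. *)
have [/hasP[y yp1 vy]|noN] := boolP (has (e v) p1).
  case/splitPr: yp1 => p2 p3 in xp' up' z vz p'm sub zE *.
  have pE : rcons (p2 ++ y :: p3) z' = rcons p2 y ++ rcons p3 z'.
    by rewrite rcons_cat cat_rcons.
  move: xp'; rewrite pE cat_path last_rcons => /andP[xp2 yp3].
  rewrite pE in sub p'm; rewrite size_cat !size_rcons addSn addnS ltnS in p'm.
  have vz' : e v z' by rewrite -zE.
  transitivity (c y).
    rewrite -(last_rcons x p2 y); apply: IH; rewrite ?size_rcons ?last_rcons //.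
      by apply: leq_trans p'm; rewrite !ltnS leq_addr.
    move=> w; rewrite inE => /orP[/eqP->|wp]; apply: sub; rewrite inE ?eqxx //.
    by rewrite mem_cat wp orbT.
  rewrite zE -(last_rcons y p3 z'); apply: IH; rewrite ?size_rcons ?last_rcons //.
    by apply: leq_trans p'm; rewrite !ltnS leq_addl.
  move=> w; rewrite inE => /orP[/eqP->|wp]; apply: sub; rewrite inE mem_cat.
    by rewrite mem_rcons inE eqxx orbT.
  by rewrite wp !orbT.
set p' := rcons p1 z' in xp' up' z vz p'm sub zE *.
(* A chord, possibly between the two ends, gives a shorter walk with the same ends. *)
have [/existsP[i /existsP[k /andP[ik eik]]]|nochord] :=
  boolP [exists i : 'I_(size p').+1, exists k : 'I_(size p').+1,
    (i.+1 < k) && e (nth x (x :: p') i) (nth x (x :: p') k)].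
  have kp : i.+1 < k <= size p' by rewrite ik -ltnS ltn_ord.
  have [p2 [xp2 lp2 sub2 s2]] := shortcut xp' kp eik.
  rewrite /z -lp2; apply: IH => //; last by rewrite lp2.
    by apply: leq_trans s2 _; rewrite -ltnS.
  move=> y; rewrite inE => /orP[/eqP->|/sub2 yp]; apply: sub; rewrite inE ?eqxx //.
  by rewrite yp orbT.
have sA y : y \in x :: p' -> (y \in A) && (y != v) by move=> /sub; rewrite !inE andbC.
have [xA _] := andP (sA _ (mem_head _ _)); have [zA _] := andP (sA _ (mem_last x p')).
(* A single edge is the local hypothesis. From two edges on, the walk has neither chord nor inner
   neighbour of [v], so [v] closes it to an induced cycle of length at least 4. *)
case: (ltnP 1 (size p')) => p'2; last first.
  apply: loc => //; move: xp' p'2; rewrite /z /p'; case: (p1) => [|a [|b s]] //=.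
  by rewrite andbT.
case: (noc (v :: x :: p')); last first.
  by move=> y; rewrite inE => /orP[/eqP->//|/sA /andP[]].
have uvp : uniq (v :: x :: p').
  rewrite cons_uniq up' andbT; apply/negP=> /sA; by rewrite eqxx andbF.
apply/and3P; split => //.
  by rewrite /ucycleb uvp andbT /= vx rcons_path xp' e_sym.
apply: chordless_nth => // -[|i] [|k] //=; rewrite !ltnS.
  case: k => [|k] kp; first by left.
  rewrite (set_nth_default x) //= => h; right; split => //.
  move: noN kp h; rewrite /p' size_rcons => noN kp.
  rewrite nth_rcons; case: (ltngtP k (size p1)) kp => [kp1 _|gt|-> //];
      last by rewrite ltnS leqNgt gt.
  by move=> h; case/negP: noN; apply/hasP; exists (nth x p1 k); rewrite ?mem_nth.
move=> /andP[ik kp]; have ip : i < (size p').+1 by rewrite ltnS ltnW // (leq_trans ik).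
rewrite !(set_nth_default x v) //.
move=> h; left; congr _.+1; apply/eqP; apply: contraNT nochord => ki.
apply/existsP; exists (Ordinal ip); apply/existsP; exists (Ordinal (kp : k < (size p').+1)) => /=.
by rewrite h andbT; lia.
Qed.

End InducedCycles.

(** * Induced cycles counted by their vertex sets *)

Section CycleSets.
Variables (T : finType) (e : rel T).
Hypothesis e_sym : ssrbool.symmetric e.

Definition cycle_sets t : {set {set T}} :=
  [set [set x in c] | c : t.-tuple T & ucycleb e c && chordless e c].

Definition inner_edges (S : {set T}) : {set {set T}} :=
  [set [set u.1; u.2] | u : T * T & [&& u.1 \in S, u.2 \in S & e u.1 u.2]].

Lemma cycle_edges_inner (c : seq T) : ucycleb e c -> chordless e c ->
  cycle_edges c = inner_edges [set x in c].
Proof.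
move=> /andP[cyc _] ch; apply/setP=> S; apply/imsetP/imsetP.
  move=> [x xc ->]; exists (x, next c x) => //.
  by rewrite !inE /= mem_next xc next_cycle.
move=> [[x y]]; rewrite !inE /= => /and3P[xc yc exy] ->.
have /forall_inP/(_ x xc)/forall_inP/(_ y yc) := ch; rewrite exy => /imsetP[z zc ->].
by exists z.
Qed.

Lemma cover_cycle_edges (c : seq T) : cover (cycle_edges c) = [set x in c].
Proof.
apply/setP=> x; rewrite inE; apply/bigcupP/idP.
  by move=> [S /imsetP[y yc ->]]; rewrite in_set2 => /orP[]/eqP->; rewrite ?mem_next.
move=> xc; exists [set x; next c x]; last by rewrite set21.
by apply/imsetP; exists x.
Qed.

(** Multidegrees see a cycle through its vertices, while the theorem counts edge sets. The edges of
    a chordless cycle are all edges inside its vertex set, and its vertices are the union of its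
    edges; the surjections [inner_edges] and [cover] bound the cardinals both ways. *)
Lemma card_induced_cycles t : #|induced_cycles e t| = #|cycle_sets t|.
Proof.
apply/eqP; rewrite eqn_leq; apply/andP; split.
  rewrite (_ : induced_cycles e t = inner_edges @: cycle_sets t) ?leq_imset_card //.
  apply/setP=> S; apply/imsetP/imsetP => [[c cc ->]|[A /imsetP[c cc ->] ->]].
    exists [set x in c]; first by apply/imsetP; exists c.
    by move: cc; rewrite inE => /andP[cu ch]; apply: cycle_edges_inner.
  by exists c => //; move: cc; rewrite inE => /andP[cu ch]; rewrite cycle_edges_inner.
rewrite (_ : cycle_sets t = @cover T @: induced_cycles e t) ?leq_imset_card //.
apply/setP=> S; apply/imsetP/imsetP => [[c cc ->]|[A /imsetP[c cc ->] ->]].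
  by exists (cycle_edges c); rewrite ?cover_cycle_edges //; apply/imsetP; exists c.
by exists c => //; rewrite cover_cycle_edges.
Qed.

Lemma mem_cycle_sets (c : seq T) :
  induced_cycle e c -> [set x in c] \in cycle_sets (size c).
Proof.
move=> /and3P[cu ch _]; apply/imsetP; exists (in_tuple c) => //.
by rewrite inE cu ch.
Qed.

Lemma cycle_setsP t S : 4 <= t -> S \in cycle_sets t ->
  exists c, [/\ induced_cycle e c, size c = t & S = [set x in c]].
Proof.
move=> t4 /imsetP[c]; rewrite inE => /andP[cu ch] ->; exists c.
by rewrite size_tuple /induced_cycle cu ch size_tuple.
Qed.

Lemma induced_cycles_neq0P t : 4 <= t ->
  reflect (exists2 c, induced_cycle e c & size c = t) (induced_cycles e t != set0).
Proof.
move=> t4; rewrite -card_gt0 card_induced_cycles card_gt0.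
apply: (iffP (set0Pn _)) => [[S /(cycle_setsP t4)[c [cc ct _]]]|[c cc ct]].
  by exists c.
by exists [set x in c]; rewrite -ct mem_cycle_sets.
Qed.

End CycleSets.

(** * Disjoint edge pairs and four-cycles of the complement *)

Section EdgePairs.
Variables (T : finType) (e : rel T).
Hypothesis e_sym : ssrbool.symmetric e.
Local Notation ec := (fun x y => (x != y) && ~~ e x y).
Local Notation pairs := (induced_disjoint_edge_pairs e).

Lemma edgesP S : reflect (exists x y, e x y /\ S = [set x; y]) (S \in edges e).
Proof.
apply: (iffP imsetP) => [[[x y]]|[x [y [exy ->]]]]; last by exists (x, y); rewrite ?inE.
by rewrite inE => exy ->; exists x, y.
Qed.

Lemma mem_pairs S1 S2 : S1 \in edges e -> S2 \in edges e -> [disjoint S1 & S2] ->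
  (forall x y, x \in S1 -> y \in S2 -> ~~ e x y) -> [set S1; S2] \in pairs.
Proof.
move=> E1 E2 dis non.
have S12 : S1 != S2.
  case/edgesP: E1 dis => x [y [_ ->]] dis; apply/eqP=> S; rewrite -S in dis.
  by have := disjointFr dis (set21 x y); rewrite set21.
rewrite inE subUset !sub1set E1 E2 cards2 S12 /=.
apply/forall_inP=> A; rewrite in_set2 => AP; apply/forall_inP=> B; rewrite in_set2 => BP.
apply/implyP=> AB; case/orP: AP BP AB => /eqP-> /orP[]/eqP->; rewrite ?eqxx // => _.
  rewrite dis; apply/forall_inP=> x xS; apply/forall_inP=> y yS.
  by rewrite [e y x]e_sym non.
rewrite disjoint_sym dis; apply/forall_inP=> x xS; apply/forall_inP=> y yS.
by rewrite [e x y]e_sym non.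
Qed.

Lemma pairsP P : P \in pairs -> exists S1 S2,
  [/\ P = [set S1; S2], S1 \in edges e, S2 \in edges e, [disjoint S1 & S2] &
      forall x y, x \in S1 -> y \in S2 -> ~~ e x y].
Proof.
rewrite inE => /and3P[/subsetP PE /cards2P[S1 [S2 [S12 PS]]] /forall_inP h].
exists S1, S2; have P1 : S1 \in P by rewrite PS set21.
have P2 : S2 \in P by rewrite PS set22.
have /forall_inP/(_ _ P2) := h _ P1; rewrite S12 => /andP[dis /forall_inP non].
split; rewrite ?PE // => x y xS yS.
by have /forall_inP/(_ _ yS)/andP[] := non _ xS.
Qed.

(** The diagonals of an induced four-cycle of the complement are non-edges there, hence edges of
    [e], and its sides say that no edge of [e] joins them. [pair_four_cycle] is the converse for two
    edges that are not loops. *)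
Lemma four_cycle_pair c : induced_cycle ec c -> size c = 4 ->
  exists x0 x1 x2 x3, [/\ c = [:: x0; x1; x2; x3], uniq c, e x0 x2, e x1 x3 &
    [set [set x0; x2]; [set x1; x3]] \in pairs].
Proof.
case: c => [|x0 [|x1 [|x2 [|x3 [|]]]]] //= /and3P[/andP[/= cyc un] ch _] _.
exists x0, x1, x2, x3.
case/and5P: cyc => /andP[_ e01] /andP[_ e12] /andP[_ e23] /andP[_ e30] _.
have ni i k : i < k <= 3 -> k <> i.+1 -> ~ (i = 0 /\ k = 3) ->
    e (nth x0 [:: x0; x1; x2; x3] i) (nth x0 [:: x0; x1; x2; x3] k).
  move=> ik k1 k3; have := @chordless_index _ ec x0 [:: x1; x2; x3] i k un ch ik.
  have -> : nth x0 [:: x0; x1; x2; x3] i != nth x0 [:: x0; x1; x2; x3] k.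
    by rewrite nth_uniq //=; lia.
  by case: (e _ _) => // /(_ isT) [].
have e02 : e x0 x2 by apply: (ni 0 2) => // -[].
have e13 : e x1 x3 by apply: (ni 1 3) => // -[].
split=> //; apply: mem_pairs.
- by apply/edgesP; exists x0, x2.
- by apply/edgesP; exists x1, x3.
- move: un; rewrite /= !inE !negb_or => /and4P[/and3P[n01 n02 n03] /andP[n12 n13] n23 _].
  rewrite disjoint_subset; apply/subsetP=> x; rewrite in_set2 inE in_set2 negb_or.
  by move=> /orP[]/eqP->; rewrite ?n01 ?n03 ?n23 //= eq_sym n12.
by move=> x y; rewrite !in_set2 => /orP[]/eqP-> /orP[]/eqP->; rewrite // e_sym.
Qed.

Lemma pair_four_cycle a a' b b' : e a a' -> e b b' -> a != a' -> b != b' ->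
    [disjoint [set a; a'] & [set b; b']] ->
    (forall x y, x \in [set a; a'] -> y \in [set b; b'] -> ~~ e x y) ->
  induced_cycle ec [:: a; b; a'; b'].
Proof.
move=> eaa ebb naa nbb dis non.
have ne x y : x \in [set a; a'] -> y \in [set b; b'] -> x != y.
  by move=> xS yS; apply: contraTneq yS => <-; rewrite (disjointFr dis).
have nn x y : x \in [set a; a'] -> y \in [set b; b'] -> ec x y.
  by move=> xS yS; rewrite ne //= non.
have ecs : ssrbool.symmetric ec by move=> x y; rewrite eq_sym e_sym.
have sa := set21 a a'; have sa' := set22 a a'; have sb := set21 b b'; have sb' := set22 b b'.
have un : uniq [:: a; b; a'; b'].
  have nba : b != a' by rewrite eq_sym ne.
  by rewrite /= !inE !negb_or naa nbb nba (ne a b) // (ne a b') // (ne a' b').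
have ec_irr : irreflexive ec by move=> x; rewrite eqxx.
apply/and3P; split=> //.
  rewrite /ucycleb un andbT /= -!/(ec _ _).
  have [h1 h2 h3 h4] : [/\ ec a b, ec b a', ec a' b' & ec b' a].
    by split; [exact: nn|rewrite ecs; exact: nn|exact: nn|rewrite ecs; exact: nn].
  by rewrite h1 h2 h3 h4.
apply: (chordless_nth ecs ec_irr un) => i k /andP[ik k3].
case: i k ik k3 => [|[|[|[|i]]]] [|[|[|[|k]]]] //=; rewrite ?eaa ?ebb ?andbF //; by [left|right|].
Qed.

End EdgePairs.

Local Open Scope ring_scope.

(** * Dimension counts: connecting isomorphism and graded pieces *)

Section KoszulShift.
Variables (K : fieldType) (U W : vectType K).
Variables (d : 'Hom(U, W)) (du : 'End(U)) (dw : 'End(W)) (S : nat -> {vspace U}).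

(* M := S / ker d and N := ker d: the connecting isomorphism H_(q+1)(M) = H_q(N) of
   0 -> N -> S -> M -> 0, stated additively and obtained by counting dimensions. *)
Lemma koszul_shift q :
    (forall u, d (du u) = dw (d u)) ->
    (du @: S q.+1 <= S q)%VS ->
    (S q.+1 :&: lker du = du @: S q.+2)%VS ->
    (S q :&: lker d :&: lker du = S q :&: lker d :&: du @: S q.+1)%VS ->
  (\dim (d @: S q.+1 :&: lker dw) + \dim (du @: (S q.+1 :&: lker d)) =
   \dim (S q :&: lker d :&: lker du) + \dim (dw @: (d @: S q.+2)))%N.
Proof.
move=> comm stab exa mini.
(* [X] is the preimage of the cycles of M. Rank-nullity on [X] along [d] and along [du], then once
   more on the two kernels, produces the summand [S q.+1 :&: lker d :&: lker du] on both sides,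
   where it cancels. *)
pose X := (S q.+1 :&: lker (dw \o d))%VS.
have memX u : (u \in X) = (u \in S q.+1) && (dw (d u) == 0).
  by rewrite memv_cap memv_ker comp_lfunE.
have X1 : (X :&: lker d = S q.+1 :&: lker d)%VS.
  apply/vspaceP=> u; rewrite !memv_cap !memv_ker comp_lfunE.
  by case: (d u =P 0) => [->|]; rewrite ?andbF // linear0 eqxx !andbT.
have X2 : (d @: X = d @: S q.+1 :&: lker dw)%VS.
  apply/vspaceP=> w; apply/memv_imgP/idP.
    move=> [u]; rewrite memX => /andP[uS /eqP u0] ->.
    by rewrite memv_cap memv_ker u0 eqxx andbT memv_img.
  rewrite memv_cap memv_ker => /andP[/memv_imgP[u uS ->] /eqP u0].
  by exists u; rewrite // memX uS u0 eqxx.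
have X3 : (X :&: lker du = S q.+1 :&: lker du)%VS.
  apply/vspaceP=> u; rewrite !memv_cap !memv_ker comp_lfunE -comm.
  by case: (du u =P 0) => [->|]; rewrite ?andbF // linear0 eqxx !andbT.
(* This is the surjectivity of the connecting map: by [mini] a cycle of N is [du u] for some [u] in
   [S q.+1], and such a [u] lies in [X]. *)
have X4 : (du @: X = S q :&: lker d :&: lker du)%VS.
  rewrite mini; apply/vspaceP=> w; apply/memv_imgP/idP.
    move=> [u]; rewrite memX => /andP[uS /eqP u0] ->.
    rewrite !memv_cap memv_ker comm u0 eqxx memv_img // !andbT.
    by rewrite (subvP stab) // memv_img.
  rewrite !memv_cap memv_ker => /andP[/andP[wS /eqP w0] /memv_imgP[u uS uE]].
  by exists u; rewrite // memX uS -comm -uE w0 eqxx.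
have X5 : (dw @: (d @: S q.+2) = d @: (S q.+1 :&: lker du))%VS.
  rewrite exa -!limg_comp; apply: eq_in_limg => u _.
  by rewrite !comp_lfunE comm.
have := limg_ker_dim d X; have := limg_ker_dim du X.
rewrite X1 X2 X3 X4 X5.
have := limg_ker_dim d (S q.+1 :&: lker du).
have := limg_ker_dim du (S q.+1 :&: lker d).
rewrite -!capvA (capvC (lker d)); lia.
Qed.

End KoszulShift.

Section IdempotentDim.
Variables (K : fieldType) (V : vectType K) (G : finType) (pr : G -> 'End(V)).
Hypothesis prE : forall g h v, pr g (pr h v) = if g == h then pr g v else 0.
Hypothesis pr_sum : forall v, v = \sum_g pr g v.

(** Orthogonal idempotents with sum one split every subspace that they preserve. Applied to the
    projections onto multidegrees, this lets cycles and boundaries be counted one multidegree at a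
    time. *)
Lemma dim_sum_idempotents (U : {vspace V}) :
  (forall g, (pr g @: U <= U)%VS) -> \dim U = (\sum_g \dim (pr g @: U))%N.
Proof.
move=> stab.
have -> : U = (\sum_g pr g @: U)%VS.
  apply/eqP; rewrite eqEsubv; apply/andP; split; last first.
    by apply/subv_sumP => g _.
  apply/subvP => v vU; rewrite [v]pr_sum; apply: memv_sumr => g _.
  exact: memv_img.
rewrite (directvP _) /=.
  apply: eq_bigr => g _; congr (\dim _).
  apply/eqP; rewrite eqEsubv; apply/andP; split; last first.
    by apply: limgS; apply/subv_sumP => h _.
  apply/subvP => v /memv_imgP[u uU ->].
  have -> : pr g u = pr g (pr g u) by rewrite prE eqxx.
  apply: memv_img; apply: (subvP (sumv_sup g _ (subvv _))) => //.
  exact: memv_img.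
apply/directv_sum_independent => us us_in sum0 g _.
have usE h : us h = pr h (us h).
  by have /memv_imgP[u _ ->] := us_in h isT; rewrite prE eqxx.
have : pr g (\sum_h us h) = us g.
  rewrite linear_sum (bigD1 g) //= -usE big1 ?addr0 // => h hg.
  by rewrite usE prE eq_sym (negPf hg).
by move=> <-; rewrite sum0 linear0.
Qed.

End IdempotentDim.

(** * The Koszul boundary on functions of finite sets *)

Section Boundary.
Variables (K : fieldType) (n : nat).
Local Notation T := 'I_n.
Implicit Types (v w : T) (t : {set T}) (u : {set T} -> K).

Definition sgn v t : K := (-1) ^+ #|[set x in t | x < v]%N|.

(** The Koszul differential on coefficients: [u t] is the coefficient of [e_t], and the new
    coefficient at [t] collects those of the sets with one more element. The factor [x_v] is
    implicit, the total multidegree being fixed. *)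
Definition bd u t : K := \sum_(v | v \notin t) sgn v t * u (v |: t).

Lemma sgnU v w t : w \notin t -> sgn v (w |: t) = (-1) ^+ (w < v)%N * sgn v t.
Proof.
move=> wt; rewrite /sgn -exprD; congr (_ ^+ _).
case: (ltnP w v) => wv.
  transitivity #|w |: [set x in t | (x < v)%N]|; last first.
    by rewrite cardsU1 inE (negPf wt).
  by apply: eq_card => x; rewrite !inE; case: eqP => [->|]; rewrite ?wv.
apply: eq_card => x; rewrite !inE; case: eqP => [->|] //=.
by rewrite ltnNge wv andbF.
Qed.

Lemma sgn_sq v t : sgn v t * sgn v t = 1.
Proof. by rewrite /sgn -expr2 sqrr_sign. Qed.

Lemma sgn_neq0 v t : sgn v t != 0.
Proof. by rewrite /sgn signr_eq0. Qed.

Lemma sgn_anti v w t : v != w -> v \notin t -> w \notin t ->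
  sgn v t * sgn w (v |: t) = - (sgn w t * sgn v (w |: t)).
Proof.
move=> vw vt wt; rewrite !sgnU //.
case: (ltngtP v w) => [h|h|/val_inj h]; last by rewrite h eqxx in vw.
  by rewrite expr1 expr0; ring.
by rewrite expr1 expr0; ring.
Qed.

Lemma eq_bd u u' t : u =1 u' -> bd u t = bd u' t.
Proof. by move=> uu'; apply: eq_bigr => v _; rewrite uu'. Qed.

Lemma bdB u u' t : bd (fun x => u x - u' x) t = bd u t - bd u' t.
Proof. by rewrite /bd -sumrB; apply: eq_bigr => v _; rewrite mulrBr. Qed.

Lemma bdD u u' t : bd (fun x => u x + u' x) t = bd u t + bd u' t.
Proof. by rewrite /bd -big_split; apply: eq_bigr => v _ /=; rewrite mulrDr. Qed.

Lemma bdZ c u t : bd (fun x => c * u x) t = c * bd u t.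
Proof. by rewrite /bd mulr_sumr; apply: eq_bigr => v _ /=; rewrite mulrCA. Qed.

Lemma bd_bd u t : bd (bd u) t = 0.
Proof.
rewrite /bd.
pose f v w := sgn v t * sgn w (v |: t) * u (w |: (v |: t)).
transitivity (\sum_v \sum_(w | [&& v \notin t, w \notin t & v != w]) f v w).
  rewrite big_mkcond; apply: eq_bigr => v _; case: ifP => vt; last first.
    by rewrite big_pred0.
  rewrite mulr_sumr; apply: eq_big => [w|w _]; last by rewrite mulrA.
  by rewrite !inE negb_or eq_sym andbC.
(* The terms of (v, w) and (w, v) cancel by [sgn_anti]; the sum is cut by the order of the two
   vertices and one half is reindexed by the swap. *)
rewrite pair_big_dep /= (bigID (fun p : T * T => p.1 < p.2)%N) /=.
rewrite [X in _ + X](reindex_inj (h := fun p : T * T => (p.2, p.1))) /=; last first.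
  by move=> [a b] [c e] [-> ->].
rewrite -[X in X + _]opprK addrC; apply/eqP; rewrite subr_eq0; apply/eqP.
rewrite -sumrN; apply: eq_big => [[v w]|[v w]] /=.
  rewrite [w == v]eq_sym; case: (eqVneq v w) => [->|vw] /=; first by rewrite !andbF /= ?andbF.
  rewrite !andbT andbC; case: (v \notin t); case: (w \notin t); rewrite /= ?andbF //.
  by case: (ltngtP v w) => // /val_inj h; rewrite h eqxx in vw.
move=> /andP[/and3P[wt vt wv] _]; rewrite /f sgn_anti // setUCA.
by ring.
Qed.

(** Exterior multiplication by [e_v]. By [bd_homotopyE] it is a contraction wherever it preserves
    the chains at hand: the source of the cone arguments and of the exactness of the Koszul
    complex. *)
Definition bd_homotopy v u t : K := if v \in t then sgn v (t :\ v) * u (t :\ v) else 0.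

Lemma bd_homotopyE v u t : bd (bd_homotopy v u) t + bd_homotopy v (bd u) t = u t.
Proof.
rewrite {2}/bd_homotopy; case: ifPn => vt; last first.
  rewrite addr0 /bd (bigD1 v) //= big1 ?addr0 => [|w /andP[wt wv]].
    by rewrite /bd_homotopy setU11 setU1K // mulrA sgn_sq mul1r.
  by rewrite /bd_homotopy !inE eq_sym (negPf wv) (negPf vt) mulr0.
have vr : v \notin t :\ v by rewrite in_setD1 eqxx.
rewrite {2}/bd (bigD1 v) //= mulrDr mulrA sgn_sq mul1r setD1K //.
rewrite addrA addrAC -[RHS]add0r; congr (_ + _).
rewrite mulr_sumr /bd.
rewrite [X in _ + X](eq_bigl (fun w => w \notin t)); last first.
  move=> w; rewrite in_setD1 negb_and negbK; case: (eqVneq w v) => [->|_] /=.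
    by rewrite vt.
  by rewrite andbT.
rewrite -big_split big1 //= => w wt.
have wv : w != v by apply: contraNneq wt => ->.
have wr : w \notin t :\ v by rewrite !inE negb_and wt orbT.
rewrite /bd_homotopy !inE vt orbT.
have -> : (w |: t) :\ v = w |: (t :\ v).
  by apply/setP=> x; rewrite !inE; case: (eqVneq x w) => [->|]; rewrite ?wv.
rewrite !mulrA -mulrDl -{1}(setD1K vt).
have := sgn_anti wv wr vr.
rewrite [sgn w (v |: _)]sgnU // ![sgn v (w |: _)]sgnU //.
case: (ltngtP v w) => [h|h|/val_inj h]; last by rewrite h eqxx in wv.
  by move=> _; rewrite expr1 expr0; ring.
by move=> _; rewrite expr1 expr0; ring.
Qed.

Definition supported (Y : pred {set T}) q u := forall t, u t != 0 -> Y t && (#|t| == q).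

(** The boundary is tested at members of [Y] only: for convex [Y] the complex is a subquotient of
    the full Koszul complex, and values of [bd] outside [Y] are discarded. *)
Definition is_cycle (Y : pred {set T}) u := forall t, Y t -> bd u t = 0.

Definition is_boundary (Y : pred {set T}) q u :=
  exists w : {set T} -> K, supported Y q.+1 w /\ forall t, Y t -> bd w t = u t.

Definition acyclic_at (Y : pred {set T}) q :=
  forall u, supported Y q u -> is_cycle Y u -> is_boundary Y q u.

Definition one_dim_at (Y : pred {set T}) q :=
  exists u0 : {set T} -> K, [/\ supported Y q u0, is_cycle Y u0, ~ is_boundary Y q u0 &
    forall u, supported Y q u -> is_cycle Y u ->
      exists c, is_boundary Y q (fun t => u t - c * u0 t)].

End Boundary.

(* Cardinals over 'I_n occur both with and without reverse_coercion in their type;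
   lia needs them syntactically equal. *)
Ltac card_lia := unfold reverse_coercion in *; lia.

(** * Families of sets: vertex removal by deletion and link *)

Section Families.
Variables (K : fieldType) (n : nat).
Local Notation T := 'I_n.
Local Notation sgn := (sgn K).
Local Notation acyclic_at := (acyclic_at K).
Local Notation one_dim_at := (one_dim_at K).
Implicit Types (Y : pred {set T}) (v x y : T) (t E A : {set T}) (u w f : {set T} -> K).

Lemma eq_acyclic Y Y' q : Y =1 Y' -> acyclic_at Y q -> acyclic_at Y' q.
Proof.
move=> YY' ac u uS uc.
have [|t tY|w [wS wE]] := ac u.
- by move=> t /uS; rewrite YY'.
- by apply: uc; rewrite -YY'.
by exists w; split=> [t /wS|t tY]; rewrite -?YY' //; apply: wE; rewrite YY'.
Qed.

Lemma eq_one_dim Y Y' q : Y =1 Y' -> one_dim_at Y q -> one_dim_at Y' q.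
Proof.
move=> YY' [u0 [u0S u0c u0b gen]].
have bY u : is_boundary Y q u -> is_boundary Y' q u.
  move=> [w [wS wE]].
  by exists w; split=> [t /wS|t tY]; rewrite -?YY' //; apply: wE; rewrite YY'.
have bY' u : is_boundary Y' q u -> is_boundary Y q u.
  move=> [w [wS wE]].
  by exists w; split=> [t /wS|t tY]; rewrite ?YY' //; apply: wE; rewrite -YY'.
exists u0; split=> [t /u0S|t tY|/bY' //|u uS uc]; rewrite -?YY' //.
  by apply: u0c; rewrite YY'.
have [|t tY|c cb] := gen u; last by exists c; apply: bY.
  by move=> t /uS; rewrite YY'.
by apply: uc; rewrite -YY'.
Qed.

Lemma bd0 t : bd (fun=> 0 : K) t = 0.
Proof. by rewrite /bd big1 // => v _; rewrite mulr0. Qed.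

Lemma acyclic_empty Y q : (forall t, Y t -> #|t| = q -> False) -> acyclic_at Y q.
Proof.
move=> Y0 u uS _; exists (fun=> 0); split=> [t|t tY]; first by rewrite eqxx.
rewrite bd0; apply/esym/eqP; apply: contraT => /uS /andP[h /eqP tq].
by case: (Y0 t).
Qed.

(** Since membership ignores [v], the homotopy at [v] stays inside the family and contracts it. *)
Lemma acyclic_toggle Y v q : (forall t, Y (v |: t) = Y t) -> acyclic_at Y q.
Proof.
move=> Yv u uS uc; exists (bd_homotopy v u); split=> t.
  rewrite /bd_homotopy; case: ifP => vt; last by rewrite eqxx.
  rewrite mulf_eq0 negb_or => /andP[_ /uS].
  by rewrite -Yv setD1K // => /andP[-> /eqP tq]; rewrite (cardsD1 v) vt tq eqxx.
move=> tY; rewrite -[RHS](bd_homotopyE v u t) [X in _ + X](_ : _ = 0) ?addr0 //.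
rewrite /bd_homotopy; case: ifP => // vt; rewrite uc ?mulr0 //.
by rewrite -Yv setD1K.
Qed.

Definition convex Y := forall s t t' : {set T}, s \subset t -> t \subset t' -> Y s -> Y t' -> Y t.

(** A set between two members of a convex family is a member, so truncating [bd w] to [Y] drops only
    zero terms of [bd (bd w)]. *)
Lemma bd_restrict Y w q t : convex Y -> supported Y q w -> Y t ->
  bd (fun s => if Y s then bd w s else 0) t = 0.
Proof.
move=> cY wS tY; rewrite -[RHS](bd_bd w t).
apply: eq_bigr => v vt; case: ifPn => // nY; congr (_ * _); apply/esym.
rewrite /bd big1 // => x xt; case: (eqVneq (w (x |: (v |: t))) 0) => [->|/wS].
  by rewrite mulr0.
by case/andP=> h _; case/negP: nY; apply: (cY t _ (x |: (v |: t))); rewrite // subsetUr.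
Qed.

Lemma bd_card w Y q t : supported Y q.+1 w -> #|t| != q -> bd w t = 0.
Proof.
move=> wS tq; apply: big1 => v vt; case: (eqVneq (w (v |: t)) 0) => [->|/wS].
  by rewrite mulr0.
by rewrite cardsU1 vt add1n eqSS (negPf tq) andbF.
Qed.

(** At a set containing [v], [bd] sees only sets containing [v]. So the part of [u] on such sets is
    itself a cycle, and the boundary in [Y] of a primitive of it clears it from [u]. *)
Lemma reduce_cycle Y v q u : convex Y ->
    acyclic_at (fun t => Y t && (v \in t)) q -> supported Y q u -> is_cycle Y u ->
  exists u1, [/\ supported (fun t => Y t && (v \notin t)) q u1, is_cycle Y u1 &
                 is_boundary Y q (fun t => u t - u1 t)].
Proof.
move=> cY ac uS uc.
have [|t /andP[tY vt]|w [wS wE]] := ac (fun t => if v \in t then u t else 0).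
- by move=> t; case: ifP => [vt /uS|]; rewrite ?vt ?andbT ?eqxx.
- by rewrite -[RHS](uc _ tY); apply: eq_bigr => x _; rewrite !inE vt orbT.
have wS' : supported Y q.+1 w by move=> t /wS /andP[/andP[-> _]].
pose b t : K := if Y t then bd w t else 0.
have bS : supported Y q b.
  move=> t; rewrite /b; case: ifP => [_|]; last by rewrite eqxx.
  by apply: contraR => /= tq; rewrite (bd_card wS').
exists (fun t => u t - b t); split.
- move=> t h; have : Y t && (#|t| == q).
    case: (eqVneq (u t) 0) => [ut|/uS //]; apply: bS.
    by move: h; rewrite ut add0r oppr_eq0.
  move=> /andP[tY ->]; rewrite tY andbT /=; apply: contraNN h => vt.
  by rewrite /b tY wE ?tY // vt subrr.
- by move=> t tY; rewrite bdB uc // (bd_restrict cY wS') // subrr.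
exists w; split=> // t tY; rewrite opprB addrCA subrr addr0 /b tY //.
Qed.

Lemma is_boundaryD Y q u u' : is_boundary Y q u -> is_boundary Y q u' ->
  is_boundary Y q (fun t => u t + u' t).
Proof.
move=> [w [wS wE]] [w' [w'S w'E]]; exists (fun t => w t + w' t); split=> t.
  case: (eqVneq (w t) 0) => [->|/wS //]; rewrite add0r; exact: w'S.
by move=> tY; rewrite bdD wE // w'E.
Qed.

Lemma eq_boundary Y q u u' : (forall t, Y t -> u t = u' t) ->
  is_boundary Y q u -> is_boundary Y q u'.
Proof. by move=> uu' [w [wS wE]]; exists w; split=> // t tY; rewrite wE ?uu'. Qed.

Lemma acyclic_step Y v q : convex Y ->
    acyclic_at (fun t => Y t && (v \in t)) q ->
    acyclic_at (fun t => Y t && (v \notin t)) q -> acyclic_at Y q.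
Proof.
move=> cY ac1 ac2 u uS uc.
have [u1 [u1S u1c b1]] := reduce_cycle cY ac1 uS uc.
suff b2 : is_boundary Y q u1.
  by apply: eq_boundary (is_boundaryD b1 b2) => t _; rewrite subrK.
have [|w [wS wE]] := ac2 u1 u1S; first by move=> t /andP[tY _]; apply: u1c.
exists w; split=> [t /wS /andP[/andP[-> _]] //|t tY].
case: (boolP (v \in t)) => vt; last by rewrite wE ?tY.
rewrite /bd big1 => [|x xt]; last first.
  case: (eqVneq (w (x |: t)) 0) => [->|/wS]; first by rewrite mulr0.
  by rewrite !inE vt orbT andbF.
by apply/esym/eqP; apply: contraT => /u1S; rewrite vt andbF.
Qed.

Variable e : rel T.
Hypothesis e_sym : ssrbool.symmetric e.
Hypothesis e_irr : irreflexive e.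

Definition clique t := [forall x in t, forall y in t, (x != y) ==> e x y].

Lemma cliqueP t : reflect {in t &, forall x y, x != y -> e x y} (clique t).
Proof.
apply: (iffP forall_inP) => [h x y xt yt xy|h x xt].
  by have /forall_inP/(_ y yt)/implyP := h x xt; apply.
by apply/forall_inP=> y yt; apply/implyP; apply: h.
Qed.

(* The faces of the clique complex on A, each encoded by its complement in E, so
   that removing a vertex from a coface is the coboundary. *)
Definition coface E A : pred {set T} :=
  fun t => [&& t \subset E, E :\: t \subset A & clique (E :\: t)].

Definition nbr v := [set x | e v x].

Lemma convex_coface E A : convex (coface E A).
Proof.
move=> s t t' st tt' /and3P[_ sA /cliqueP sc] /and3P[tE _ _].
have sub : E :\: t \subset E :\: s by apply: setDS.
apply/and3P; split; [exact: subset_trans tE|exact: subset_trans sA|].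
by apply/cliqueP=> x y xt yt; apply: sc; apply: (subsetP sub).
Qed.

Lemma coface_in E A v : A \subset E -> v \in A ->
  (fun t => coface E A t && (v \in t)) =1 coface E (A :\ v).
Proof.
move=> AE vA t; have vE := subsetP AE _ vA.
by rewrite /coface subsetD1 !inE vE andbT negbK -!andbA [clique _ && _]andbC.
Qed.

Lemma setDUD E t v : v \in E -> v \notin t -> E :\: t = v |: ((E :\ v) :\: t).
Proof.
move=> vE vt; apply/setP=> x; rewrite !inE.
by case: (eqVneq x v) => [->|]; rewrite ?vE ?vt.
Qed.

(** These are the faces through [v], that is, the link of [v]. Since [v] also leaves [E], the same
    level [q] now means faces with one vertex less. *)
Lemma coface_notin E A v : A \subset E -> v \in A ->
  (fun t => coface E A t && (v \notin t)) =1 coface (E :\ v) (A :&: nbr v).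
Proof.
move=> AE vA t; have vE := subsetP AE _ vA.
rewrite /coface subsetD1; case: (t \subset E) => //=.
case: (boolP (v \in t)) => vt /=; first by rewrite andbF.
rewrite andbT (setDUD vE vt); set s := (E :\ v) :\: t.
have vs : v \notin s by rewrite !inE eqxx andbF.
rewrite subUset sub1set vA /= subsetI; case: (s \subset A) => //=.
apply/cliqueP/andP => [h|[/subsetP sN /cliqueP h] x y].
  split; last by apply/cliqueP=> x y xs ys; apply: h; rewrite in_setU1 ?xs ?ys orbT.
  apply/subsetP=> x xs; rewrite inE; apply: h; rewrite ?in_setU1 ?eqxx ?xs ?orbT //.
  by apply: contraNneq vs => ->.
rewrite !in_setU1 => /orP[/eqP->|xs] /orP[/eqP->|ys]; rewrite ?eqxx // => xy.
- by have := sN _ ys; rewrite inE.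
- by have := sN _ xs; rewrite inE e_sym.
exact: h.
Qed.

Lemma nbr_subset E A v : A \subset E -> A :&: nbr v \subset E :\ v.
Proof.
move=> AE; rewrite subsetD1 subIset ?AE //=.
by rewrite !inE e_irr andbF.
Qed.

Lemma coface_step E A v q : A \subset E -> v \in A ->
  acyclic_at (coface E (A :\ v)) q -> acyclic_at (coface (E :\ v) (A :&: nbr v)) q ->
  acyclic_at (coface E A) q.
Proof.
move=> AE vA ac1 ac2; apply: (acyclic_step (v := v)); first exact: convex_coface.
  by apply: eq_acyclic ac1 => t; rewrite -(coface_in AE vA).
by apply: eq_acyclic ac2 => t; rewrite -(coface_notin AE vA).
Qed.

(** A vertex adjacent to all others can be added to or removed from any clique, which is the
    invariance that [acyclic_toggle] asks for. *)
Lemma coface_cone E A v q : A \subset E -> v \in A -> A :\ v \subset nbr v ->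
  acyclic_at (coface E A) q.
Proof.
move=> AE vA vN; apply: (acyclic_toggle (v := v)) => t.
have vE := subsetP AE _ vA.
case: (boolP (v \in t)) => vt; first by rewrite (setUidPr _) ?sub1set.
rewrite /coface subUset sub1set vE /=; congr (_ && _).
rewrite (setDUD vE vt).
have -> : E :\: (v |: t) = (E :\ v) :\: t by rewrite setDDl.
rewrite subUset sub1set vA /=; case: (boolP (_ \subset A)) => //= sA.
set s := (E :\ v) :\: t in sA *.
have vs : v \notin s by rewrite !inE eqxx andbF.
have sN x : x \in s -> e v x.
  move=> xs; have := subsetP vN x; rewrite !inE; apply.
  by rewrite (subsetP sA) // andbT; apply: contraNneq vs => <-.
apply/cliqueP/cliqueP => h x y; last by move=> xs ys; apply: h; rewrite in_setU1 ?xs ?ys orbT.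
rewrite !in_setU1 => /orP[/eqP->|xs] /orP[/eqP->|ys]; rewrite ?eqxx // => xy.
- exact: sN.
- by rewrite e_sym; apply: sN.
exact: h.
Qed.

Lemma card_coface E A q t : coface E A t -> #|t| = q -> (q <= #|E| <= q + #|A|)%N.
Proof.
move=> /and3P[tE tA _] <-; rewrite subset_leq_card //=.
by have := subset_leq_card tA; rewrite cardsD (setIidPr tE) leq_subLR.
Qed.

Lemma coface_triv E A q : (#|E| < q)%N || (q + #|A| < #|E|)%N -> acyclic_at (coface E A) q.
Proof.
move=> h; apply: acyclic_empty => t tF tq.
by have := card_coface tF tq; move: h; card_lia.
Qed.

Lemma card_nbr A v : v \in A -> (#|A :&: nbr v| < #|A|)%N.
Proof.
move=> vA; apply: proper_card; apply/properP; split; first exact: subsetIl.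
by exists v => //; rewrite !inE e_irr andbF.
Qed.

Lemma card_nbr2 A v : v \in A -> ~~ (A :\ v \subset nbr v) -> (#|A :&: nbr v| + 2 <= #|A|)%N.
Proof.
move=> vA /subsetPn[x xA xN].
rewrite (cardsD1 v A) vA; have -> : A :&: nbr v = (A :\ v) :&: nbr v.
  by apply/setP=> y; rewrite !inE; case: eqP => // ->; rewrite e_irr andbF.
rewrite add1n addn2 ltnS.
apply: proper_card; apply/properP; split; first exact: subsetIl.
by exists x => //; rewrite inE (negPf xN) andbF.
Qed.

(** A class on faces with [s] vertices needs at least [2 * s] vertices, as in the boundary of a
    cross-polytope: unless [v] is a cone point, its link loses [v] and a non-neighbour while [s]
    drops by one. *)
Lemma coface_small E A q s : A \subset E -> (q + s = #|E|)%N -> (#|A| < 2 * s)%N ->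
  acyclic_at (coface E A) q.
Proof.
have [m] := ubnP #|A|; elim: m A E s => // m IH A E s Am AE qs As.
have [A0|[v vA]] := set_0Vmem A; first by apply: coface_triv; rewrite A0 cards0; card_lia.
have [cone|ncone] := boolP (A :\ v \subset nbr v); first exact: coface_cone cone.
have := cardsD1 v A; rewrite vA add1n => cA; have := cardsD1 v E;
    rewrite (subsetP AE) // add1n => cE.
have c2 := card_nbr2 vA ncone.
apply: (coface_step AE vA); [apply: (IH _ _ s)|apply: (IH _ _ s.-1)]; try card_lia.
  exact: subset_trans (subD1set _ _) AE.
exact: nbr_subset.
Qed.

(** At this level the only face is the empty one, and its class dies as soon as there is a
    vertex. *)
Lemma coface_top E A q : A \subset E -> A != set0 -> q = #|E| -> acyclic_at (coface E A) q.
Proof.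
have [m] := ubnP #|A|; elim: m A => // m IH A Am AE /set0Pn[v vA] qE.
have := cardsD1 v A; rewrite vA add1n => cA; have := cardsD1 v E;
    rewrite (subsetP AE) // add1n => cE.
have [A0|An0] := eqVneq (A :\ v) set0.
  by apply: (coface_cone AE vA); rewrite A0 sub0set.
apply: (coface_step AE vA); last by apply: coface_triv; card_lia.
apply: IH => //; first by card_lia.
exact: subset_trans (subD1set _ _) AE.
Qed.

Lemma bd_pair E f x y : (forall t, f t != 0 -> t \subset E) ->
  x \in E -> y \in E -> x != y ->
  bd f (E :\ x :\ y) = sgn x (E :\ x :\ y) * f (E :\ y) + sgn y (E :\ x :\ y) * f (E :\ x).
Proof.
move=> fE xE yE xy; rewrite /bd (bigD1 x) /=; last by rewrite !inE eqxx andbF.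
rewrite (bigD1 y) /=; last by rewrite !inE eqxx /= eq_sym.
rewrite big1 ?addr0 => [|z /andP[/andP[zt zx] zy]].
  congr (_ * f _ + _ * f _); last by rewrite setD1K // !inE yE eq_sym xy.
  apply/setP=> z; rewrite !inE; case: (eqVneq z x) => [->|] //=.
  by rewrite xE xy.
case: (eqVneq (f (z |: E :\ x :\ y)) 0) => [->|/fE]; first by rewrite mulr0.
move: zt; rewrite !inE zx zy /= => zE /subsetP/(_ z).
by rewrite !inE eqxx => /(_ isT) h; rewrite h in zE.
Qed.

Lemma sgnD x y E : x \in E -> y \in E -> x != y ->
  sgn x (E :\ x :\ y) = (-1) ^+ (y < x)%N * sgn x E.
Proof.
move=> xE yE xy.
rewrite -{2}(setD1K xE) sgnU ?inE ?eqxx // ltnn expr0 mul1r.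
rewrite -{2}(_ : y |: (E :\ x :\ y) = E :\ x); last by rewrite setD1K // !inE yE eq_sym xy.
by rewrite sgnU ?inE ?eqxx // mulrA -expr2 sqrr_sign mul1r.
Qed.

(* With the vertex signs absorbed, the coboundary of a 0-cochain is a difference. *)
Lemma bd_pair_diff E f x y : (forall t, f t != 0 -> t \subset E) ->
  x \in E -> y \in E -> x != y ->
  bd f (E :\ x :\ y) = (-1) ^+ (y < x)%N * sgn x E * sgn y E *
    (sgn y E * f (E :\ y) - sgn x E * f (E :\ x)).
Proof.
move=> fE xE yE xy; rewrite bd_pair // sgnD //.
have -> : sgn y (E :\ x :\ y) = (-1) ^+ (x < y)%N * sgn y E.
  by rewrite -sgnD // 1?eq_sym //; congr sgn; apply/setP=> z; rewrite !inE andbCA.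
rewrite mulrBr; congr (_ + _).
  by rewrite -!mulrA [sgn y E * (sgn y E * _)]mulrA sgn_sq mul1r.
have -> : (-1) ^+ (x < y)%N = - (-1) ^+ (y < x)%N :> K.
  by case: (ltngtP x y) => [||/val_inj h]; rewrite ?expr1 ?expr0 ?opprK // h eqxx in xy *.
rewrite !mulNr; congr (- _).
transitivity ((-1) ^+ (y < x)%N * sgn y E * f (E :\ x) * (sgn x E * sgn x E)).
  by rewrite sgn_sq mulr1.
ring.
Qed.

(** The vertex [y] is encoded by the coface [E :\ y]; the sign is the one that makes the coboundary
    compare the plain values of [h]. *)
Definition cochain0 E A (h : T -> K) t : K :=
  \sum_(y in A) (t == E :\ y)%:R * (sgn y E * h y).

Lemma setD1_inj E x y : x \in E -> y \in E -> E :\ x = E :\ y -> x = y.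
Proof.
move=> xE yE /setP/(_ x); rewrite !inE eqxx xE andbT /= => h.
by apply/eqP; move: h; case: eqP.
Qed.

Lemma cochain0E E A h y : A \subset E -> y \in A ->
  cochain0 E A h (E :\ y) = sgn y E * h y.
Proof.
move=> AE yA; rewrite /cochain0 (bigD1 y) //= eqxx mul1r big1 ?addr0 // => z /andP[zA zy].
case: eqP => [/setD1_inj yz|]; last by rewrite mul0r.
by rewrite yz ?eqxx ?(subsetP AE) in zy.
Qed.

Lemma cochain0_supp E A h q : A \subset E -> (q.+1 = #|E|)%N ->
  supported (coface E A) q (cochain0 E A h).
Proof.
move=> AE qE t t0; have /exists_inP[y yA /eqP->] : [exists y in A, t == E :\ y].
  apply: contraR t0; rewrite negb_exists_in => /forall_inP h0.
  by rewrite /cochain0 big1 // => y /h0 /negPf ->; rewrite mul0r.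
have yE := subsetP AE _ yA.
have Ey : E :\: (E :\ y) = [set y].
  by apply/setP=> x; rewrite !inE; case: (eqVneq x y) => [->|]; rewrite ?yE //= andNb.
rewrite /coface Ey subsetDl sub1set yA /=; apply/andP; split.
  by apply/cliqueP=> x z; rewrite !inE => /eqP -> /eqP ->; rewrite eqxx.
by have := cardsD1 y E; rewrite yE -qE add1n => -[->].
Qed.

End Families.

(** * Cohomology of clique complexes: vanishing, and one-dimensional cases *)

Section CliqueHomology.
Variables (K : fieldType) (n : nat).
Local Notation T := 'I_n.
Local Notation sgn := (sgn K).
Local Notation acyclic_at := (acyclic_at K).
Local Notation one_dim_at := (one_dim_at K).
Implicit Types (v x y : T) (t E A : {set T}) (u w f : {set T} -> K).
Variable e : rel T.
Hypothesis e_sym : ssrbool.symmetric e.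
Hypothesis e_irr : irreflexive e.
Local Notation coface := (coface e).
Local Notation nbr := (nbr e).

Lemma bd_pair_eq0 E f x y : (forall t, f t != 0 -> t \subset E) ->
  x \in E -> y \in E -> x != y ->
  (bd f (E :\ x :\ y) == 0) = (sgn x E * f (E :\ x) == sgn y E * f (E :\ y)).
Proof.
move=> fE xE yE xy; rewrite bd_pair_diff // !mulf_eq0 signr_eq0 subr_eq0 [RHS]eq_sym.
by rewrite !(negPf (sgn_neq0 _ _ _)).
Qed.

Lemma coface_pairE E A t q : coface E A t -> #|t| = q -> (q + 2 = #|E|)%N ->
  exists x y, [/\ x \in A, y \in A, e x y & t = E :\ x :\ y].
Proof.
move=> /and3P[tE tA /cliqueP tc] tq qE.
have : #|E :\: t| == 2%N by rewrite cardsD (setIidPr tE); apply/eqP; card_lia.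
move=> /cards2P[x [y [xy Et]]]; have xE : x \in E :\: t by rewrite Et set21.
have yE : y \in E :\: t by rewrite Et set22.
exists x, y; split; rewrite ?(subsetP tA) ?tc //.
rewrite -(setIidPr tE) -[t in LHS]setCK -setDE; apply/setP=> z.
move/setP/(_ z): Et; rewrite !inE; case: (z \in E) => /=; rewrite ?andbT ?andbF //.
by case: (z == x); case: (z == y); case: (z \in t).
Qed.

Lemma setDD1 E x y : x \in E -> y \in E -> E :\: (E :\ x :\ y) = [set x; y].
Proof.
move=> xE yE; apply/setP=> z; rewrite !inE.
case: (eqVneq z x) => [->|]; first by rewrite xE andbF.
by case: (eqVneq z y) => [->|] //=; rewrite ?yE // andNb.
Qed.

Lemma coface_pair E A x y : A \subset E -> x \in A -> y \in A -> e x y ->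
  coface E A (E :\ x :\ y).
Proof.
move=> /subsetP AE xA yA exy; apply/and3P; split.
- by apply: subset_trans (subD1set _ _) (subD1set _ _).
- by rewrite setDD1 ?AE // subUset !sub1set xA.
rewrite setDD1 ?AE //; apply/cliqueP=> a b; rewrite !inE.
by move=> /orP[]/eqP-> /orP[]/eqP->; rewrite ?eqxx // e_sym.
Qed.

Lemma edge_neq x y : e x y -> x != y.
Proof. by apply: contraTneq => ->; rewrite e_irr. Qed.

Lemma setD1C E x y : E :\ x :\ y = E :\ y :\ x.
Proof. by apply/setP=> z; rewrite !inE andbCA. Qed.

(** A 1-cocycle carried by the edges at [v] is a function [g] on the neighbours of [v] that agrees
    along edges of the link. By [link_constant] it takes one value on all neighbours of [v] in the
    same component of [A :\ v], so it extends to a locally constant function there, whose coboundary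
    is the cocycle. *)
Lemma link_coboundary E A v q u : A \subset E -> v \in A -> no_induced_cycle e A ->
    (q + 2 = #|E|)%N ->
    supported (fun t => coface E A t && (v \notin t)) q u -> is_cycle (coface E A) u ->
  is_boundary (coface E A) q u.
Proof.
move=> AE vA noc qE uS uc; have vE := subsetP AE _ vA.
pose E' := E :\ v; pose g x := sgn x E' * u (E' :\ x).
have uE' t : u t != 0 -> t \subset E'.
  by move/uS => /andP[/andP[/and3P[tE _ _] vt] _]; rewrite subsetD1 tE.
have nE' x : x \in A -> e v x -> x \in E'.
  by move=> xA /edge_neq vx; rewrite !inE eq_sym vx (subsetP AE).
have gloc x y : x \in A -> y \in A -> e v x -> e v y -> e x y -> g x = g y.
  move=> xA yA vx vy xy; apply/eqP; rewrite /g -bd_pair_eq0 ?edge_neq ?nE' //; apply/eqP.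
  apply: uc; have : coface E' (A :&: nbr v) (E' :\ x :\ y).
    by apply: coface_pair; rewrite ?nbr_subset // !inE ?xA ?yA.
  by rewrite -coface_notin // => /andP[].
pose R := [rel x y | [&& e x y, x \in A :\ v & y \in A :\ v]].
have Rsym : connect_sym R.
  by apply: sym_connect_sym => x y /=; rewrite e_sym; congr (_ && _); rewrite andbC.
have gconn x y : x \in A -> e v x -> e v y -> connect R x y -> g x = g y.
  move=> xA vx vy /connectP[p Rp yE]; rewrite yE; rewrite yE in vy.
  apply: (link_constant e_sym e_irr vA noc gloc) => //.
    by apply: sub_path Rp => a b /= /and3P[].
  have : x \in A :\ v by rewrite !inE xA eq_sym edge_neq.
  elim: p x Rp {yE vy vx xA} => [|a p IH] x /=; first by move=> _ xA y' /[!inE] /eqP->;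
      rewrite !inE in xA.
  move=> /andP[/and3P[_ _ aA] Rp] xA b; rewrite inE => /orP[/eqP-> //|]; exact: IH.
(* [h] is constant on each component of [A :\ v], with the value read at any neighbour of [v] in it,
   and 0 if there is none. With [h v = 0], the factor [- sgn v E] makes the coboundary equal [u] on
   the edges at [v]. *)
pose h y := if y == v then 0 else
  if [pick x | [&& x \in A, e v x & connect R x y]] is Some x then - (sgn v E * g x) else 0.
have hN x : x \in A -> e v x -> h x = - (sgn v E * g x).
  move=> xA vx; rewrite /h eq_sym (negPf (edge_neq vx)).
  case: pickP => [y /and3P[yA vy yx]|/(_ x)]; last by rewrite xA vx connect0.
  by rewrite (gconn _ _ yA vy vx yx).
have hloc x y : x \in A -> y \in A -> x != v -> y != v -> e x y -> h x = h y.
  move=> xA yA xv yv xy; rewrite /h (negPf xv) (negPf yv).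
  have Rxy : connect R x y by apply: connect1; rewrite /= xy !inE xv yv xA yA.
  case: pickP => [a /and3P[aA va ax]|nx]; case: pickP => [b /and3P[bA vb bY]|ny] //.
  - by rewrite (gconn a b) // (connect_trans ax) // (connect_trans Rxy) // Rsym.
  - by have := ny a; rewrite aA va (connect_trans ax).
  by have := nx b; rewrite bA vb (connect_trans bY) // Rsym.
pose f := cochain0 E A h.
have fS : supported (coface E A) q.+1 f by apply: cochain0_supp => //; card_lia.
have fE t : f t != 0 -> t \subset E by move/fS => /andP[/and3P[]].
exists f; split=> // t tF.
have [tq|tq] := eqVneq #|t| q; last first.
  rewrite (bd_card fS) //; apply/esym/eqP; apply: contraNT tq => /uS /andP[_ //].
have vcase x : x \in A -> e v x -> bd f (E :\ v :\ x) = u (E :\ v :\ x).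
  move=> xA vx; have xE := subsetP AE _ xA; have vx' := edge_neq vx.
  rewrite bd_pair_diff // /f !cochain0E // {2}/h eqxx mulr0 mulr0 subr0 mulrA sgn_sq mul1r.
  rewrite hN // /g.
  have -> : sgn x E = (-1) ^+ (v < x)%N * sgn x E'.
    by rewrite -{1}(setD1K vE) sgnU // !inE eqxx.
  have sE := @sgn_sq K n v E; have sE' := @sgn_sq K n x E'.
  have -> : (-1) ^+ (v < x)%N = - (-1) ^+ (x < v)%N :> K.
    by case: (ltngtP v x) => [||/val_inj h0]; rewrite ?expr1 ?expr0 ?opprK // h0 eqxx in vx' *.
  have s2 : (-1) ^+ (x < v)%N * (-1) ^+ (x < v)%N = 1 :> K by rewrite -expr2 sqrr_sign.
  transitivity (((-1) ^+ (x < v)%N * (-1) ^+ (x < v)%N) * (sgn v E * sgn v E) *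
     (sgn x E' * sgn x E') * u (E' :\ x)); first by ring.
  by rewrite s2 sE sE' !mul1r.
have [x [y [xA yA xy ->]]] := coface_pairE tF tq qE.
case: (eqVneq x v) => [xv|xv]; first by rewrite xv; apply: vcase; rewrite -?xv.
case: (eqVneq y v) => [yv|yv]; first by rewrite yv setD1C; apply: vcase; rewrite -?yv // e_sym.
have -> : u (E :\ x :\ y) = 0.
  apply/eqP; apply: contraT => /uS /andP[/andP[_]].
  by rewrite !inE vE eq_sym yv eq_sym xv.
apply/eqP; rewrite bd_pair_eq0 ?edge_neq ?(subsetP AE) // /f !cochain0E //.
by rewrite !mulrA !sgn_sq !mul1r (hloc _ _ xA yA).
Qed.

(** The vanishing of H^1: deletion of [v] is handled by induction, so a cocycle can be moved onto
    the edges at [v], where [link_coboundary] applies. *)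
Lemma coface_chordal2 E A q : A \subset E -> no_induced_cycle e A -> (q + 2 = #|E|)%N ->
  acyclic_at (coface E A) q.
Proof.
have [m] := ubnP #|A|; elim: m A => // m IH A Am AE noc qE.
have [A0|[v vA]] := set_0Vmem A; first by apply: coface_triv; rewrite A0 cards0; card_lia.
have := cardsD1 v A; rewrite vA add1n => cA.
have sub : A :\ v \subset A by apply: subD1set.
have ac1 : acyclic_at (fun t => coface E A t && (v \in t)) q.
  apply: eq_acyclic (IH (A :\ v) _ _ _ qE) => [t||| //]; first by rewrite (coface_in _ AE vA).
  - by card_lia.
  - exact: subset_trans sub AE.
  exact: no_induced_cycleS noc.
move=> u uS uc; have [u1 [u1S u1c b1]] := reduce_cycle (@convex_coface n e E A) ac1 uS uc.
have b2 := link_coboundary AE vA noc qE u1S u1c.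
by apply: eq_boundary (is_boundaryD b1 b2) => t _; rewrite subrK.
Qed.

(** Deletions and links inherit the absence of induced cycles, and each link lowers [s], down to the
    case [s = 2]. *)
Lemma coface_chordal E A q s : A \subset E -> no_induced_cycle e A -> (q + s = #|E|)%N ->
  (2 <= s)%N -> acyclic_at (coface E A) q.
Proof.
have [m] := ubnP #|A|; elim: m A E s => // m IH A E s Am AE noc qs s2.
have [A0|[v vA]] := set_0Vmem A; first by apply: coface_triv; rewrite A0 cards0; card_lia.
have [sE|s3] := eqVneq s 2%N; first by apply: coface_chordal2; rewrite -?sE.
have := cardsD1 v A; rewrite vA add1n => cA; have := cardsD1 v E;
    rewrite (subsetP AE) // add1n => cE.
have cN := card_nbr e_irr vA.
apply: (coface_step e_sym AE vA); [apply: (IH _ _ s)|apply: (IH _ _ s.-1)]; try card_lia.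
- exact: subset_trans (subD1set _ _) AE.
- exact: no_induced_cycleS (subD1set _ _) noc.
- exact: nbr_subset.
exact: no_induced_cycleS (subsetIl _ _) noc.
Qed.

Section Girth.
Variable r : nat.
Hypothesis girth : forall c, induced_cycle e c -> (r <= size c)%N.

Lemma no_cycle_girth A : (#|A| < r)%N -> no_induced_cycle e A.
Proof.
move=> Ar c cc cA; have := girth cc; rewrite leqNgt; case/negP.
apply: leq_ltn_trans Ar; case/and3P: cc => /andP[_ uc] _ _.
by rewrite cardE; apply: uniq_leq_size => // x /cA; rewrite mem_enum.
Qed.

(** The inequality survives deletion and link, and at [s = 2] it reads [#|A| < r]: too few vertices
    for an induced cycle. *)
Lemma coface_girth E A q s : A \subset E -> (q + s = #|E|)%N -> (2 <= s)%N ->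
  (#|A| + 3 <= r + s)%N -> acyclic_at (coface E A) q.
Proof.
have [m] := ubnP #|A|; elim: m A E s => // m IH A E s Am AE qs s2 As.
have [A0|[v vA]] := set_0Vmem A; first by apply: coface_triv; rewrite A0 cards0; card_lia.
have [sE|s3] := eqVneq s 2%N.
  by apply: (coface_chordal AE _ qs s2); apply: no_cycle_girth; card_lia.
have := cardsD1 v A; rewrite vA add1n => cA; have := cardsD1 v E;
    rewrite (subsetP AE) // add1n => cE.
have cN := card_nbr e_irr vA.
apply: (coface_step e_sym AE vA); [apply: (IH _ _ s)|apply: (IH _ _ s.-1)]; try card_lia.
  exact: subset_trans (subD1set _ _) AE.
exact: nbr_subset.
Qed.

(** One more vertex is allowed than in [coface_girth]: outside the cone case the first link removes
    two vertices for one unit of [s]. It must start at [s >= 3], since at [s = 2] a shortest cycle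
    carries a class. *)
Lemma coface_girth3 E A q s : A \subset E -> (q + s = #|E|)%N -> (3 <= s)%N ->
  (#|A| + 2 <= r + s)%N -> acyclic_at (coface E A) q.
Proof.
move=> AE qs s3 As.
have [A0|[v vA]] := set_0Vmem A; first by apply: coface_triv; rewrite A0 cards0; card_lia.
have [cone|ncone] := boolP (A :\ v \subset nbr v); first exact: coface_cone cone.
have := cardsD1 v A; rewrite vA add1n => cA; have := cardsD1 v E;
    rewrite (subsetP AE) // add1n => cE.
have c2 := card_nbr2 e_irr vA ncone.
apply: (coface_step e_sym AE vA);
    [apply: (coface_girth (s := s))|apply: (coface_girth (s := s.-1))]; try card_lia.
  exact: subset_trans (subD1set _ _) AE.
exact: nbr_subset.
Qed.

End Girth.

Definition delta t0 t : K := (t == t0)%:R.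

Lemma delta_supp (Y : pred {set T}) t0 : Y t0 -> supported Y #|t0| (delta t0).
Proof.
move=> Y0 t; rewrite /delta; case: (t =P t0) => [->|]; last by rewrite eqxx.
by rewrite Y0 eqxx.
Qed.

Lemma bd_delta t0 t v : v \notin t -> t0 = v |: t -> bd (delta t0) t = sgn v t.
Proof.
move=> vt ->; rewrite /bd (bigD1 v) //= /delta eqxx mulr1 big1 ?addr0 // => x /andP[xt xv].
rewrite (_ : (_ == _) = false) ?mulr0 //; apply/negbTE; apply/eqP=> /setP/(_ x).
by rewrite !inE eqxx (negPf xt) (negPf xv).
Qed.

Lemma bd_delta0 t0 t : (forall v, v \notin t -> v |: t != t0) -> bd (delta t0) t = 0.
Proof.
by move=> h; rewrite /bd big1 // => v vt; rewrite /delta (negPf (h v vt)) mulr0.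
Qed.

(** Without vertices the complex has only the empty face, whose coface is [E] itself. *)
Lemma coface_one_dim0 E : one_dim_at (coface E set0) #|E|.
Proof.
have famE t : coface E set0 t = (t == E).
  rewrite /coface subset0 setD_eq0 eqEsubset; case: (t \subset E) => //=.
  case: (boolP (E \subset t)) => //= Et; apply/cliqueP => x y.
  by rewrite !inE => /andP[/negP xt /(subsetP Et)].
exists (delta E); split.
- by apply: delta_supp; rewrite famE.
- move=> t; rewrite famE => /eqP ->; apply: bd_delta0 => v vE.
  by apply: contraNneq vE => <-; rewrite setU11.
- move=> [w [wS]] /(_ E); rewrite famE eqxx => /(_ isT).
  rewrite /bd big1 => [/esym/eqP|v vE]; first by rewrite /delta eqxx oner_eq0.
  case: (eqVneq (w (v |: E)) 0) => [->|/wS]; first by rewrite mulr0.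
  rewrite famE => /andP[/eqP h _]; case/negP: vE; by rewrite -h setU11.
move=> u uS uc; exists (u E); exists (fun=> 0); split=> [t|t].
  by rewrite eqxx.
by rewrite famE bd0 => /eqP->; rewrite /delta eqxx mulr1 subrr.
Qed.

Lemma coface_singleE E A t q : coface E A t -> #|t| = q -> q.+1 = #|E| ->
  exists2 x, x \in A & t = E :\ x.
Proof.
move=> /and3P[tE tA _] tq qE.
have : #|E :\: t| == 1%N by rewrite cardsD (setIidPr tE); apply/eqP; card_lia.
move=> /cards1P[x Et]; have xE : x \in E :\: t by rewrite Et set11.
exists x; first exact: (subsetP tA).
apply/setP=> z; move/setP/(_ z): Et; rewrite !inE.
move: (subsetP tE z).
by case: (z \in t); case: (z \in E); case: (z == x) => //= /(_ isT).
Qed.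

Lemma coface_single E A x : A \subset E -> x \in A -> coface E A (E :\ x).
Proof.
move=> AE xA; have xE := subsetP AE _ xA.
have Ex : E :\: (E :\ x) = [set x].
  by apply/setP=> z; rewrite !inE; case: (eqVneq z x) => [->|]; rewrite ?xE //= andNb.
rewrite /coface Ex subD1set sub1set xA /=.
by apply/cliqueP=> a b; rewrite !inE => /eqP-> /eqP->; rewrite eqxx.
Qed.

Lemma coface_full E A : coface E A E.
Proof.
by rewrite /coface subxx setDv sub0set; apply/cliqueP=> x y; rewrite inE.
Qed.

Lemma setD1_neq E a z : a \in E -> z \in E -> a != z -> (E :\ a == E :\ z) = false.
Proof. by move=> aE zE az; apply/negbTE; apply: contra_neqN az => /eqP; apply: setD1_inj. Qed.

(** The coboundary of the empty face, [delta E], is nonzero at both vertices; a multiple of it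
    clears the value at [a] and leaves a multiple of the vertex [z]. *)
Lemma coface_gen1 E a z q u : a \in E -> z \in E -> a != z -> q.+1 = #|E| ->
    supported (coface E [set a; z]) q u ->
  exists c, is_boundary (coface E [set a; z]) q (fun t => u t - c * delta (E :\ z) t).
Proof.
move=> aE zE az qE; set A := [set a; z] => uS.
have AE : A \subset E by rewrite subUset !sub1set aE.
have bdE x : x \in E -> bd (delta E) (E :\ x) = sgn x (E :\ x).
  by move=> xE; apply: bd_delta; rewrite ?setD1K // !inE eqxx.
pose l := u (E :\ a) / sgn a (E :\ a).
exists (u (E :\ z) - l * sgn z (E :\ z)); exists (fun t => l * delta E t); split.
  move=> t; rewrite mulf_eq0 negb_or => /andP[_].
  by rewrite qE; apply: delta_supp; apply: coface_full.
move=> t tF; rewrite bdZ.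
have [tq|tq] := eqVneq #|t| q; last first.
  rewrite (bd_card (Y := coface E A) (q := q)) //; last by rewrite qE; apply: delta_supp;
      apply: coface_full.
  have -> : u t = 0 by apply/eqP; apply: contraNT tq => /uS /andP[].
  rewrite /delta (_ : (_ == _) = false) ?mulr0 ?subr0 //.
  apply/negbTE; apply: contraNneq tq => ->.
  by have := cardsD1 z E; rewrite zE -qE add1n => -[->].
have [x xA tE] := coface_singleE tF tq qE; rewrite tE bdE ?(subsetP AE) //.
move: xA; rewrite !inE => /orP[]/eqP->; rewrite /delta.
  by rewrite setD1_neq // mulr0 subr0 /l divfK // sgn_neq0.
by rewrite eqxx mulr1 opprB addrCA subrr addr0.
Qed.

(** Two non-adjacent points form a 0-sphere. A primitive of the generator is determined by its value
    at the empty face, which would have to vanish because of [a] and not because of [z]. *)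
Lemma coface_one_dim1 E a z q : a \in E -> z \in E -> a != z -> ~~ e a z -> q.+1 = #|E| ->
  one_dim_at (coface E [set a; z]) q.
Proof.
move=> aE zE az naz qE; set A := [set a; z].
have AE : A \subset E by rewrite subUset !sub1set aE.
have aA : a \in A by rewrite set21.
have zA : z \in A by rewrite set22.
have cE x : x \in E -> #|E :\ x| = q.
  by move=> xE; have := cardsD1 x E; rewrite xE; card_lia.
have ntri t x : x \in E -> coface E A t -> forall v, v \notin t -> v |: t != E :\ x.
  move=> xE tF v vt; apply/eqP=> tE.
  have tq : #|t| = q.-1 by have := cardsU1 v t; rewrite vt tE (cE _ xE); card_lia.
  have q1 : (0 < q)%N by rewrite -(cE _ xE) -tE cardsU1 vt.
  have [b [c [bA cA bc _]]] : exists b c, [/\ b \in A, c \in A, e b c & t = E :\ b :\ c].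
    by apply: (coface_pairE tF tq); card_lia.
  move: bA cA bc naz; rewrite !inE => /orP[]/eqP-> /orP[]/eqP->; rewrite ?e_irr // => h.
    by rewrite h.
  by rewrite e_sym h.
exists (delta (E :\ z)); split.
- by have := @delta_supp (coface E A) (E :\ z) (coface_single AE zA); rewrite cE.
- by move=> t tF; apply: bd_delta0; apply: ntri.
- move=> [w [wS wE]].
  have wE1 x : x \in A -> bd w (E :\ x) = sgn x (E :\ x) * w E.
    move=> xA; have xE := subsetP AE _ xA.
    rewrite /bd (bigD1 x) ?inE ?eqxx //= setD1K // big1 ?addr0 // => v /andP[vt vx].
    case: (eqVneq (w (v |: E :\ x)) 0) => [->|/wS]; first by rewrite mulr0.
    move=> /andP[/and3P[/subsetP/(_ v) h _ _] _]; move: vt.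
    by rewrite !inE vx h // setU11.
  have := wE _ (coface_single AE aA); rewrite wE1 // /delta.
  rewrite setD1_neq // => /eqP; rewrite mulf_eq0 (negPf (sgn_neq0 _ _ _)) /= => /eqP w0.
  have := wE _ (coface_single AE zA); rewrite wE1 // w0 mulr0 /delta eqxx => /esym/eqP.
  by rewrite oner_eq0.
by move=> u uS _; apply: coface_gen1.
Qed.

Lemma boundary_notin (Y : pred {set T}) v q u :
  is_boundary (fun t => Y t && (v \notin t)) q u -> (forall t, v \in t -> u t = 0) ->
  is_boundary Y q u.
Proof.
move=> [w [wS wE]] u0; exists w; split=> [t /wS /andP[/andP[-> _]] //|t tY].
case: (boolP (v \in t)) => vt; last by rewrite wE ?tY.
rewrite u0 // /bd big1 // => x xt.
case: (eqVneq (w (x |: t)) 0) => [->|/wS]; first by rewrite mulr0.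
by rewrite !inE vt orbT andbF.
Qed.

Section OneCycle.
Variables (v : T) (p : seq T).
Local Notation c := (v :: p).
Local Notation cn i := (nth v c i).
Hypothesis ind : induced_cycle e c.
Hypothesis girth : forall c', induced_cycle e c' -> (size c <= size c')%N.
Local Notation A := [set x in c].
Local Notation z := (last v p).
Local Notation a := (cn 1).

Let uc : uniq c. Proof. by case/and3P: ind => /andP[]. Qed.
Let p3 : (3 <= size p)%N. Proof. by case/and3P: ind. Qed.
Let cA : #|A| = size c. Proof. by rewrite cardsE; apply/card_uniqP. Qed.
Let cnA i : (i <= size p)%N -> cn i \in A.
Proof. by move=> ip; rewrite inE mem_nth. Qed.
Let cn_inj i k : (i <= size p)%N -> (k <= size p)%N -> cn i = cn k -> i = k.
Proof. by move=> ip kp /eqP; rewrite nth_uniq // => /eqP. Qed.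
Let zE : z = cn (size p). Proof. by rewrite (last_nth v). Qed.

Let cycle_idx i k : (i < k <= size p)%N -> e (cn i) (cn k) ->
  k = i.+1 \/ i = 0%N /\ k = size p.
Proof. by case/and3P: ind => _ ch _; apply: chordless_index. Qed.

Let edge_next i : (i < size p)%N -> e (cn i) (cn i.+1).
Proof.
case/and3P: ind => /andP[/= cyc _] _ _ ip.
have /(pathP v)/(_ i) := cyc; rewrite size_rcons => /(_ (ltnW ip)).
by rewrite !nth_rcons ip -[v :: rcons p v]/(rcons c v) nth_rcons /= ltnS ltnW.
Qed.

Let edge_close : e v z.
Proof.
case/and3P: ind => /andP[/= cyc _] _ _.
by move: cyc; rewrite rcons_path e_sym => /andP[].
Qed.

Let nbr_v : A :&: nbr v = [set a; z].
Proof.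
apply/setP=> x; rewrite !inE; apply/andP/idP => [[xc vx]|].
  have [xv|xv] := eqVneq x v; first by rewrite xv e_irr in vx.
  move: xc; rewrite (negPf xv) /= => xp.
  have ip : (0 < (index x p).+1 <= size p)%N by rewrite /= index_mem.
  have cx : cn (index x p).+1 = x by rewrite /= nth_index.
  have : e (cn 0) (cn (index x p).+1) by rewrite cx.
  case/(cycle_idx ip) => [i1|[_ im]]; first by rewrite -cx i1 eqxx.
  by rewrite zE -im cx eqxx orbT.
have p1 : (0 < size p)%N by apply: leq_trans p3.
move=> /orP[]/eqP->; split; rewrite ?edge_close //.
- by rewrite /= mem_nth ?orbT.
- exact: (@edge_next 0 p1).
by rewrite -in_cons mem_last.
Qed.

(** The class is carried by the single edge from [v] to [z] that closes the cycle, of coface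
    [t0]. *)
Lemma coface_one_dim_cycle q : (q + 2 = size c)%N -> one_dim_at (coface A A) q.
Proof.
move=> qc; pose t0 := A :\ v :\ z.
have vA : v \in A by rewrite inE mem_head.
have zA : z \in A by rewrite inE mem_last.
have qA : (q + 2 = #|A|)%N by rewrite cA.
have vz := edge_neq edge_close.
have aA : a \in A by apply: cnA; apply: leq_trans p3.
have va : v != a by apply: edge_neq; apply: (@edge_next 0); apply: leq_trans p3.
have az : a != z.
  apply/eqP; rewrite zE => /cn_inj h; have := p3; rewrite -h //; exact: leq_trans p3.
have naz : ~~ e a z.
  apply/negP; rewrite zE => /cycle_idx; rewrite leqnn andbT => /(_ (ltn_trans _ p3)).
  by case=> // [h|[]//]; have := p3; rewrite h.
have ct0 : #|t0| = q.
  have := cardsD1 v A; rewrite vA -qA add1n addn2 => -[h1].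
  have := cardsD1 z (A :\ v).
  by rewrite in_setD1 zA eq_sym vz /= -h1 add1n => -[].
have u0S : supported (coface A A) q (delta t0).
  by rewrite -ct0; apply: delta_supp; apply: coface_pair.
exists (delta t0); split=> //.
(* A triangle on the edge [v z] would have [a], the other neighbour of [v], as its third vertex, but
   [a] and [z] are not adjacent. *)
- move=> t tF; apply: bd_delta0 => w wt; apply/eqP => tE.
  have wt0 : w \in t0 by rewrite -tE setU11.
  move: (wt0); rewrite in_setD1 in_setD1 => /and3P[wz wv wA].
  have out x : x \in A -> x \notin t0 -> x \in A :\: t.
    by move=> xA xt; rewrite in_setD xA andbT; apply: contra xt; rewrite -tE in_setU1 orbC => ->.
  case/and3P: tF => _ _ /cliqueP cl.
  have wo : w \in A :\: t by rewrite in_setD wt.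
  have vo : v \in A :\: t by apply: out; rewrite // in_setD1 in_setD1 eqxx andbF.
  have zo : z \in A :\: t by apply: out; rewrite // in_setD1 eqxx.
  have : w \in A :&: nbr v by rewrite in_setI wA inE cl // eq_sym.
  rewrite nbr_v in_set2 (negPf wz) orbF => /eqP wa; case/negP: naz.
  by rewrite -wa cl.
(* A primitive, signs absorbed, is constant along the path from [v] to [z] that avoids the closing
   edge, so its coboundary vanishes on that edge, where [delta t0] is 1. *)
- move=> [w [wS wE]].
  have wsub t : w t != 0 -> t \subset A by move/wS => /andP[/and3P[]].
  have step i : (i < size p)%N -> sgn (cn i) A * w (A :\ cn i) = sgn (cn i.+1) A * w (A :\ cn i.+1).
    move=> ip; have ei := edge_next ip; have iA := cnA (ltnW ip); have iA' := cnA ip.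
    apply/eqP; rewrite -bd_pair_eq0 ?edge_neq // wE ?coface_pair //.
    rewrite /delta; case: (_ =P t0) => [tE|_]; last by rewrite eqxx.
    exfalso; have : [set cn i; cn i.+1] = [set v; z] by rewrite -(setDD1 iA iA') tE setDD1.
    move=> S; have : v \in [set cn i; cn i.+1] by rewrite S set21.
    rewrite in_set2 => /orP[]/eqP; rewrite -[v in v = _]/(cn 0) => /cn_inj.
      move=> /(_ isT (ltnW ip)) i0; have : z \in [set cn i; cn i.+1] by rewrite S set22.
      rewrite zE in_set2 -i0 => /orP[]/eqP/cn_inj; have := p3.
        by move=> h /(_ (leqnn _) isT) h0; rewrite h0 in h.
      by move=> h /(_ (leqnn _) (leq_trans _ h)) h0; rewrite h0 // in h.
    by move=> /(_ isT ip).
  have allv i : (i <= size p)%N -> sgn (cn i) A * w (A :\ cn i) = sgn v A * w (A :\ v).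
    by elim: i => [//|i IH] ip; rewrite -step // IH // ltnW.
  have : bd w t0 == 0 by rewrite bd_pair_eq0 // zE allv.
  by rewrite wE ?coface_pair // /delta eqxx oner_eq0.
move=> u uS uc'.
(* The cycle is shortest, so deleting [v] leaves no induced cycle; a cocycle then moves to the link
   of [v], the two points [a] and [z]. *)
have ac1 : acyclic_at (fun t => coface A A t && (v \in t)) q.
  apply: (@eq_acyclic K n (coface A (A :\ v))) => [t|]; first by rewrite coface_in.
  apply: coface_chordal2 => //; first exact: subD1set.
  apply: (no_cycle_girth girth); rewrite -cA; apply: proper_card.
  by apply: properD1.
have [u1 [u1S u1c b1]] := reduce_cycle (@convex_coface n e A A) ac1 uS uc'.
have famE := coface_notin e_sym (subxx A) vA.
rewrite nbr_v in famE.
have u1S' : supported (coface (A :\ v) [set a; z]) q u1 by move=> t /u1S; rewrite famE.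
have [|||c0 b2] := coface_gen1 _ _ az _ u1S'.
- by rewrite in_setD1 aA eq_sym va.
- by rewrite in_setD1 zA eq_sym vz.
- by have := cardsD1 v A; rewrite vA add1n -qA addn2 => -[].
exists c0; have b2' : is_boundary (coface A A) q (fun t => u1 t - c0 * delta t0 t).
  apply: (@boundary_notin _ v); first by case: b2 => w [wS wE]; exists w; split=> [t /wS|t tY];
      rewrite ?famE //; apply: wE; rewrite -famE.
  move=> t vt; have -> : u1 t = 0 by apply/eqP; apply: contraT => /u1S; rewrite vt andbF.
  rewrite /delta (_ : (_ == _) = false) ?mulr0 ?subr0 //; apply/negbTE.
  by apply: contraTneq vt => ->; rewrite in_setD1 in_setD1 eqxx andbF.
by apply: eq_boundary (is_boundaryD b1 b2') => t _; rewrite addrA subrK.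
Qed.

End OneCycle.

End CliqueHomology.

(** * Functions with prescribed support, as subspaces *)

Section Restriction.
Variables (K : fieldType) (J : finType).
Local Notation V := {ffun J -> K^o}.
Implicit Types (S : pred J) (u : V).

Definition restr S u : V := [ffun x => if S x then u x else 0].

Lemma restr_is_linear S : linear (restr S).
Proof.
move=> c u v; apply/ffunP=> x; rewrite !ffunE; case: ifP => // _.
by rewrite scaler0 addr0.
Qed.

HB.instance Definition _ S :=
  GRing.isLinear.Build K V V _ (restr S) (restr_is_linear S).

Definition lrestr S : 'End(V) := linfun (restr S).

Lemma lrestrE S u x : lrestr S u x = if S x then u x else 0.
Proof. by rewrite lfunE /= ffunE. Qed.

Definition suppv S : {vspace V} := limg (lrestr S).

Lemma memv_suppv S u : reflect (forall x, ~~ S x -> u x = 0) (u \in suppv S).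
Proof.
apply: (iffP memv_imgP) => [[w _ ->] x /negPf Sx|u0].
  by rewrite lrestrE Sx.
exists u; first exact: memvf.
by apply/ffunP=> x; rewrite lrestrE; case: ifPn => // /u0.
Qed.

Lemma lrestr_suppv S S' :
  (lrestr S @: suppv S' = suppv (fun x => S x && S' x))%VS.
Proof.
apply/vspaceP=> u; apply/memv_imgP/memv_suppv => [[w wS' ->] x|u0].
  rewrite lrestrE; case: (S x) => //= Sx.
  by move/memv_suppv: wS' => ->.
exists u; last first.
  apply/ffunP=> x; rewrite lrestrE; case: ifPn => // Sx.
  by apply: u0; rewrite (negPf Sx).
by apply/memv_suppv => x Sx; apply: u0; rewrite (negPf Sx) andbF.
Qed.

Lemma dim_sum_fibers (G : finType) (f : J -> G) (U : {vspace V}) :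
  (forall g, (lrestr (fun x => f x == g) @: U <= U)%VS) ->
  \dim U = (\sum_g \dim (lrestr (fun x => f x == g) @: U))%N.
Proof.
apply: dim_sum_idempotents => [g h v|v].
  apply/ffunP=> x; rewrite !lrestrE.
  case: (eqVneq g h) => [->|gh]; first by rewrite lrestrE; case: (f x == h).
  rewrite ffunE; case: ifP => // /eqP ->.
  by rewrite (negPf gh).
apply/ffunP=> x; rewrite sum_ffunE (bigD1 (f x)) //= lrestrE eqxx.
rewrite big1 ?addr0 // => g gx; rewrite lrestrE eq_sym (negPf gx) //.
Qed.

Lemma dim_suppv S : \dim (suppv S) = #|S|.
Proof.
rewrite (dim_sum_fibers (f := id)) => [|g]; last first.
  rewrite lrestr_suppv; apply/subvP=> u /memv_suppv u0; apply/memv_suppv=> x Sx.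
  by apply: u0; rewrite (negPf Sx) andbF.
rewrite -sum1_card [RHS]big_mkcond /=; apply: eq_bigr => x _.
rewrite lrestr_suppv.
pose e : V := [ffun y => (y == x)%:R].
transitivity (\dim (if x \in S then <[e]> else 0)%VS); last first.
  case: ifP => _; rewrite ?dimv0 // dim_vline; case: eqP => // /ffunP/(_ x).
  by rewrite !ffunE eqxx => /eqP; rewrite oner_eq0.
congr (\dim _); apply/vspaceP=> u; apply/memv_suppv/idP.
  move=> u0; case: ifPn => Sx.
    apply/vlineP; exists (u x); apply/ffunP=> y; rewrite !ffunE.
    case: (eqVneq y x) => [->|yx]; first by rewrite /GRing.scale /= mulr1.
    by rewrite scaler0 u0 // (negPf yx).
  rewrite memv0; apply/eqP/ffunP=> y; rewrite ffunE u0 //.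
  by case: eqP => // ->.
case: ifPn => Sx; last by rewrite memv0 => /eqP-> y _; rewrite ffunE.
move=> /vlineP[c ->] y; rewrite !ffunE; case: eqP => //= [->|_ _].
  by rewrite (Sx : S x).
by rewrite scaler0.
Qed.

End Restriction.

Section MonomialCoefficients.
Variables (K : fieldType) (n : nat).
Implicit Types (p q : {mpoly K[n]}) (m : 'X_{1..n}) (t : {set 'I_n}).

Lemma mcoeffM_bounded p q m k : (mdeg m < k)%N ->
  (p * q)@_m = \sum_(b : 'X_{1..n < k} | (b <= m)%MM) p@_b * q@_(m - b).
Proof. exact: mcoeff_poly_mul_lin. Qed.

Lemma mpolyX_eq0 m : ('X_[m] == 0 :> {mpoly K[n]}) = false.
Proof.
apply/negbTE; apply/eqP=> /(congr1 (mcoeff m))/eqP.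
by rewrite mcoeffX eqxx mcoeff0 oner_eq0.
Qed.

Lemma mcoeffMXE p m b :
  (p * 'X_[m])@_b = if (m <= b)%MM then p@_(b - m) else 0.
Proof.
case: ifPn => [mb|]; first by rewrite -{1}(submK mb) addmC mcoeffMX.
apply: contraNeq; rewrite -mcoeff_msupp => /msuppM_le.
rewrite msuppX => /allpairsP[[m1 m2]] /= [_ /[!inE] /eqP-> ->].
by rewrite lem_addl.
Qed.

End MonomialCoefficients.

(** * Koszul chains over graded free modules, in a fixed degree *)

Section Chains.
Variables (K : fieldType) (n j : nat).
Local Notation R := {mpoly K[n]}.
Local Notation BM := 'X_{1..n < j.+1}.
Local Notation idx r := ('I_r * BM * {set 'I_n})%type.
Local Notation chain r := {ffun idx r -> K^o}.

(* The index (a, b, t) stands for e_a (x) x^(b-t) (x) e_t: recording the total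
   multidegree b makes the Koszul differential act on t alone. *)
Definition koszul_bd_fun r (u : chain r) : chain r :=
  [ffun x => bd (fun t => u (x.1, t)) x.2].

Lemma koszul_bd_is_linear r : linear (@koszul_bd_fun r).
Proof.
move=> c u v; apply/ffunP=> x; rewrite !ffunE /GRing.scale /= -bdZ -bdD.
by apply: eq_bd => t; rewrite !ffunE.
Qed.

HB.instance Definition _ r :=
  GRing.isLinear.Build K (chain r) (chain r) _ (@koszul_bd_fun r) (@koszul_bd_is_linear r).

Definition koszul_bd r : 'End(chain r) := linfun (@koszul_bd_fun r).

Lemma koszul_bdE r (u : chain r) x : koszul_bd r u x = bd (fun t => u (x.1, t)) x.2.
Proof. by rewrite lfunE /= ffunE. Qed.

Definition mulD_fun r r' (D : 'M[R]_(r, r')) (u : chain r) : chain r' :=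
  [ffun y : idx r' => \sum_a \sum_(b : BM | (b <= y.1.2)%MM)
     u (a, b, y.2) * (D a y.1.1)@_(y.1.2 - b)].

Lemma mulD_is_linear r r' (D : 'M[R]_(r, r')) : linear (mulD_fun D).
Proof.
move=> c u v; apply/ffunP=> y; rewrite !ffunE /GRing.scale /= mulr_sumr -big_split.
apply: eq_bigr => a _ /=; rewrite mulr_sumr -big_split; apply: eq_bigr => b _ /=.
by rewrite !ffunE /GRing.scale /= mulrDl mulrA.
Qed.

HB.instance Definition _ r r' (D : 'M[R]_(r, r')) :=
  GRing.isLinear.Build K (chain r) (chain r') _ (mulD_fun D) (mulD_is_linear D).

Definition mulD r r' (D : 'M[R]_(r, r')) : 'Hom(chain r, chain r') :=
  linfun (mulD_fun D).

Lemma mulDE r r' (D : 'M[R]_(r, r')) u y :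
  mulD D u y = \sum_a \sum_(b : BM | (b <= y.1.2)%MM)
     u (a, b, y.2) * (D a y.1.1)@_(y.1.2 - b).
Proof. by rewrite lfunE /= ffunE. Qed.

Lemma mulD_koszul_bd r r' (D : 'M[R]_(r, r')) u : mulD D (koszul_bd r u) = koszul_bd r' (mulD D u).
Proof.
apply/ffunP=> y; rewrite mulDE koszul_bdE.
transitivity (\sum_a \sum_(b : BM | (b <= y.1.2)%MM)
   \sum_(v | v \notin y.2) sgn K v y.2 * (u (a, b, v |: y.2) * (D a y.1.1)@_(y.1.2 - b))).
  apply: eq_bigr => a _; apply: eq_bigr => b _; rewrite koszul_bdE /= mulr_suml.
  by apply: eq_bigr => v _; rewrite mulrA.
rewrite pair_big_dep /= exchange_big /=; apply: eq_bigr => v _.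
by rewrite mulDE /= pair_big_dep /= mulr_sumr.
Qed.

(** The basis of the degree-[j] part of the free module tensored with the [q]-th Koszul module;
    [mesym1 t <= b] says that x^(b-t) is a monomial. *)
Definition graded r (sh : 'I_r -> nat) (q : nat) : pred (idx r) :=
  fun x => [&& sh x.1.1 + mdeg x.1.2 == j, (mesym1 x.2 <= x.1.2)%MM & #|x.2| == q]%N.

Local Notation S sh q := (suppv K (graded sh q%N)).

Lemma mesym1_le (t : {set 'I_n}) (b : 'X_{1..n}) :
  (mesym1 t <= b)%MM = (t \subset [set i | 0 < b i])%N.
Proof.
apply/mnm_lepP/subsetP => h i; last first.
  by rewrite mnmE; have := h i; rewrite inE; case: (i \in t) => // ->.
by rewrite inE => it; have := h i; rewrite mnmE it.
Qed.

Lemma mesym1_leU v (t : {set 'I_n}) (b : 'X_{1..n}) :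
  (mesym1 (v |: t) <= b)%MM = (0 < b v)%N && (mesym1 t <= b)%MM.
Proof. by rewrite !mesym1_le subUset sub1set inE. Qed.

Lemma koszul_bd_graded r (sh : 'I_r -> nat) q : (koszul_bd r @: S sh q.+1 <= S sh q)%VS.
Proof.
apply/subvP=> w /memv_imgP[u /memv_suppv u0 ->]; apply/memv_suppv => x xS.
rewrite koszul_bdE; apply: big1 => v vx; rewrite u0 ?mulr0 //.
move: xS; rewrite /graded /= mesym1_leU cardsU1 vx add1n eqSS.
by apply: contra => /and3P[-> /andP[_ ->] ->].
Qed.

Lemma koszul_bd_bd r u : koszul_bd r (koszul_bd r u) = 0.
Proof.
apply/ffunP=> x; rewrite koszul_bdE ffunE -[RHS](bd_bd (fun t => u (x.1, t)) x.2).
by apply: eq_bd => t; rewrite koszul_bdE.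
Qed.

(** In a multidegree other than 0 the homotopy at a variable of the support contracts the Koszul
    complex. Multidegree 0 is excluded by hypothesis; for the syzygy modules that exclusion is
    minimality. *)
Lemma koszul_bd_exact r (sh : 'I_r -> nat) q u :
  u \in S sh q -> koszul_bd r u = 0 -> (forall a t, u (a, bm0, t) = 0) ->
  u \in (koszul_bd r @: S sh q.+1)%VS.
Proof.
move=> /memv_suppv u0 ku u00.
(* The vertex depends on the multidegree alone, so one homotopy is used throughout each multidegree
   and [bd_homotopyE] applies. *)
pose f (x : idx r) : K^o := if [pick v | (0 < (x.1.2 : 'X_{1..n}) v)%N] is Some v
  then bd_homotopy v (fun t => u (x.1, t)) x.2 else 0.
pose w : chain r := [ffun x => f x].
apply/memv_imgP; exists w.
  apply/memv_suppv => x; apply: contraNeq; rewrite ffunE /f.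
  case: pickP => [v bv|_ /eqP //]; rewrite /bd_homotopy.
  case: ifP => [vx|_ /eqP //]; apply: contraNT => xS; rewrite u0 ?mulr0 //.
  apply: contra xS => /and3P[/= hd hm hc]; apply/and3P; split => //.
    by rewrite -(setD1K vx) mesym1_leU bv.
  by rewrite (cardsD1 v) vx (eqP hc).
apply/ffunP=> -[x t0]; rewrite koszul_bdE /=.
case E : [pick v | (0 < (x.2 : 'X_{1..n}) v)%N] => [v|].
  rewrite -[LHS](bd_homotopyE v (fun t => u (x, t)) t0).
  have -> : bd_homotopy v (bd (fun t => u (x, t))) t0 = 0.
    rewrite /bd_homotopy; case: ifP => // _.
    have /ffunP/(_ (x, t0 :\ v)) := ku.
    by rewrite koszul_bdE ffunE /= => ->; rewrite mulr0.
  by rewrite addr0; apply: eq_bd => t; rewrite ffunE /f /= E.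
have xb : x.2 = bm0.
  apply: val_inj; apply/mnmP=> i; rewrite mnmE; apply/eqP.
  by move: E; case: pickP => // /(_ i); rewrite lt0n => /negbFE.
rewrite /bd big1 => [|v _]; last by rewrite ffunE /f /= E mulr0.
by case: x xb {E} => a b /= ->; rewrite u00.
Qed.

Lemma graded_bm0 r (sh : 'I_r -> nat) q u a t : u \in S sh q.+1 -> u (a, bm0, t) = 0.
Proof.
move=> /memv_suppv -> //; apply/negP => /and3P[_ /= h /eqP tq].
have : t = set0.
  apply/eqP; rewrite -subset0; apply: subset_trans (_ : [set i | 0 < (0%MM :
      'X_{1..n}) i]%N \subset set0).
    by rewrite -mesym1_le.
  by apply/subsetP=> i; rewrite inE mnmE.
by move=> t0; rewrite t0 cards0 in tq.
Qed.

Lemma koszul_bd_exactS r (sh : 'I_r -> nat) q :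
  (S sh q.+1 :&: lker (koszul_bd r) = koszul_bd r @: S sh q.+2)%VS.
Proof.
apply/vspaceP=> u; rewrite memv_cap memv_ker; apply/andP/idP.
  move=> [uS /eqP ku]; apply: koszul_bd_exact => // a t; exact: graded_bm0 uS.
move=> h; split; first exact: (subvP (koszul_bd_graded _ _)).
by case/memv_imgP: h => w _ ->; rewrite koszul_bd_bd.
Qed.

Section OneMap.
Variables (r r' : nat) (sh : 'I_r -> nat) (sh' : 'I_r' -> nat) (D : 'M[R]_(r, r')).
Hypothesis Dhomog : forall a a', homog_shift (D a a') (sh a) (sh' a').

Lemma homogE a a' m : (D a a')@_m != 0 -> (mdeg m + sh' a' = sh a)%N.
Proof. by rewrite -mcoeff_msupp => /Dhomog. Qed.

Lemma mulD_graded q : (mulD D @: S sh q <= S sh' q)%VS.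
Proof.
apply/subvP=> w /memv_imgP[u /memv_suppv u0 ->]; apply/memv_suppv => y.
apply: contraNeq; rewrite mulDE => /eqP h.
have [[a b] /= bP uD] : exists2 p : 'I_r * BM, (p.2 <= y.1.2)%MM &
    u (p, y.2) * (D p.1 y.1.1)@_(y.1.2 - p.2) != 0.
  move: h; rewrite pair_big_dep /= => h.
  have [p /andP[p1 p2]|none] := pickP (fun p : 'I_r * BM => (p.2 <= y.1.2)%MM &&
    (u (p, y.2) * (D p.1 y.1.1)@_(y.1.2 - p.2) != 0)); first by exists p.
  case: h; apply: big1 => -[a b] /= hb; apply/eqP.
  by have := none (a, b); rewrite /= hb /= => /negbFE.
move: uD; rewrite mulf_eq0 negb_or => /andP[un /homogE hD].
have : graded sh q (a, b, y.2) by apply: contraR un => /u0 ->.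
move=> /and3P[/eqP /= hd hm hc]; apply/and3P; split => //.
  have := congr1 mdeg (submK bP); rewrite mdegD => hs; apply/eqP.
  by rewrite /= in hs hD hd; lia.
exact: lepm_trans bP.
Qed.

Definition rowX (u : chain r) t : 'rV[R]_r := \row_a \sum_b u (a, b, t) *: 'X_[b].

Lemma rowXE u t a (b : BM) : (rowX u t 0 a)@_b = u (a, b, t).
Proof.
rewrite mxE raddf_sum /= (bigD1 b) //= mcoeffZ mcoeffX eqxx mulr1.
rewrite big1 ?addr0 // => c cb; rewrite mcoeffZ mcoeffX.
by rewrite (negPf (_ : c != b :> 'X_{1..n})) ?mulr0.
Qed.

Lemma rowX_big u t a (m : 'X_{1..n}) : (j < mdeg m)%N -> (rowX u t 0 a)@_m = 0.
Proof.
move=> jm; rewrite mxE raddf_sum big1 //= => b _; rewrite mcoeffZ mcoeffX.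
case: eqP => [bm|_]; last by rewrite mulr0.
by have := bmdeg b; rewrite bm ltnNge jm.
Qed.

Lemma rowX_mulD u t a' (b' : BM) : ((rowX u t *m D) 0 a')@_b' = mulD D u (a', b', t).
Proof.
rewrite mulDE mxE raddf_sum; apply: eq_bigr => a _ /=.
rewrite (mcoeffM_bounded _ _ (bmdeg b')); apply: eq_bigr => b _.
by rewrite rowXE.
Qed.

(** The actual module coefficient of [e_t]. [rowX] is this vector times x^t, which makes its
    polynomial coefficients the values of [u] themselves. *)
Definition rowQ (u : chain r) t : 'rV[R]_r :=
  \row_a \sum_(b : BM | (mesym1 t <= b)%MM) u (a, b, t) *: 'X_[b - mesym1 t].

Lemma rowQ_X u t q : u \in S sh q -> rowX u t = 'X_[mesym1 t] *: rowQ u t.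
Proof.
move=> /memv_suppv u0; apply/rowP=> a; rewrite !mxE mulr_sumr.
rewrite [RHS]big_mkcond; apply: eq_bigr => b _; case: ifPn => [tb|tb].
  by rewrite -scalerAr -mpolyXD addmC submK.
by rewrite u0 ?scale0r //; apply/negP=> /and3P[_ h _]; case/negP: tb.
Qed.

End OneMap.

(** Chains only record monomials of degree at most [j]. Homogeneity of [D] keeps the whole product
    within that bound, so the identity holds between full polynomials. *)
Lemma rowX_mulD_graded r r' (sh : 'I_r -> nat) (sh' : 'I_r' -> nat) (D : 'M[R]_(r, r')) q u t :
  (forall a a', homog_shift (D a a') (sh a) (sh' a')) ->
  u \in S sh q -> rowX (mulD D u) t = rowX u t *m D.
Proof.
move=> Dh uS; apply/rowP=> a'; apply/mpolyP=> m.
case: (ltnP j (mdeg m)) => jm; last first.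
  have mj : (mdeg m < j.+1)%N by [].
  by rewrite -[m]/(val (BMultinom mj)) rowXE rowX_mulD.
rewrite rowX_big //; apply/esym/eqP; apply: contraLR jm => h; rewrite -leqNgt.
move: h; rewrite mxE raddf_sum /= => h.
have [a ha] : exists a, (rowX u t 0 a * D a a')@_m != 0.
  apply/existsP; apply: contraR h; rewrite negb_exists => /forallP h.
  by rewrite big1 // => a _; apply/eqP; have := h a; rewrite negbK.
move: ha; rewrite -mcoeff_msupp => /msuppM_le /allpairsP[[m1 m2] /= [h1 h2 ->]].
have := Dh _ _ _ h2; rewrite mdegD.
move: h1; rewrite mcoeff_msupp.
case: (ltnP j (mdeg m1)) => jm1; first by rewrite rowX_big // eqxx.
rewrite -[m1]/(val (BMultinom (jm1 : (mdeg m1 < j.+1)%N))) rowXE => h1.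
have : graded sh q (a, BMultinom (jm1 : (mdeg m1 < j.+1)%N), t).
  by apply: contraR h1 => /(memv_suppv _ _ uS) ->.
by move=> /and3P[/eqP /= <- _ _]; lia.
Qed.

Lemma mulD_comp0 r0 r1 r2 (sh0 : 'I_r0 -> nat) (sh1 : 'I_r1 -> nat) (D0 : 'M[R]_(r0, r1))
  (D1 : 'M[R]_(r1, r2)) q u :
  (forall a a', homog_shift (D0 a a') (sh0 a) (sh1 a')) ->
  D0 *m D1 = 0 -> u \in S sh0 q -> mulD D1 (mulD D0 u) = 0.
Proof.
move=> Dh D01 uS; apply/ffunP=> -[[a b] t]; rewrite -rowX_mulD ffunE.
by rewrite (rowX_mulD_graded _ Dh uS) -mulmxA D01 mulmx0 mxE mcoeff0.
Qed.

(** The lifts over the polynomial ring need not be homogeneous: [w] keeps their part of the right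
    degree, and the homogeneity of [D] shows that this part already maps to [u]. *)
Lemma row_lift r r' (sh : 'I_r -> nat) (sh' : 'I_r' -> nat) (D : 'M[R]_(r, r')) q u :
  (forall a a', homog_shift (D a a') (sh a) (sh' a')) ->
  u \in S sh' q -> (forall t, exists W, rowQ u t = W *m D) ->
  u \in (mulD D @: S sh q)%VS.
Proof.
move=> Dh uS /fin_all_exists[W WE].
pose w : chain r := [ffun x : idx r =>
    if graded sh q x then (W x.2 0 x.1.1)@_(x.1.2 - mesym1 x.2) else 0].
have wS : w \in S sh q by apply/memv_suppv => x /negPf xS; rewrite ffunE xS.
apply/memv_imgP; exists w => //; apply/ffunP=> -[[a' b'] t].
case: (boolP (graded sh' q (a', b', t))) => xS; last first.
  rewrite (memv_suppv _ _ uS _ xS); apply/esym.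
  by have /memv_suppv -> := subvP (mulD_graded Dh q) _ (memv_img (mulD D) wS).
rewrite mulDE -[LHS]rowXE (rowQ_X t uS) WE !mxE mulr_sumr raddf_sum /=.
case/and3P: xS => /eqP /= hd hm hc.
apply: eq_bigr => a _; rewrite mulrA [_ * W _ _ _]mulrC.
rewrite (mcoeffM_bounded _ _ (bmdeg b')); apply: eq_bigr => b bb'.
case: (eqVneq (D a a')@_(b' - b) 0) => [->|/(homogE Dh) hD]; first by rewrite !mulr0.
congr (_ * _); rewrite mcoeffMXE ffunE /graded /= hc andbT.
have -> : (sh a + mdeg b == j)%N.
  have := congr1 mdeg (submK bb'); rewrite mdegD => hs; apply/eqP; lia.
by [].
Qed.

End Chains.

(** * From the minimal resolution to the Koszul homology of R/I *)

Section ResolutionAxioms.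
Variables (K : fieldType) (n : nat) (I : {pred {mpoly K[n]}}).
Variable F : min_graded_resolution I.

Lemma res_aug_homog a : homog_shift (res_aug F a 0) (res_shift a) 0.
Proof. by case: F a. Qed.

Lemma res_diff_homog i a b :
  homog_shift (res_diff F i a b) (res_shift a) (res_shift b).
Proof. by case: F i a b. Qed.

Lemma res_augP f : f \in I <-> exists u : 'rV_(res_rank F 0), u *m res_aug F = f%:M.
Proof. by case: F. Qed.

Lemma res_exact0 (u : 'rV_(res_rank F 0)) :
  u *m res_aug F = 0 <-> exists v, u = v *m res_diff F 0.
Proof. by case: F u. Qed.

Lemma res_exactS i (u : 'rV_(res_rank F i.+1)) :
  u *m res_diff F i = 0 <-> exists v, u = v *m res_diff F i.+1.
Proof. by case: F i u. Qed.

Lemma res_diff_min i a b : (res_diff F i a b)@_0%MM = 0.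
Proof. by case: F i a b. Qed.

Lemma res_rank_gt_length i : (res_length F < i)%N -> res_rank F i = 0%N.
Proof. by case: F i. Qed.

End ResolutionAxioms.

Section QuadraticMonomialIdeal.
Variables (K : fieldType) (n : nat) (I : {pred {mpoly K[n]}}).
Hypothesis HI : generated_by_quadratic_monomials I.
Implicit Types (m b : 'X_{1..n}) (t : {set 'I_n}) (f g : {mpoly K[n]}).

Definition in_ideal m := [exists i, exists k, (U_(i) + U_(k) <= m)%MM && Gedge I i k].

Lemma in_idealS m m' : (m <= m')%MM -> in_ideal m -> in_ideal m'.
Proof.
move=> mm' /existsP[i /existsP[k /andP[le e]]].
by apply/existsP; exists i; apply/existsP; exists k; rewrite e (lepm_trans le).
Qed.

Lemma mdeg2 m : mdeg m = 2%N -> exists i k, m = (U_(i) + U_(k))%MM.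
Proof.
move=> m2; have [i mi] : exists i, (0 < m i)%N.
  apply/existsP; apply: contra_eqT m2; rewrite negb_exists => /forallP m0.
  by rewrite mdegE big1 // => i _; apply/eqP; rewrite -leqn0 leqNgt.
have Ui : (U_(i) <= m)%MM.
  by apply/mnm_lepP=> k; rewrite mnm1E; case: eqP => // <-.
have : mdeg (m - U_(i)) == 1%N.
  by have := congr1 mdeg (submK Ui); rewrite mdegD mdeg1 m2; lia.
by case/mdeg1P=> k /eqP mk; exists k, i; rewrite -mk submK.
Qed.

Lemma ideal0 : 0 \in I.
Proof. by case: HI => M [_ ->]; exists [::]; rewrite big_nil. Qed.

Lemma idealD f g : f \in I -> g \in I -> f + g \in I.
Proof.
case: HI => M [_ IE] /IE[s [sM ->]] /IE[s' [s'M ->]]; apply/IE.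
by exists (s ++ s'); rewrite all_cat sM s'M big_cat.
Qed.

Lemma idealM f g : g \in I -> f * g \in I.
Proof.
case: HI => M [_ IE] /IE[s [sM ->]]; apply/IE.
exists [seq (f * p.1, p.2) | p <- s]; split; first by rewrite all_map.
by rewrite big_map mulr_sumr; apply: eq_bigr => p _ /=; rewrite mulrA.
Qed.

Lemma mem_ideal f : (f \in I) <-> (forall m, m \in msupp f -> in_ideal m).
Proof.
split=> [|fI].
  case: HI => M [M2 IE] /IE[s [sM ->]] m.
  elim: s sM => [_|p s IH /= /andP[pM sM]]; first by rewrite big_nil msupp0.
  rewrite big_cons => /msuppD_le; rewrite mem_cat => /orP[|/IH]; last exact.
  rewrite mcoeff_msupp mcoeffMXE; case: ifP => [pm _|]; last by rewrite eqxx.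
  apply: in_idealS pm _; have [i [k ik]] := mdeg2 (M2 _ pM).
  apply/existsP; exists i; apply/existsP; exists k; rewrite ik lepm_refl /=.
  rewrite /Gedge; apply/IE; exists [:: (1, p.2)].
  by rewrite /= pM big_seq1 mul1r ik mpolyXD.
rewrite [f]mpolyE big_seq; apply: (big_ind (fun g => g \in I)).
- exact: ideal0.
- exact: idealD.
move=> m mf; have /existsP[i /existsP[k /andP[le e]]] := fI _ mf.
by rewrite -(submK le) mpolyXD scalerAl mpolyXD; apply: idealM.
Qed.

Lemma in_ideal0 : in_ideal 0%MM = false.
Proof.
apply/negbTE/negP=> /existsP[i /existsP[k /andP[/mnm_lepP/(_ i)]]].
by rewrite mnmDE !mnm1E mnm0E eqxx.
Qed.

Lemma Gedge_sym : ssrbool.symmetric (Gedge I).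
Proof. by move=> i k; rewrite /Gedge mulrC. Qed.

Definition std_face b t := (mesym1 t <= b)%MM && ~~ in_ideal (b - mesym1 t).

Section Resolution.
Variable F : min_graded_resolution I.

(* The resolution shifted by one, with R in position 0. *)
Definition cplx_rank p := if p is p'.+1 then res_rank F p' else 1%N.

Definition cplx_shift p : 'I_(cplx_rank p) -> nat :=
  if p is p'.+1 return 'I_(cplx_rank p) -> nat then @res_shift _ _ _ F p' else fun=> 0%N.

Definition cplx_diff p : 'M[{mpoly K[n]}]_(cplx_rank p.+1, cplx_rank p) :=
  if p is p'.+1 return 'M[{mpoly K[n]}]_(cplx_rank p.+1, cplx_rank p) then res_diff F p' else
      res_aug F.

Lemma cplx_diff_homog p a (b : 'I_(cplx_rank p)) :
    homog_shift (cplx_diff p a b) (cplx_shift a) (cplx_shift b).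
Proof.
case: p a b => [|p] a b; last exact: res_diff_homog.
by rewrite ord1; apply: res_aug_homog.
Qed.

Lemma res_mem f : f \in I <-> exists u : 'rV_(cplx_rank 1), u *m cplx_diff 0 = f%:M.
Proof. exact: res_augP. Qed.

Lemma cplx_diff_exact p (u : 'rV_(cplx_rank p.+1)) :
  u *m cplx_diff p = 0 <-> exists v, u = v *m cplx_diff p.+1.
Proof. by case: p u => [|p] u; [apply: res_exact0|apply: res_exactS]. Qed.

Lemma cplx_diff_comp0 p : cplx_diff p.+1 *m cplx_diff p = 0.
Proof.
apply/row_matrixP=> i; rewrite row0 rowE mulmxA.
by apply/cplx_diff_exact; exists (delta_mx 0 i).
Qed.

Lemma aug_mem (u : 'rV_(cplx_rank 1)) : (u *m cplx_diff 0) 0 0 \in I.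
Proof. by apply/res_mem; exists u; apply: mx11_scalar. Qed.

(** For the augmentation this is not an axiom of the resolution: its entries lie in [I], whose
    elements have no constant term. *)
Lemma cplx_diff_min p a (b : 'I_(cplx_rank p)) : (cplx_diff p a b)@_0%MM = 0.
Proof.
case: p a b => [|p] a b; last exact: res_diff_min.
rewrite ord1; have := aug_mem (delta_mx 0 a); rewrite -rowE mxE => /mem_ideal h.
by apply/eqP; rewrite mcoeff_eq0; apply: contraFN in_ideal0 => /h.
Qed.

Variable j : nat.
Local Notation BM := 'X_{1..n < j.+1}.
Local Notation idx r := ('I_r * BM * {set 'I_n})%type.
Local Notation chain r := {ffun idx r -> K^o}.
Local Notation S p q := (suppv K (@graded n j (cplx_rank p) (@cplx_shift p%N) q%N)).
Local Notation d p := (@mulD K n j _ _ (cplx_diff p)).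
Local Notation ker_im p q := (d p%N @: S p%N.+1 q%N)%VS.

(** Exactness over R passes to chains: since x^t is a nonzerodivisor, [rowQ u t] is in the kernel,
    and [row_lift] turns its preimage into a chain of degree [j]. *)
Lemma ker_mulD p (q : nat) : (S p.+1 q :&: lker (d p) = ker_im p.+1 q)%VS.
Proof.
apply/vspaceP=> u; rewrite memv_cap memv_ker; apply/andP/idP.
  move=> [uS /eqP du]; apply: (row_lift (@cplx_diff_homog _)) => // t.
  apply/cplx_diff_exact; apply/rowP=> a; apply/eqP.
  have /eqP := congr1 (fun M : 'rV_ _ => M 0 a) (rowX_mulD_graded t (@cplx_diff_homog _) uS).
  rewrite du (rowQ_X t uS) -scalemxAl ![in X in _ == X]mxE [X in X == _]mxE.
  rewrite big1 => [|b _]; last by rewrite ffunE scale0r.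
  by rewrite eq_sym mulf_eq0 mpolyX_eq0 /= mxE [in X in _ -> X]mxE.
move=> uI; split; first exact: (subvP (mulD_graded j (@cplx_diff_homog p.+1) q) _ uI).
case/memv_imgP: uI => w wS ->.
by rewrite (mulD_comp0 (@cplx_diff_homog _) (cplx_diff_comp0 p) wS).
Qed.

Lemma ker_im_bm0 p q u a t : u \in ker_im p q -> u (a, bm0, t) = 0.
Proof.
case/memv_imgP=> w _ ->; rewrite mulDE big1 // => c _; apply: big1 => b _ /=.
by rewrite sub0m cplx_diff_min mulr0.
Qed.

Lemma koszul_bd_deg0 r (sh : 'I_r -> nat) (u : chain r) :
  u \in suppv K (graded sh 0) -> koszul_bd K n j r u = 0.
Proof.
move=> /memv_suppv u0; apply/ffunP=> x; rewrite koszul_bdE ffunE /bd big1 // => v vx.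
by rewrite u0 ?mulr0 // /graded /= cardsU1 vx !andbF.
Qed.

(** For [q > 0] this is exactness of the Koszul complex; at [q = 0], where every element is a cycle,
    it is minimality: the image of the differential lies in the maximal ideal times its target. *)
Lemma ker_im_min p q :
  (ker_im p q :&: lker (koszul_bd K n j (cplx_rank p)) =
   ker_im p q :&: koszul_bd K n j (cplx_rank p) @: S p q.+1)%VS.
Proof.
apply/vspaceP=> u; rewrite !memv_cap memv_ker; apply/andP/andP => -[uI h]; split=> //.
  apply: koszul_bd_exact; first exact: (subvP (mulD_graded j (@cplx_diff_homog p) q) _ uI).
    exact/eqP.
  by move=> a t; apply: ker_im_bm0 uI.
by case/memv_imgP: h => w _ ->; rewrite koszul_bd_bd.
Qed.

(** With [ker_im p] standing for the syzygy module M_p, [dimZ p q - dimB p q] is the dimension of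
    H_q(K (x) M_p) in degree [j]. *)
Definition dimZ p q := \dim (ker_im p q :&: lker (koszul_bd K n j (cplx_rank p))).
Definition dimB p q := \dim (koszul_bd K n j (cplx_rank p) @: ker_im p q.+1).

Lemma dimZ_dimB_shift p q : (dimZ p q.+1 + dimB p.+1 q = dimZ p.+1 q + dimB p q.+1)%N.
Proof.
rewrite /dimZ /dimB -!ker_mulD; apply: (koszul_shift (S := fun q => S p.+1 q)).
- exact: mulD_koszul_bd.
- exact: koszul_bd_graded.
- exact: koszul_bd_exactS.
by rewrite ker_mulD; apply: ker_im_min.
Qed.

(** [X] is the maximal ideal times F_p. Minimality puts the kernel of the differential inside [X],
    so M_p and F_p have the same dimension modulo the maximal ideal, namely the number of basis
    elements of degree [j]. *)
Lemma dimZ_dimB0 p : dimZ p 0 = (betti F p j + dimB p 0)%N.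
Proof.
have Z0 : (ker_im p 0 :&: lker (koszul_bd K n j (cplx_rank p)) = ker_im p 0)%VS.
  apply/capv_idPl/subvP=> u /(subvP (mulD_graded j (@cplx_diff_homog _) _)) uS.
  by rewrite memv_ker (koszul_bd_deg0 uS).
pose X := (koszul_bd K n j (cplx_rank p.+1) @: S p.+1 1)%VS.
have BX : (koszul_bd K n j (cplx_rank p) @: ker_im p 1 = d p @: X)%VS.
  rewrite -!limg_comp; apply: eq_in_limg => u _.
  by rewrite !comp_lfunE mulD_koszul_bd.
(* Membership in the maximal ideal times F_p means the absence of constant coefficients, those at
   [bm0]. *)
have XE : X = suppv K (fun x => graded (@cplx_shift p.+1) 0 x && (x.1.2 != bm0)).
  apply/vspaceP=> u; apply/idP/memv_suppv => [uX x|u0].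
    rewrite negb_and negbK => /orP[xS|/eqP xb].
      by have /memv_suppv -> := subvP (@koszul_bd_graded K n j _ (@cplx_shift p.+1) 0) _ uX.
    case/memv_imgP: uX => w wS ->; rewrite koszul_bdE /bd big1 // => v _.
    by rewrite [x.1]surjective_pairing xb (graded_bm0 _ _ wS) mulr0.
  have uS : u \in S p.+1 0.
    by apply/memv_suppv=> x xS; apply: u0; rewrite (negPf xS).
  apply: koszul_bd_exact => // [|a t]; first exact: koszul_bd_deg0 uS.
  by apply: u0; rewrite /= eqxx andbF.
have XS : (X <= S p.+1 0)%VS by apply: koszul_bd_graded.
have XN : (X :&: lker (d p) = S p.+1 0 :&: lker (d p))%VS.
  apply/eqP; rewrite eqEsubv; apply/andP; split.
    by rewrite subv_cap capvSr (subv_trans (capvSl _ _) XS).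
  rewrite subv_cap capvSr andbT ker_mulD; have := ker_im_min p.+1 0.
  rewrite (_ : _ :&: lker _ = ker_im p.+1 0)%VS; last first.
    apply/capv_idPl/subvP=> u /(subvP (mulD_graded j (@cplx_diff_homog _) _)) uS.
    by rewrite memv_ker (koszul_bd_deg0 uS).
  by move=> ->; rewrite capvSr.
have := limg_ker_dim (d p) X; have := limg_ker_dim (d p) (S p.+1 0).
rewrite /dimZ /dimB Z0 BX XN.
have -> : \dim (S p.+1 0) = (betti F p j + \dim X)%N; last first.
  move=> e1 e2; apply/eqP; rewrite -(eqn_add2l (\dim (S p.+1 0 :&: lker (d p)))).
  by rewrite e1 addnCA e2.
rewrite XE !dim_suppv -(cardID (fun x : idx (cplx_rank p.+1) => x.1.2 == bm0)) /=.
congr (_ + _)%N; last by apply: eq_card => x; rewrite !inE andbC.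
rewrite /betti -(card_imset _ (_ : injective (fun a : 'I_(cplx_rank p.+1) => (a, bm0 :
    BM, set0 : {set 'I_n})))); last first.
  by move=> a b [].
apply: eq_card => -[[a b] t]; rewrite !inE /graded /=; apply/andP/imsetP.
  move=> [/and3P[/= /eqP hs _ /eqP/cards0_eq /= ->] /eqP bb].
  exists a; last by rewrite (bb : b = bm0).
  by rewrite inE; apply/eqP; move: hs; rewrite (bb : b = bm0) mdeg0 addn0.
move=> [a']; rewrite inE => /eqP hs [-> -> ->]; split; last exact: eqxx.
apply/and3P; split; rewrite /= ?cards0 ?mesym1_set0 ?lepm_refl //.
by rewrite mdeg0 addn0; apply/eqP.
Qed.

Lemma dimZ_dimB p q : dimZ p q = (betti F (p + q) j + dimB p q)%N.
Proof.
elim: q p => [|q IH] p; first by rewrite addn0 dimZ_dimB0.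
by have := dimZ_dimB_shift p q; rewrite IH addSnnS; lia.
Qed.

(** The monomials outside [I] are a basis of R/I, so restriction to these indices serves as the
    quotient map and [dS] as the differential of K (x) R/I. *)
Definition std_index : pred (idx (cplx_rank 0)) := fun x => ~~ in_ideal (x.1.2 - mesym1 x.2).

Local Notation dS := (lrestr K std_index \o koszul_bd K n j (cplx_rank 0))%VF.

Lemma std_indexU (b : BM) a v t : std_index (a, b, t) -> std_index (a, b, v |: t).
Proof.
apply: contra => /=; apply: in_idealS; apply/mnm_lepP=> i; rewrite !mnmE.
by apply: leq_sub2l; rewrite !inE; case: (i \in t); rewrite ?orbT.
Qed.

Lemma lrestr_koszul_bd u : lrestr K std_index (koszul_bd K n j (cplx_rank 0) u) = dS (lrestr K
    std_index u).
Proof.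
apply/ffunP=> -[[a b] t]; rewrite comp_lfunE !lrestrE !koszul_bdE /=; case: ifP => // h.
by apply: eq_bigr => v _; rewrite lrestrE (std_indexU _ h).
Qed.

Lemma ker_std q : (S 0 q :&: lker (lrestr K std_index) = ker_im 0 q)%VS.
Proof.
apply/vspaceP=> u; rewrite memv_cap memv_ker; apply/andP/idP.
  move=> [uS /eqP du]; apply: (row_lift (@cplx_diff_homog _)) => // t.
  have : rowQ u t 0 0 \in I.
    apply/mem_ideal=> m; rewrite mcoeff_msupp mxE raddf_sum /=.
    apply: contraR => mI; apply/eqP; apply: big1 => b tb.
    rewrite mcoeffZ mcoeffX; case: eqP => [bm|_]; last by rewrite mulr0.
    have /ffunP/(_ (0, b, t)) := du.
    by rewrite lrestrE ffunE /std_index /= bm mI => ->; rewrite mul0r.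
  by case/res_mem=> W WE; exists W; rewrite WE; apply: mx11_scalar.
move=> uI; split; first exact: (subvP (mulD_graded j (@cplx_diff_homog 0) q) _ uI).
case/memv_imgP: uI => w wS ->; apply/eqP/ffunP=> -[[a b] t].
rewrite lrestrE ffunE; case: ifP => // h; apply/eqP; apply: contraTT h.
rewrite -rowX_mulD (rowQ_X t wS) -scalemxAl mxE mulrC mcoeffMXE negbK /=.
case: ifP => [tb|]; last by rewrite eqxx.
by rewrite ord1 -mcoeff_msupp; have /mem_ideal := aug_mem (rowQ w t); apply.
Qed.

Definition std_graded q : pred (idx (cplx_rank 0)) :=
    fun x => std_index x && graded (@cplx_shift 0) q x.

(** A last use of [koszul_shift], on 0 -> I -> R -> R/I -> 0, raises the Koszul degree to [q.+1]. *)
Lemma betti_std q :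
  \dim (suppv K (std_graded q.+1) :&: lker dS) =
  (betti F q j + \dim (dS @: suppv K (std_graded q.+2)))%N.
Proof.
have := koszul_shift (d := lrestr K std_index) (du := koszul_bd K n j (cplx_rank 0)) (dw := dS)
  (S := fun q => S 0 q) (q := q) lrestr_koszul_bd (@koszul_bd_graded K n j _ _ _)
      (@koszul_bd_exactS K n j _ _ _).
rewrite !lrestr_suppv !ker_std => /(_ (ker_im_min 0 q)).
by have := dimZ_dimB 0 q; rewrite /dimZ /dimB add0n => ->; rewrite addnAC; move/addIn.
Qed.

Definition fiber (b : BM) : 'End(chain (cplx_rank 0)) := lrestr K (fun x => x.1.2 == b).

Lemma dS_E u a (b : BM) t : dS u (a, b, t) =
  if std_index (a, b, t) then bd (fun t => u (a, b, t)) t else 0.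
Proof. by rewrite comp_lfunE lrestrE koszul_bdE. Qed.

Lemma fiber_dS (b : BM) u : fiber b (dS u) = dS (fiber b u).
Proof.
apply/ffunP=> -[[a c] t]; rewrite lrestrE !dS_E /=.
case: ifPn => cb; case: ifP => // _.
  by apply: eq_bd => t'; rewrite lrestrE /= cb.
by rewrite /bd big1 // => v _; rewrite lrestrE /= (negPf cb) mulr0.
Qed.

Lemma fiber_cycles (b : BM) q : (fiber b @: (suppv K (std_graded q) :&: lker dS) =
  suppv K (fun x => (x.1.2 == b) && std_graded q x) :&: lker dS)%VS.
Proof.
apply/vspaceP=> u; apply/memv_imgP/idP.
  move=> [w]; rewrite memv_cap memv_ker => /andP[wS /eqP w0] ->.
  by rewrite memv_cap -lrestr_suppv memv_img // memv_ker -fiber_dS w0 linear0 eqxx.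
rewrite memv_cap => /andP[/memv_suppv uS uk]; exists u.
  rewrite memv_cap uk andbT; apply/memv_suppv => x xS.
  by apply: uS; rewrite (negPf xS) andbF.
apply/ffunP=> x; rewrite lrestrE; case: ifPn => // xb.
by apply: uS; rewrite (negPf xb).
Qed.

Lemma fiber_boundaries (b : BM) q : (fiber b @: (dS @: suppv K (std_graded q)) =
  dS @: suppv K (fun x => (x.1.2 == b) && std_graded q x))%VS.
Proof.
rewrite -lrestr_suppv -[LHS]limg_comp -[RHS]limg_comp; apply: eq_in_limg => u _.
by rewrite [LHS]comp_lfunE [RHS]comp_lfunE; apply: fiber_dS.
Qed.

Lemma std_gradedE q a (b : BM) t :
  std_graded q (a, b, t) = [&& mdeg b == j, std_face b t & #|t| == q].
Proof.
rewrite /std_graded /std_index /graded /std_face /= add0n.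
by case: (in_ideal _); rewrite /= ?andbT ?andbF //= andbF.
Qed.

Section Fiber.
Variables (b : BM) (q : nat).
Hypothesis bj : mdeg b = j.
Local Notation Zb := (suppv K (fun x => (x.1.2 == b) && std_graded q x) :&: lker dS)%VS.
Local Notation Bb := (dS @: suppv K (fun x => (x.1.2 == b) && std_graded q.+1 x))%VS.

Lemma supp_fiber k (u : chain (cplx_rank 0)) :
  u \in suppv K (fun x => (x.1.2 == b) && std_graded k x) <->
  (forall x, x.1.2 != b -> u x = 0) /\
  supported (std_face b) k (fun t => u (0, b, t)).
Proof.
split=> [/memv_suppv u0|[u0 uS]].
  split=> [x xb|t]; first by apply: u0; rewrite (negPf xb).
  by apply: contraR => tS; rewrite u0 //= eqxx std_gradedE bj eqxx.
apply/memv_suppv=> -[[a c] t] /=; case: (eqVneq c b) => [->|cb _]; last exact: u0.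
rewrite std_gradedE bj eqxx ord1 /=; apply: contraNeq; exact: uS.
Qed.

Lemma fiber_cyclesP u : u \in Zb <-> [/\ (forall x, x.1.2 != b -> u x = 0),
  supported (std_face b) q (fun t => u (0, b, t)) & is_cycle (std_face b) (fun t => u (0, b, t))].
Proof.
rewrite memv_cap memv_ker; split.
  move=> /andP[/supp_fiber[u0 uS] /eqP uk]; split => // t /andP[_ tb].
  by have /ffunP/(_ (0, b, t)) := uk; rewrite dS_E /std_index tb ffunE.
move=> [u0 uS uc]; apply/andP; split; first exact/supp_fiber.
apply/eqP/ffunP=> -[[a c] t]; rewrite ffunE dS_E ord1; case: ifP => // h.
case: (eqVneq c b) h => [-> h|cb _]; last first.
  by rewrite /bd big1 // => v _; rewrite u0 ?mulr0.
case: (boolP (mesym1 t <= b)%MM) => tb; first by apply: uc; rewrite /std_face tb.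
rewrite /bd big1 // => v _; case: (eqVneq (u (0, b, v |: t)) 0) => [->|]; rewrite ?mulr0 //.
by move/uS => /andP[/andP[]]; rewrite mesym1_leU (negPf tb) andbF.
Qed.

Lemma fiber_boundariesP u : u \in Bb <-> [/\ (forall x, x.1.2 != b -> u x = 0),
  supported (std_face b) q (fun t => u (0, b, t)) & is_boundary (std_face b) q (fun t =>
      u (0, b, t))].
Proof.
split.
  move=> /memv_imgP[w /supp_fiber[w0 wS] ->].
  have dw t : std_face b t = false -> dS w (0, b, t) = 0.
    rewrite dS_E /std_face /std_index /=; case: ifP => //= _; rewrite andbT => tb.
    rewrite /bd big1 // => v _; case: (eqVneq (w (0, b, v |: t)) 0) => [->|]; rewrite ?mulr0 //.
    by move/wS => /andP[/andP[]]; rewrite mesym1_leU tb andbF.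
  split.
  - move=> [[a c] t] /= cb; rewrite dS_E; case: ifP => // _.
    by rewrite /bd big1 // => v _; rewrite w0 ?mulr0.
  - move=> t; case E : (std_face b t); last by rewrite dw ?eqxx.
    rewrite dS_E; case: ifP => [_|]; last by rewrite eqxx.
    apply: contraR => /= tq; apply/eqP; apply: big1 => v vt.
    case: (eqVneq (w (0, b, v |: t)) 0) => [->|/wS]; first by rewrite mulr0.
    by rewrite cardsU1 vt add1n eqSS (negPf tq) andbF.
  exists (fun t => w (0, b, t)); split => // t /andP[_ tb].
  by rewrite dS_E /std_index tb.
move=> [u0 uS [w [wS wE]]].
pose f (x : idx (cplx_rank 0)) : K^o := if x.1.2 == b then w x.2 else 0.
apply/memv_imgP; exists [ffun x => f x].
  apply/supp_fiber; split=> [x xb|t]; rewrite ffunE /f /= ?eqxx ?(negPf xb) //.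
  exact: wS.
apply/ffunP=> -[[a c] t]; rewrite dS_E ord1.
case: (eqVneq c b) => [->|cb]; last first.
  rewrite u0 //; case: ifP => // _.
  by rewrite /bd big1 // => v _; rewrite ffunE /f /= (negPf cb) mulr0.
have bdE : bd (fun t0 => [ffun x => f x] (0, b, t0)) t = bd w t.
  by apply: eq_bd => t'; rewrite ffunE /f /= eqxx.
rewrite bdE; case: (boolP (std_face b t)) => [tf|tf].
  by rewrite wE //; case/andP: tf => _; rewrite /std_index /= => ->.
have -> : u (0, b, t) = 0 by apply/eqP; apply: contraNT tf => /uS /andP[].
case: ifP => // h; apply/esym; move: tf; rewrite /std_face; move: h; rewrite /std_index /= => ->.
rewrite andbT => tb.
rewrite /bd big1 // => v _; case: (eqVneq (w (v |: t)) 0) => [->|]; rewrite ?mulr0 //.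
by move/wS => /andP[/andP[]]; rewrite mesym1_leU (negPf tb) andbF.
Qed.

Lemma boundaries_sub_cycles : (Bb <= Zb)%VS.
Proof.
apply/subvP=> u uB; have /fiber_boundariesP[u0 uS _] := uB.
rewrite memv_cap; apply/andP; split; first exact/supp_fiber.
case/memv_imgP: uB => w _ ->; rewrite memv_ker; apply/eqP/ffunP=> -[[a c] t].
rewrite dS_E ffunE; case: ifP => // h; rewrite -[RHS](bd_bd (fun t => w (a, c, t)) t).
by apply: eq_bigr => v _; rewrite dS_E (std_indexU _ h).
Qed.

Lemma acyclic_fiber : acyclic_at K (std_face b) q -> \dim Zb = \dim Bb.
Proof.
move=> ac; congr (\dim _); apply/eqP; rewrite eqEsubv boundaries_sub_cycles andbT.
by apply/subvP=> u /fiber_cyclesP[u0 uS uc]; apply/fiber_boundariesP; split => //; apply: ac.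
Qed.

Lemma one_dim_fiber : one_dim_at K (std_face b) q -> \dim Zb = (1 + \dim Bb)%N.
Proof.
move=> [f0 [fS fc fnb fgen]].
pose f (x : idx (cplx_rank 0)) : K^o := if x.1.2 == b then f0 x.2 else 0.
pose e : chain (cplx_rank 0) := [ffun x => f x].
have eE t : e (0, b, t) = f0 t by rewrite ffunE /f /= eqxx.
have e0 x : x.1.2 != b -> e x = 0 by move=> xb; rewrite ffunE /f (negPf xb).
have eZ : e \in Zb.
  apply/fiber_cyclesP; split=> [//|t|t tb]; first by rewrite eE; apply: fS.
  by rewrite -[RHS](fc _ tb); apply: eq_bd.
have eB : e \notin Bb.
  apply/negP=> /fiber_boundariesP[_ _ [w [wS wE]]]; apply: fnb; exists w; split => // t tb.
  by rewrite -eE; apply: wE.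
have -> : Zb = (<[e]> + Bb)%VS.
  apply/eqP; rewrite eqEsubv; apply/andP; split; last first.
    by rewrite subv_add boundaries_sub_cycles andbT -memvE.
  apply/subvP=> u /fiber_cyclesP[u0 uS uc].
  have [c [w [wS wE]]] := fgen _ uS uc.
  apply/memv_addP; exists (c *: e); first exact/memvZ/memv_line.
  exists (u - c *: e); last by rewrite addrC subrK.
  have uE t : (u - c *: e) (0, b, t) = u (0, b, t) - c * f0 t.
    by rewrite !ffunE /GRing.scale /= /f /= eqxx.
  apply/fiber_boundariesP; split=> [x xb|t|].
  - by rewrite !ffunE /GRing.scale /= u0 // /f (negPf xb) mulr0 subr0.
  - rewrite uE; apply: contraR => tS; have := @uS t; have := @fS t.
    case: (eqVneq (u (0, b, t)) 0) => [-> /=|_ _ /(_ isT) h]; last by rewrite h in tS.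
    case: (eqVneq (f0 t) 0) => [-> /=|_ /(_ isT) h]; last by rewrite h in tS.
    by rewrite mulr0 subr0 eqxx.
  by exists w; split=> // t tb; rewrite uE; apply: wE.
rewrite dimv_disjoint_sum; last first.
  apply/eqP; rewrite -subv0; apply/subvP=> v; rewrite memv_cap => /andP[/vlineP[c ->] cB].
  case: (eqVneq c 0) => [->|c0]; first by rewrite scale0r mem0v.
  by case/negP: eB; rewrite -(scalerK c0 e) memvZ.
rewrite dim_vline; case: eqP => // e00; by rewrite e00 mem0v in eB.
Qed.

End Fiber.

(** The Betti number is the sum over multidegrees of total degree [j] of the homology of
    [std_face b] at level [q.+1]. If each term is zero or a line, the sum is the number of lines. *)
Lemma betti_count q (c : pred 'X_{1..n}) :
    (forall b, mdeg b = j -> c b -> one_dim_at K (std_face b) q.+1) ->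
    (forall b, mdeg b = j -> ~~ c b -> acyclic_at K (std_face b) q.+1) ->
  betti F q j = #|[set b : BM | (mdeg b == j) && c b]|.
Proof.
move=> c1 c0; apply/(@addIn (\dim (dS @: suppv K (std_graded q.+2)))).
rewrite -betti_std (dim_sum_fibers (f := fun x => x.1.2)); last first.
  move=> b; rewrite [X in (X <= _)%VS]fiber_cycles; apply: capvS => //.
  apply/subvP=> u /memv_suppv u0; apply/memv_suppv=> x xS.
  by apply: u0; rewrite (negPf xS) andbF.
rewrite [in RHS](dim_sum_fibers (f := fun x => x.1.2)); last first.
  move=> b; rewrite [X in (X <= _)%VS]fiber_boundaries; apply: limgS.
  apply/subvP=> u /memv_suppv u0; apply/memv_suppv=> x xS.
  by apply: u0; rewrite (negPf xS) andbF.
rewrite -sum1_card [X in (_ = X + _)%N]big_mkcond -big_split /=.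
apply: eq_bigr => b _; rewrite [X in \dim X]fiber_cycles [in RHS]fiber_boundaries inE.
case: (eqVneq (mdeg b) j) => bj /=.
  case: ifPn => cb; first by rewrite one_dim_fiber //; apply: c1.
  by rewrite acyclic_fiber //; apply: c0.
(* The index type also holds multidegrees of smaller total degree; these carry no chains. *)
have z k : suppv K (fun x => (x.1.2 == b) && std_graded k x) = 0%VS.
  apply/eqP; rewrite -subv0; apply/subvP=> u /memv_suppv u0; rewrite memv0.
  apply/eqP/ffunP=> -[[a b'] t]; rewrite ffunE u0 //= std_gradedE.
  by case: eqP => // ->; rewrite (negPf bj).
by rewrite !z cap0v limg0 !dimv0.
Qed.

End Resolution.
End QuadraticMonomialIdeal.

Local Close Scope ring_scope.

(** * The complex of a multidegree as a clique complex *)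

Section StandardFaces.
Variables (K : fieldType) (n : nat) (I : {pred {mpoly K[n]}}).
Local Notation T := 'I_n.
Local Notation e := (Gedge I).
Local Notation ec := (Gedge_compl I).
Implicit Types (m b : 'X_{1..n}) (t : {set T}) (v w x y : T).

Lemma Gedge_compl_sym : ssrbool.symmetric ec.
Proof. by move=> x y; rewrite /Gedge_compl eq_sym Gedge_sym. Qed.

Lemma Gedge_compl_irr : irreflexive ec.
Proof. by move=> x; rewrite /Gedge_compl eqxx. Qed.

Lemma mnm2_le x y m :
  (U_(x) + U_(y) <= m)%MM = if x == y then 1 < m x else (0 < m x) && (0 < m y).
Proof.
apply/mnm_lepP/idP => h.
  have hx := h x; have hy := h y; rewrite !mnmDE !mnm1E !eqxx in hx hy.
  by move: hx hy; rewrite [y == x]eq_sym; case: eqP => _; rewrite ?addn0 ?add0n // => ->.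
move=> z; rewrite mnmDE !mnm1E; move: h.
case: (x =P y) => [->|xy]; first by case: (y =P z) => // ->.
move=> /andP[hx hy]; case: (x =P z) => [xz|_]; case: (y =P z) => [yz|_] //=.
- by case: xy; rewrite xz yz.
- by rewrite -xz.
by rewrite -yz.
Qed.

Lemma in_idealP m : reflect
  (exists x y, [/\ e x y & if x == y then 1 < m x else (0 < m x) && (0 < m y)])
  (in_ideal I m).
Proof.
apply: (iffP existsP) => [[x /existsP[y /andP[le xy]]]|[x [y [xy h]]]].
  by exists x, y; split; rewrite // -mnm2_le.
by exists x; apply/existsP; exists y; rewrite mnm2_le h.
Qed.

Lemma mnm_sub_face b t v : (b - mesym1 t)%MM v = b v - (v \in t).
Proof. by rewrite mnmBE mnmE. Qed.

Definition vsupp b := [set v | 0 < b v].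
Definition vones b := [set v | b v == 1].
Definition vtwos b := [set v | b v == 2].
Definition vlink b := [set x in vones b | [forall v in vtwos b, ec x v]].
Definition reduced b := [forall v, (1 < b v) ==> (b v == 2) && e v v].

(** Whether or not [v] is in [t], x_v still divides x^(b-t), and without a loop at [v] its exponent
    is irrelevant to membership in [I]. *)
Lemma std_face_toggle v b t : 1 < b v -> ~~ e v v ->
  std_face I b (v |: t) = std_face I b t.
Proof.
move=> bv nv; rewrite /std_face mesym1_leU ltnW //=; congr (_ && ~~ _).
apply/in_idealP/in_idealP => -[x [y [xy h]]]; exists x, y; split => //; move: h;
  rewrite !mnm_sub_face !inE.
  by case: (x =P y) => _; case: (x \in t); case: (y \in t); rewrite ?orbT //; lia.
case: (x =P y) => [xE|_].
  case: (x =P v) => [xv|//]; by rewrite -xE xv (negPf nv) in xy.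
move=> /andP[hx hy].
by case: (x =P v) => [->|_]; case: (y =P v) => [->|_] /=; apply/andP; split => //; lia.
Qed.

Lemma std_face_loop3 v b t : 2 < b v -> e v v -> std_face I b t = false.
Proof.
move=> bv vv; apply/negbTE; rewrite negb_and negbK; apply/orP; right.
by apply/in_idealP; exists v, v; split; rewrite // eqxx mnm_sub_face; case: (v \in t); lia.
Qed.

Lemma vlink_sub b : vlink b \subset vsupp b.
Proof. by apply/subsetP=> x; rewrite !inE => /andP[/eqP->]. Qed.

Lemma std_face_clique b t : reduced b -> std_face I b t -> clique ec (vtwos b).
Proof.
move=> /forallP rb /andP[_ /in_idealP nI]; apply/cliqueP=> x y; rewrite !inE => /eqP bx /eqP by_ xy.
rewrite /Gedge_compl xy; apply/negP=> exy; apply: nI; exists x, y; split => //.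
by rewrite (negPf xy) !mnm_sub_face bx by_; case: (x \in t); case: (y \in t).
Qed.

(** The loop at a doubled vertex forces it into [t], yet one factor x_v remains in x^(b-t). It is
    thus never in the face [vsupp b :\: t], but every vertex of the face must be compatible with it;
    hence the link. *)
Lemma std_face_coface b t : reduced b -> clique ec (vtwos b) ->
  std_face I b t = coface ec (vsupp b) (vlink b) t.
Proof.
move=> /forallP rb /cliqueP cb; rewrite /std_face /coface mesym1_le; congr (_ && _).
have red v : 1 < b v -> b v = 2 /\ e v v.
  by move=> bv; have := rb v; rewrite bv => /andP[/eqP].
apply/idP/andP => [/in_idealP nI|[/subsetP tl /cliqueP tc]]; last first.
  apply/in_idealP=> -[x [y [xy]]].
  have cases z : 0 < b z - (z \in t) -> (z \in vsupp b :\: t) \/ z \in vtwos b.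
    rewrite !inE; case: (z \in t) => /=; last by rewrite subn0; left.
    by rewrite subn_gt0 => /red[->]; right.
  rewrite !mnm_sub_face; case: (eqVneq x y) => [_ h|nxy /andP[/cases hx /cases hy]].
    have [bx _] := red x (leq_trans h (leq_subr _ _)).
    have := tl x; rewrite !inE bx; case: (x \in t) h => //=; rewrite ?bx //.
    by move=> _ /(_ isT).
  suff : ec x y by rewrite /Gedge_compl xy andbF.
  have lk u w : u \in vsupp b :\: t -> w \in vtwos b -> ec u w.
    by move=> /tl; rewrite inE => /andP[_ /forall_inP]; apply.
  case: hx hy => hx [] hy.
  - exact: tc.
  - exact: lk.
  - by rewrite Gedge_compl_sym; apply: lk.
  exact: cb.
have edge x y : x != y -> 0 < (b - mesym1 t)%MM x -> 0 < (b - mesym1 t)%MM y -> ec x y.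
  move=> xy hx hy; rewrite /Gedge_compl xy; apply/negP=> exy; apply: nI.
  by exists x, y; rewrite (negPf xy) hx hy.
have one x : x \in vsupp b :\: t -> b x = 1.
  rewrite !inE => /andP[xt bx]; apply/eqP; rewrite eqn_leq bx andbT leqNgt.
  apply/negP=> /red[b2 xx]; apply: nI; exists x, x; split => //.
  by rewrite eqxx mnm_sub_face b2 (negPf xt).
have pos x : x \in vsupp b :\: t -> 0 < (b - mesym1 t)%MM x.
  by move=> xt; rewrite mnm_sub_face one //; move: xt; rewrite inE => /andP[/negPf->].
split; last by apply/cliqueP=> x y /pos hx /pos hy xy; apply: edge.
apply/subsetP=> x xt; rewrite !inE one //=; apply/forall_inP=> v; rewrite inE => /eqP bv.
apply: edge; [|exact: pos|by rewrite mnm_sub_face bv; case: (v \in t)].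
by apply: contra_eqN bv => /eqP <-; rewrite one.
Qed.

Lemma std_acyclic b q :
  (reduced b -> clique ec (vtwos b) -> acyclic_at K (coface ec (vsupp b) (vlink b)) q) ->
  acyclic_at K (std_face I b) q.
Proof.
move=> h; have [rb|] := boolP (reduced b); last first.
  rewrite negb_forall => /existsP[v]; rewrite negb_imply negb_and => /andP[bv].
  case: (boolP (e v v)) => [vv|nv _]; last by apply: (acyclic_toggle (v := v)) => t;
      apply: std_face_toggle.
  rewrite orbF => b2; apply: acyclic_empty => t; rewrite (@std_face_loop3 v) //.
  by rewrite ltn_neqAle eq_sym b2.
have [cb|ncb] := boolP (clique ec (vtwos b)); last first.
  apply: acyclic_empty => t tf; case/negP: ncb; exact: std_face_clique tf.
by apply: eq_acyclic (h rb cb) => t; rewrite std_face_coface.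
Qed.

Lemma reduced_le2 b v : reduced b -> b v <= 2.
Proof.
move=> /forallP/(_ v); case: (ltnP 1 (b v)) => [_ /andP[/eqP-> //]|h _].
exact: leq_trans h _.
Qed.

Lemma card_vsupp b : reduced b -> #|vsupp b| = #|vones b| + #|vtwos b|.
Proof.
move=> rb; rewrite -!sum1dep_card [LHS]big_mkcond /=.
rewrite [X in _ = X + _]big_mkcond [X in _ = _ + X]big_mkcond -big_split /=.
by apply: eq_bigr => v _; have := reduced_le2 v rb; case: (b v) => [|[|[|]]].
Qed.

Lemma mdeg_reduced b : reduced b -> mdeg b = #|vones b| + 2 * #|vtwos b|.
Proof.
move=> rb; rewrite mdegE -!sum1dep_card big_distrr /=.
rewrite [X in _ = X + _]big_mkcond [X in _ = _ + X]big_mkcond -big_split /=.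
by apply: eq_bigr => v _; have := reduced_le2 v rb; case: (b v) => [|[|[|]]].
Qed.

Lemma vlink_vones b : vlink b \subset vones b.
Proof. by apply/subsetP=> x; rewrite inE => /andP[]. Qed.

Lemma vlink_squarefree b : reduced b -> #|vtwos b| = 0 -> vlink b = vsupp b.
Proof.
move=> rb /cards0_eq t0; apply/setP=> x; rewrite !inE t0.
have -> : [forall v in set0, ec x v] by apply/forall_inP=> v; rewrite inE.
rewrite andbT; have := reduced_le2 x rb.
have : x \notin vtwos b by rewrite t0 inE.
by rewrite inE; case: (b x) => [|[|[|]]].
Qed.

End StandardFaces.

(** * Vanishing ranges, and the Betti number counted by shortest cycles *)

Section BettiNumbers.
Variables (K : fieldType) (n : nat) (I : {pred {mpoly K[n]}}).
Hypothesis HI : generated_by_quadratic_monomials I.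
Variable F : min_graded_resolution I.
Local Notation T := 'I_n.
Local Notation e := (Gedge I).
Local Notation ec := (Gedge_compl I).
Local Notation pairs := (induced_disjoint_edge_pairs e).
Local Notation cycles := (induced_cycles ec).
Local Notation e_sym := (@Gedge_sym K n I).
Local Notation ec_sym := (@Gedge_compl_sym K n I).
Local Notation ec_irr := (@Gedge_compl_irr K n I).
Implicit Types (b : 'X_{1..n}) (v w x y : T).

Lemma betti_vanish i j :
    (forall b, mdeg b = j -> reduced I b -> clique ec (vtwos b) ->
       acyclic_at K (coface ec (vsupp b) (vlink I b)) i.+1) ->
  betti F i j = 0.
Proof.
move=> h; rewrite (betti_count HI F (c := pred0)) // => [|b bj _].
  by apply/eqP; rewrite cards_eq0; apply/eqP/setP=> b; rewrite !inE andbF.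
by apply: std_acyclic; apply: h.
Qed.

Lemma betti_low i j : j < i + 2 -> betti F i j = 0.
Proof.
move=> ji; apply: betti_vanish => b bj rb _.
have := mdeg_reduced rb; have := card_vsupp rb; rewrite bj => cE cj.
have [E_lt|E_ge] := ltnP #|vsupp b| i.+1; first by apply: coface_triv; rewrite E_lt.
have t0 : #|vtwos b| = 0 by card_lia.
rewrite vlink_squarefree //; apply: (coface_top ec_sym) => //; last by card_lia.
by rewrite -card_gt0; apply: leq_trans E_ge.
Qed.

(** Since [mdeg b] is [#|vones b| + 2 * #|vtwos b|] and the link lies in [vones b], the bound of
    [coface_small] with [s = #|vsupp b| - i.+1] is implied by [2 * i + 2 < j]. *)
Lemma betti_high i j : 2 * i + 2 < j -> betti F i j = 0.
Proof.
move=> ij; apply: betti_vanish => b bj rb _.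
have := mdeg_reduced rb; have := card_vsupp rb; rewrite bj => cE cj.
have cl := subset_leq_card (vlink_vones I b).
by apply: (coface_small ec_sym ec_irr (s := #|vsupp b| - i.+1)); rewrite ?vlink_sub //; card_lia.
Qed.

Lemma reduced_loop b v : reduced I b -> v \in vtwos b -> e v v.
Proof. by move=> /forallP/(_ v); rewrite inE => /implyP h /eqP bv; have := h;
    rewrite bv => /(_ isT). Qed.

Lemma loop_edge v : e v v -> [set v] \in edges e.
Proof. by move=> vv; apply/edgesP; exists v, v; rewrite setUid. Qed.

Lemma disjoint1 v (S : {set T}) : v \notin S -> [disjoint [set v] & S].
Proof. by move=> vS; rewrite disjoints1. Qed.

Lemma compl_edge x y : ec x y -> ~~ e x y.
Proof. by case/andP. Qed.

Lemma two_loops_pair v w : e v v -> e w w -> ec v w -> [set [set v]; [set w]] \in pairs.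
Proof.
move=> vv ww vw; apply: (mem_pairs e_sym); rewrite ?loop_edge //.
  by apply: disjoint1; rewrite inE; case/andP: vw.
by move=> x y; rewrite !inE => /eqP-> /eqP->; apply: compl_edge.
Qed.

Lemma loop_edge_pair v x y : e v v -> e x y -> ec x v -> ec y v ->
  [set [set v]; [set x; y]] \in pairs.
Proof.
move=> vv xy xv yv; apply: (mem_pairs e_sym); rewrite ?loop_edge //.
- by apply/edgesP; exists x, y.
- apply: disjoint1; rewrite !inE negb_or ![v == _]eq_sym.
  by case/andP: xv => -> _; case/andP: yv.
move=> a c; rewrite !inE => /eqP-> /orP[]/eqP->; rewrite e_sym; exact: compl_edge.
Qed.

Lemma vsupp_mesym1 (S : {set T}) : vsupp (mesym1 S) = S.
Proof. by apply/setP=> x; rewrite inE mnmE; case: (x \in S). Qed.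

Lemma reduced_mesym1 (S : {set T}) : reduced I (mesym1 S).
Proof. by apply/forallP=> v; rewrite mnmE; case: (v \in S). Qed.

Lemma vtwos_mesym1 (S : {set T}) : vtwos (mesym1 S) = set0.
Proof. by apply/setP=> v; rewrite !inE mnmE; case: (v \in S). Qed.

Lemma cycle_set_one_dim (S : {set T}) q r : 4 <= r ->
    (forall c, induced_cycle ec c -> r <= size c) -> S \in cycle_sets ec r -> q + 2 = r ->
  one_dim_at K (std_face I (mesym1 S)) q.
Proof.
move=> r4 girth /(cycle_setsP r4)[c [cc cr ->]].
move=> qr; apply: (@eq_one_dim K n (coface ec [set x in c] [set x in c])).
  move=> t; rewrite std_face_coface ?reduced_mesym1 ?vlink_squarefree ?vsupp_mesym1 //.
  - exact: reduced_mesym1.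
  - by rewrite vtwos_mesym1 cards0.
  by rewrite vtwos_mesym1; apply/cliqueP=> x y; rewrite inE.
case: c cc cr => [/and3P[] //|v p] cc cr.
by apply: (coface_one_dim_cycle K ec_sym ec_irr cc); rewrite cr.
Qed.
Lemma squarefreeE b : reduced I b -> #|vtwos b| = 0 -> b = mesym1 (vsupp b).
Proof.
move=> rb /cards0_eq t0; apply/mnmP=> x; rewrite mnmE inE.
have := reduced_le2 x rb; have : x \notin vtwos b by rewrite t0 inE.
by rewrite inE; case: (b x) => [|[|[|]]].
Qed.

Lemma spanning_cycle (c : seq T) (S : {set T}) : induced_cycle ec c -> {subset c <= S} ->
  #|S| <= size c -> S \in cycle_sets ec (size c).
Proof.
move=> cc cS Sc; have -> : S = [set x in c].
  apply/esym/eqP; rewrite eqEcard; apply/andP; split.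
    by apply/subsetP=> x; rewrite inE; apply: cS.
  by case/and3P: cc => /andP[_ /card_uniqP cu] _ _; rewrite cardsE cu.
exact: mem_cycle_sets.
Qed.

Section NoPairs.
Hypothesis no_pairs : pairs = set0.

Lemma no_pairs_twos b : reduced I b -> clique ec (vtwos b) -> #|vtwos b| <= 1.
Proof.
move=> rb /cliqueP cb; rewrite leqNgt; apply/negP=> /card_gt1P[v [w [vt wt vw]]].
have := two_loops_pair (reduced_loop rb vt) (reduced_loop rb wt) (cb _ _ vt wt vw).
by rewrite no_pairs inE.
Qed.

(** Two doubled vertices would be a pair of loops. With a single one, two link vertices joined in
    [G(I)] would form a pair with its loop; so the link is a simplex or empty, and emptiness is
    excluded at this level by the degree. *)
Lemma no_pairs_acyclic b i : reduced I b -> clique ec (vtwos b) -> 0 < #|vtwos b| ->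
  i + 2 < mdeg b -> acyclic_at K (coface ec (vsupp b) (vlink I b)) i.+1.
Proof.
move=> rb cb t0 ib; have t1 : #|vtwos b| = 1.
  by apply/eqP; rewrite eqn_leq no_pairs_twos.
have := mdeg_reduced rb; have := card_vsupp rb; rewrite t1 => cE cj.
move/eqP/cards1P: t1 => [v tv].
have vt : v \in vtwos b by rewrite tv set11.
have [l0|[x xl]] := set_0Vmem (vlink I b).
  by apply: coface_triv; rewrite l0 cards0; card_lia.
apply: (coface_cone ec_sym (vlink_sub I b) xl).
have lv y : y \in vlink I b -> ec y v by rewrite inE => /andP[_ /forall_inP]; apply.
apply/subsetP=> y; rewrite in_setD1 => /andP[yx yl].
rewrite inE /Gedge_compl eq_sym yx; apply/negP=> xy.
have := loop_edge_pair (reduced_loop rb vt) xy (lv _ xl) (lv _ yl).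
by rewrite no_pairs inE.
Qed.

Lemma no_pairs_size c : induced_cycle ec c -> 5 <= size c.
Proof.
move=> cc; have := cc => /and3P[_ _]; rewrite leq_eqVlt => /orP[/eqP/esym c4|//].
have [x0 [x1 [x2 [x3 [_ _ _ _]]]]] := four_cycle_pair e_sym cc c4.
by rewrite no_pairs inE.
Qed.

Lemma betti_chordal i j : (forall c, ~~ induced_cycle ec c) -> i + 2 < j -> betti F i j = 0.
Proof.
move=> chord ij; apply: betti_vanish => b bj rb cb.
have [t0|t0] := posnP #|vtwos b|; last by apply: no_pairs_acyclic; rewrite ?bj.
have := mdeg_reduced rb; have := card_vsupp rb; rewrite bj t0 => cE cj.
rewrite vlink_squarefree //.
apply: (coface_chordal ec_sym ec_irr (s := j - i.+1)) => //; last by card_lia.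
  by move=> c cc; have := chord c; rewrite cc.
by card_lia.
Qed.

Section Girth.
Variable r : nat.
Hypothesis r5 : 5 <= r.
Hypothesis girth : forall c, induced_cycle ec c -> r <= size c.

Lemma betti_girth i j : i <= r - 3 -> i + 2 < j -> (i, j) != (r - 3, r) -> betti F i j = 0.
Proof.
move=> ir ij nij; apply: betti_vanish => b bj rb cb.
have [t0|t0] := posnP #|vtwos b|; last by apply: no_pairs_acyclic; rewrite ?bj.
have := mdeg_reduced rb; have := card_vsupp rb; rewrite bj t0 => cE cj.
rewrite vlink_squarefree //.
(* With [#|A| = j] and [s = j - i.+1], [coface_girth] asks for [i <= r - 4] and [coface_girth3] for
   [i <= r - 3]. Only [j = i + 3] relies on the former, and there the excluded couple [(r - 3, r)]
   is exactly the missing case. *)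
have [j3|j3] := leqP j (i + 3).
  apply: (coface_girth ec_sym ec_irr girth (s := j - i.+1)) => //; try card_lia.
  have jr : j != r.
    by apply: contraNneq nij => jr; rewrite xpair_eqE jr eqxx andbT; apply/eqP; lia.
  by card_lia.
apply: (coface_girth3 ec_sym ec_irr girth (s := j - i.+1)) => //; card_lia.
Qed.

Lemma betti_cycles : betti F (r - 3) r = #|cycles r|.
Proof.
pose cyc b := (b == mesym1 (vsupp b)) && (vsupp b \in cycle_sets ec r).
have r4 : 4 <= r by apply: leq_trans r5.
rewrite (betti_count HI F (c := cyc)) => [|b br /andP[/eqP bE S_cyc]|b br ncyc]; first last.
- apply: std_acyclic => rb cb.
  have [t0|t0] := posnP #|vtwos b|; last by apply: no_pairs_acyclic; rewrite ?br //; lia.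
  have := mdeg_reduced rb; have := card_vsupp rb; rewrite br t0 => cE cj.
  rewrite vlink_squarefree //.
  apply: (coface_chordal ec_sym ec_irr (s := 2)) => //; last by card_lia.
  (* An induced cycle inside [r] vertices has length at least [r], hence spans the support. *)
  move=> c cc cS; case/negP: ncyc; apply/andP; split; first by rewrite -squarefreeE.
  have rc := girth cc; have /and3P[/andP[_ cu] _ _] := cc.
  have cr : size c = r.
    apply/eqP; rewrite eqn_leq rc andbT.
    have : size c <= #|vsupp b| by rewrite cardE; apply: uniq_leq_size => // x /cS;
        rewrite mem_enum.
    by card_lia.
  by rewrite -cr; apply: spanning_cycle => //; rewrite cr cE; card_lia.
- by rewrite bE; apply: (cycle_set_one_dim r4 girth S_cyc); lia.
rewrite card_induced_cycles.
rewrite -(card_in_imset (f := fun b : 'X_{1..n < r.+1} => vsupp b)); last first.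
  move=> b b'; rewrite !inE => /and3P[_ /eqP bE _] /and3P[_ /eqP bE' _] bb.
  by apply: val_inj; rewrite /= bE bE' bb.
apply: eq_card => S; apply/imsetP/idP => [[b]|S_cyc].
  by rewrite inE => /and3P[_ _ S_cyc] ->.
have Sr : mdeg (mesym1 S) = r.
  rewrite mdeg_mesym1; have [c [cc <- ->]] := cycle_setsP r4 S_cyc.
  by rewrite cardsE; apply/card_uniqP; case/and3P: cc => /andP[].
have Sb : mdeg (mesym1 S) < r.+1 by rewrite Sr.
exists (BMultinom Sb); last by rewrite /= vsupp_mesym1.
by rewrite inE /cyc /= vsupp_mesym1 Sr !eqxx.
Qed.

End Girth.

End NoPairs.
End BettiNumbers.

(** * Multidegrees of pairs of disjoint edges *)

Section PairMonomials.
Variables (K : fieldType) (n : nat) (I : {pred {mpoly K[n]}}).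
Local Notation T := 'I_n.
Local Notation e := (Gedge I).
Local Notation ec := (Gedge_compl I).
Local Notation pairs := (induced_disjoint_edge_pairs e).
Local Notation e_sym := (@Gedge_sym K n I).
Local Notation ec_sym := (@Gedge_compl_sym K n I).
Local Notation ec_irr := (@Gedge_compl_irr K n I).
Implicit Types (b : 'X_{1..n}) (v w x y z : T) (S : {set T}) (P : {set {set T}}).

(* A loop contributes the square of its vertex. *)
Definition edge_mult S := if #|S| == 1 then 2 else 1.

Definition pair_mnm P : 'X_{1..n} := [multinom \sum_(S in P) (x \in S) * edge_mult S | x < n].

Lemma edge_mult1 v : edge_mult [set v] = 2.
Proof. by rewrite /edge_mult cards1. Qed.

Lemma edge_mult2 x y : x != y -> edge_mult [set x; y] = 1.
Proof. by move=> xy; rewrite /edge_mult cards2 xy. Qed.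

Lemma pair_mnmE S1 S2 x : S1 != S2 ->
  pair_mnm [set S1; S2] x = (x \in S1) * edge_mult S1 + (x \in S2) * edge_mult S2.
Proof. by move=> S12; rewrite mnmE big_setU1 ?inE //= big_set1. Qed.

Lemma card_edge_mult S : S \in edges e -> #|S| * edge_mult S = 2.
Proof.
move=> /edgesP[x [y [_ ->]]]; case: (eqVneq x y) => [->|xy].
  by rewrite setUid edge_mult1 cards1.
by rewrite edge_mult2 // cards2 xy.
Qed.

Lemma disjoint_edges_neq S1 S2 : S1 \in edges e -> [disjoint S1 & S2] -> S1 != S2.
Proof.
move=> /edgesP[x [y [_ ->]]] dis; apply/eqP=> S; rewrite -S in dis.
by have := disjointFr dis (set21 x y); rewrite set21.
Qed.

Lemma sum_mem S k : \sum_x (x \in S) * k = #|S| * k.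
Proof. by rewrite -big_distrl /= -sum1_card [in RHS]big_mkcond; congr (_ * _);
    apply: eq_bigr => x _; case: (x \in S). Qed.

Lemma mdeg_pair_mnm P : P \in pairs -> mdeg (pair_mnm P) = 4.
Proof.
move=> /pairsP[S1 [S2 [-> E1 E2 dis _]]]; rewrite mdegE.
under eq_bigr do rewrite pair_mnmE ?(disjoint_edges_neq E1) //.
by rewrite big_split /= !sum_mem !card_edge_mult.
Qed.

(** As no edge joins the two members of the pair, they are the only edges whose monomial divides
    their product; so the monomial determines the pair. *)
Lemma pair_mnmK P : P \in pairs ->
  P = [set S in edges e | [forall x, (x \in S) * edge_mult S <= pair_mnm P x]].
Proof.
move=> /pairsP[S1 [S2 [-> E1 E2 dis non]]]; have S12 := disjoint_edges_neq E1 dis.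
apply/setP=> S; rewrite in_set2 inE; apply/idP/andP.
  move=> /orP[]/eqP->; split=> //; apply/forallP=> x; rewrite pair_mnmE //.
    exact: leq_addr.
  exact: leq_addl.
move=> [/edgesP[x [y [exy SE]]] /forallP le].
have lex : 0 < pair_mnm [set S1; S2] x.
  apply: leq_trans (le x); rewrite SE set21 mul1n /edge_mult; by case: ifP.
have ley : 0 < pair_mnm [set S1; S2] y.
  apply: leq_trans (le y); rewrite SE set22 mul1n /edge_mult; by case: ifP.
have loc z : 0 < pair_mnm [set S1; S2] z -> z \in S1 \/ z \in S2.
  by rewrite pair_mnmE //; case: (z \in S1); [left|case: (z \in S2); [right|]].
have same S' : S' \in edges e -> x \in S' -> y \in S' ->
    pair_mnm [set S1; S2] x = edge_mult S' -> S = S'.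
  move=> /edgesP[x' [y' [_ S'E]]] xS' yS' xm; have := le x.
  rewrite xm SE set21 mul1n; case: (eqVneq x y) => [xy|xy].
    rewrite -xy setUid edge_mult1 /edge_mult; case: ifP => // /cards1P[z S'z] _.
    by move: xS'; rewrite S'z inE => /eqP->.
  move=> _; apply/eqP; rewrite eqEcard subUset !sub1set xS' yS' /=.
  by rewrite S'E !cards2 xy; case: (x' != y').
case: (loc x lex) (loc y ley) => hx [] hy.
- rewrite (same S1) ?eqxx // pair_mnmE // hx mul1n.
  by rewrite (disjointFr dis hx) mul0n addn0.
- by have := non _ _ hx hy; rewrite exy.
- by have := non _ _ hy hx; rewrite e_sym exy.
rewrite (same S2) ?eqxx ?orbT // pair_mnmE // hx mul1n.
by rewrite (disjointFl dis hx).
Qed.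

Lemma pair_mnm_inj : {in pairs &, injective pair_mnm}.
Proof. by move=> P P' PP PP' eqb; rewrite (pair_mnmK PP) (pair_mnmK PP') eqb. Qed.

Lemma reducedE b x : reduced I b -> b x = (x \in vones b) + (x \in vtwos b) * 2.
Proof. by move=> rb; rewrite !inE; have := reduced_le2 x rb; case: (b x) => [|[|[|]]]. Qed.

(** Both vertices are doubled, so the link is empty and the class is that of the empty face, at
    level [2 = #|E|]. *)
Lemma one_dim_loops v w : e v v -> e w w -> ec v w ->
  one_dim_at K (std_face I (pair_mnm [set [set v]; [set w]])) 2.
Proof.
move=> vv ww vw; have /andP[nvw _] := vw.
set b := pair_mnm _.
have bE x : b x = (x == v) * 2 + (x == w) * 2.
  rewrite pair_mnmE ?edge_mult1 ?in_set1 //.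
  by apply: contra_neq nvw => /set1_inj.
have sb : vsupp b = [set v; w].
  by apply/setP=> x; rewrite !inE bE; case: eqP; case: eqP.
have tb : vtwos b = [set v; w].
  apply/setP=> x; rewrite !inE bE; case: (x =P v) => [->|_]; last by case: (x =P w).
  by rewrite (negPf nvw).
have ob : vones b = set0.
  by apply/setP=> x; rewrite !inE bE; case: (x =P v); case: (x =P w).
have lb : vlink I b = set0 by apply/eqP; rewrite -subset0 -ob vlink_vones.
have rb : reduced I b.
  apply/forallP=> x; apply/implyP; rewrite bE.
  case: (x =P v) => [->|_]; first by rewrite (negPf nvw) vv.
  by case: (x =P w) => [->|].
have cb : clique ec (vtwos b).
  rewrite tb; apply/cliqueP=> x y; rewrite !inE => /orP[]/eqP-> /orP[]/eqP->; rewrite ?eqxx //.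
  by rewrite ec_sym.
apply: (@eq_one_dim K n (coface ec [set v; w] set0)).
  by move=> t; rewrite std_face_coface // sb lb.
by have := @coface_one_dim0 K n ec [set v; w]; rewrite cards2 nvw.
Qed.

(** The link of the doubled vertex consists of [x] and [y], not adjacent in the complement: a
    0-sphere, at level [2 = #|E| - 1]. *)
Lemma one_dim_loop_edge v x y : e v v -> e x y -> x != y -> ec x v -> ec y v ->
  one_dim_at K (std_face I (pair_mnm [set [set v]; [set x; y]])) 2.
Proof.
move=> vv xy nxy xv yv; have /andP[nxv _] := xv; have /andP[nyv _] := yv.
set b := pair_mnm _.
have bE z : b z = (z == v) * 2 + ((z == x) || (z == y)).
  rewrite pair_mnmE ?edge_mult1 ?edge_mult2 ?in_set1 ?in_set2 ?muln1 //.
  by apply/eqP=> /setP/(_ x); rewrite !inE eqxx (negPf nxv).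
have cases z : [\/ z = v, z = x, z = y | [/\ z != v, z != x & z != y]].
  case: (eqVneq z v) => [|zv]; first by constructor 1.
  case: (eqVneq z x) => [|zx]; first by constructor 2.
  by case: (eqVneq z y) => [|zy]; [constructor 3|constructor 4].
have bv : b v = 2 by rewrite bE eqxx ![v == _]eq_sym (negPf nxv) (negPf nyv).
have bx : b x = 1 by rewrite bE eqxx (negPf nxv).
have by' : b y = 1 by rewrite bE eqxx (negPf nyv) orbT.
have b0 z : z != v -> z != x -> z != y -> b z = 0.
  by move=> zv zx zy; rewrite bE (negPf zv) (negPf zx) (negPf zy).
have sb : vsupp b = v |: [set x; y].
  apply/setP=> z; rewrite !inE; case: (cases z) => [->|->|->|[zv zx zy]].
  - by rewrite bv eqxx.
  - by rewrite bx eqxx orbT.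
  - by rewrite by' eqxx !orbT.
  by rewrite b0 // (negPf zv) (negPf zx) (negPf zy).
have tb : vtwos b = [set v].
  apply/setP=> z; rewrite !inE; case: (cases z) => [->|->|->|[zv zx zy]].
  - by rewrite bv !eqxx.
  - by rewrite bx (negPf nxv).
  - by rewrite by' (negPf nyv).
  by rewrite b0 // (negPf zv).
have lb : vlink I b = [set x; y].
  apply/setP=> z; rewrite in_set2 inE tb (_ : (z \in vones b) = (b z == 1)) ?inE //.
  case: (cases z) => [->|->|->|[zv zx zy]].
  - by rewrite bv ![v == _]eq_sym (negPf nxv) (negPf nyv).
  - rewrite bx !eqxx; apply/forall_inP=> u; rewrite inE => /eqP->; exact: xv.
  - rewrite by' !eqxx orbT; apply/forall_inP=> u; rewrite inE => /eqP->; exact: yv.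
  by rewrite b0 // (negPf zx) (negPf zy).
have rb : reduced I b.
  apply/forallP=> z; apply/implyP; case: (cases z) => [->|->|->|[zv zx zy]].
  - by rewrite bv vv.
  - by rewrite bx.
  - by rewrite by'.
  by rewrite b0.
have cb : clique ec (vtwos b).
  by rewrite tb; apply/cliqueP=> z z'; rewrite !inE => /eqP-> /eqP->; rewrite eqxx.
apply: (@eq_one_dim K n (coface ec (v |: [set x; y]) [set x; y])).
  by move=> t; rewrite std_face_coface // sb lb.
apply: (coface_one_dim1 K ec_sym ec_irr) => //.
- by rewrite !inE eqxx orbT.
- by rewrite !inE eqxx !orbT.
- by rewrite /Gedge_compl xy andbF.
by rewrite cardsU1 cards2 nxy !inE negb_or ![v == _]eq_sym nxv nyv.
Qed.

Lemma pair_mnm_edges x y x' y' : x != y -> x' != y' ->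
    [disjoint [set x; y] & [set x'; y']] ->
  pair_mnm [set [set x; y]; [set x'; y']] = mesym1 [set z in [:: x; x'; y; y']].
Proof.
move=> xy xy' dis; apply/mnmP=> z; rewrite pair_mnmE; last first.
  by apply/eqP=> S; rewrite -S in dis; have := disjointFr dis (set21 x y); rewrite set21.
rewrite !edge_mult2 // !muln1 mnmE !inE.
have := @disjointFr _ _ _ z dis; rewrite !inE.
case: (z == x); case: (z == y); case: (z == x'); case: (z == y') => //=; by [move/(_ isT)|].
Qed.

Lemma pair_one_dim P : P \in pairs -> one_dim_at K (std_face I (pair_mnm P)) 2.
Proof.
move=> /pairsP[S1 [S2 [-> E1 E2 dis non]]].
case/edgesP: E1 dis non => x [y [exy ->]]; case/edgesP: E2 => x' [y' [exy' ->]] dis non.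
have nn a c : a \in [set x; y] -> c \in [set x'; y'] -> ec a c.
  move=> aS cS; rewrite /Gedge_compl non // andbT.
  by apply: contraTneq cS => <-; rewrite (disjointFr dis).
case: (eqVneq x y) => [xy|nxy]; case: (eqVneq x' y') => [xy'|nxy'].
- subst y y'; rewrite !setUid in nn *; apply: one_dim_loops => //.
  by apply: nn; rewrite inE.
- subst y; rewrite setUid in nn *; apply: one_dim_loop_edge => //;
    rewrite ec_sym nn ?set11 ?set21 ?set22 //.
- subst y'; rewrite [[set x'; x']]setUid in nn *; rewrite setUC.
  by apply: one_dim_loop_edge => //; apply: nn; rewrite ?set11 ?set21 ?set22.
rewrite pair_mnm_edges //.
have cc := pair_four_cycle e_sym exy exy' nxy nxy' dis non.
(* A four-cycle is automatically shortest, induced cycles having length at least 4 by definition. *)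
apply: (@cycle_set_one_dim K n I _ 2 4) => //; first by move=> c /and3P[].
exact: (mem_cycle_sets cc).
Qed.

(** In degree 4 there are zero, one or two doubled vertices. A class would require respectively an
    induced four-cycle, an edge in the link of a loop, or two loops, and each of these exhibits [b]
    as a pair monomial. *)
Lemma no_pair_acyclic b : mdeg b = 4 -> ~~ [exists P in pairs, b == pair_mnm P] ->
  acyclic_at K (std_face I b) 2.
Proof.
move=> b4 nb; apply: std_acyclic => rb cb.
have npair P : P \in pairs -> b <> pair_mnm P.
  by move=> PP bP; case/negP: nb; apply/exists_inP; exists P => //; apply/eqP.
have := mdeg_reduced rb; have := card_vsupp rb; rewrite b4 => cE cj.
have loops v : v \in vtwos b -> e v v by apply: reduced_loop.
have bE x := reducedE x rb.
have [t0|] := posnP #|vtwos b|.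
  rewrite vlink_squarefree //.
  apply: (coface_chordal ec_sym ec_irr (s := 2)) => //; last by card_lia.
  move=> c cc cS; have /and3P[/andP[_ cu] _ c4] := cc.
  have cE4 : #|vsupp b| = 4 by card_lia.
  have sc : size c = 4.
    apply/eqP; rewrite eqn_leq c4 andbT -cE4 cardE; apply: uniq_leq_size => // x /cS.
    by rewrite mem_enum.
  have [x0 [x1 [x2 [x3 [cx un e02 e13 PP]]]]] := four_cycle_pair e_sym cc sc.
  have Sc : vsupp b = [set x in c].
    apply/esym/eqP; rewrite eqEcard; apply/andP; split.
      by apply/subsetP=> x; rewrite inE; apply: cS.
    by rewrite cE4 cardsE (card_uniqP cu) sc.
  apply: (npair _ PP); rewrite (squarefreeE rb t0) Sc cx.
  move: un; rewrite cx /= !inE !negb_or => /and4P[/and3P[n01 n02 n03] /andP[n12 n13] n23 _].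
  rewrite pair_mnm_edges //.
  rewrite disjoint_subset; apply/subsetP=> x; rewrite in_set2 inE in_set2 negb_or.
  by move=> /orP[]/eqP->; rewrite ?n01 ?n03 ?n23 //= eq_sym n12.
rewrite leq_eqVlt => /orP[/eqP/esym t1|t2].
  have o2 : #|vones b| = 2 by card_lia.
  move/eqP/cards1P: t1 => [v tv]; have vt : v \in vtwos b by rewrite tv set11.
  move/eqP/cards2P: (o2) => [x [y [nxy oxy]]].
  have [lo|lo] := eqVneq (vlink I b) (vones b); last first.
    (* A link smaller than [vones b] has at most one vertex, too few for a class on single
       vertices. *)
    apply: (coface_small ec_sym ec_irr (s := 1)); rewrite ?vlink_sub //;
        first by rewrite cE o2 tv cards1.
    rewrite muln1 -o2; apply: proper_card.
    by rewrite properEneq lo vlink_vones.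
  have lv z : z \in vlink I b -> ec z v by rewrite inE => /andP[_ /forall_inP]; apply.
  have xl : x \in vlink I b by rewrite lo oxy set21.
  have yl : y \in vlink I b by rewrite lo oxy set22.
  have [exy|nexy] := boolP (e x y).
    have PP := loop_edge_pair (loops _ vt) exy (lv _ xl) (lv _ yl).
    case: (npair _ PP); apply/mnmP=> z; rewrite bE oxy tv pair_mnmE.
      by rewrite edge_mult1 edge_mult2 // muln1 addnC.
    apply/eqP=> /setP/(_ x); rewrite !inE eqxx; have /andP[/negPf-> _] := lv _ xl.
    by [].
  apply: (coface_cone ec_sym (vlink_sub I b) xl); apply/subsetP=> z.
  rewrite in_setD1 lo oxy in_set2 => /andP[/negPf-> /= /eqP->].
  by rewrite inE /Gedge_compl nxy.
have t2E : #|vtwos b| = 2 by card_lia.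
have o0 : #|vones b| = 0 by card_lia.
move/eqP/cards2P: t2E => [v [w [nvw tvw]]].
have vt : v \in vtwos b by rewrite tvw set21.
have wt : w \in vtwos b by rewrite tvw set22.
have vw : ec v w by move/cliqueP: cb => cb; apply: cb.
case: (npair _ (two_loops_pair (loops _ vt) (loops _ wt) vw)).
apply/mnmP=> z; rewrite bE tvw (cards0_eq o0) inE pair_mnmE.
  rewrite !edge_mult1 !inE; case: (z =P v) => [->|_]; rewrite ?(negPf nvw) //.
by apply: contra_neq nvw => /set1_inj.
Qed.

End PairMonomials.

(** * The first nonlinear index, and the theorem *)

Section FirstIndex.
Variables (K : fieldType) (n : nat) (I : {pred {mpoly K[n]}}).
Hypothesis HI : generated_by_quadratic_monomials I.
Variable F : min_graded_resolution I.
Local Notation e := (Gedge I).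
Local Notation pairs := (induced_disjoint_edge_pairs e).

Lemma betti_pairs : betti F 1 4 = #|pairs|.
Proof.
rewrite (betti_count HI F (c := fun b => [exists P in pairs, b == pair_mnm P])); first last.
- by move=> b b4 nb; apply: no_pair_acyclic.
- by move=> b _ /exists_inP[P PP /eqP->]; apply: pair_one_dim.
(* The default [bm0] is never reached on pairs, whose monomials have degree 4. *)
pose f (P : {set {set 'I_n}}) : 'X_{1..n < 5} := insubd bm0 (pair_mnm P).
have fE P : P \in pairs -> f P = pair_mnm P :> 'X_{1..n}.
  by move=> PP; rewrite /f insubdK // -topredE /= (mdeg_pair_mnm PP).
rewrite -(card_in_imset (f := f)); last first.
  by move=> P P' PP PP' /(congr1 val) /=; rewrite !fE //; apply: (@pair_mnm_inj K n I).
apply: eq_card => b; rewrite inE; apply/andP/imsetP.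
  by move=> [_ /exists_inP[P PP /eqP bP]]; exists P => //; apply: val_inj; rewrite /= fE.
move=> [P PP ->]; rewrite fE // (mdeg_pair_mnm PP); split=> //.
by apply/exists_inP; exists P.
Qed.

Lemma betti_length i j : betti F i j != 0 -> i <= res_length F.
Proof.
rewrite leqNgt; apply: contra => /res_rank_gt_length r0.
rewrite /betti cards_eq0; apply/eqP/setP=> a.
by have := leq_trans (ltn_ord a) (eq_leq r0).
Qed.

Lemma first_index_eq d k : 0 < k -> betti F k (k + d) != 0 ->
  (forall i, 0 < i < k -> betti F i (i + d) = 0) -> first_index F d = k.
Proof.
move=> k0 bk lt; have kL := betti_length bk; rewrite /first_index.
have -> : res_length F = k.-1 + (res_length F - k).+1 by lia.
rewrite iotaD filter_cat (_ : [seq i <- iota 1 k.-1 | _] = [::]) /=; last first.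
  apply/eqP; rewrite -(negbK (_ == _)) -has_filter; apply/hasPn=> i.
  by rewrite mem_iota => ik; rewrite lt //; lia.
have -> : 1 + k.-1 = k by lia.
by rewrite bk.
Qed.

Lemma first_index_eq0 d : (forall i, 0 < i -> betti F i (i + d) = 0) -> first_index F d = 0.
Proof.
move=> z; rewrite /first_index (_ : filter _ _ = [::]) //.
apply/eqP; rewrite -(negbK (_ == _)) -has_filter; apply/hasPn=> i.
by rewrite mem_iota => /andP[i0 _]; rewrite z.
Qed.

End FirstIndex.

Theorem theorem1p1 (K : fieldType) (n : nat) (I : {pred {mpoly K[n]}})
    (HI : generated_by_quadratic_monomials I) (F : min_graded_resolution I) :
  let beta := betti F in
  let i3 := first_index F 3 in
  let pairs := induced_disjoint_edge_pairs (Gedge I) in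
  let cycles := induced_cycles (Gedge_compl I) in
  (* (1) *)
  ((i3 = 1 <-> pairs != set0) /\
   (i3 = 1 ->
      beta 1 4 = #|pairs| /\ (forall j, 4 < j -> beta 1 j = 0))) /\
  (* (2) *)
  ((1 < i3 <->
      pairs = set0 /\ (exists t, 5 <= t /\ cycles t != set0)) /\
   (1 < i3 ->
      exists r, is_least (fun t => 5 <= t /\ cycles t != set0) r /\
        i3 = r - 3 /\
        beta i3 (i3 + 3) = #|cycles r| /\
        (forall i j, i <= i3 -> i3 + 3 < j -> beta i j = 0))) /\
  (* (3) *)
  ((i3 = 0 <-> pairs = set0 /\ chordal (Gedge_compl I)) /\
   (i3 = 0 -> linear_resolution F)).
Proof.
move=> beta i3 pairs cycles.
have b14 : beta 1 4 = #|pairs| by apply: betti_pairs.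
have [p0|pn0] := eqVneq pairs set0; last first.
  have i31 : i3 = 1.
    apply: first_index_eq => // [|i]; last by lia.
    by rewrite [betti _ _ _]b14 cards_eq0.
  (* At index 1 the range [2 * i + 2 < j] of [betti_high] is exactly [4 < j]. *)
  split; first by split=> // _; split=> // j j4; apply: betti_high.
  split; rewrite i31; first by split=> //; split=> // -[h]; rewrite h eqxx in pn0.
  by split=> //; split=> // -[h]; rewrite h eqxx in pn0.
have size5 := no_pairs_size p0.
pose Q t := (5 <= t) && (cycles t != set0).
have Qcycle c : induced_cycle (Gedge_compl I) c -> Q (size c).
  move=> cc; rewrite /Q size5 //=.
  by apply/induced_cycles_neq0P; [apply: ltnW; apply: size5|exists c].
(* A cycle has at most [n] vertices, so the existence of a suitable length is decided by a finite
   search. *)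
have Qbound t : Q t -> t < n.+1.
  move=> /andP[t5 /induced_cycles_neq0P[|c cc <-]]; first exact: ltnW.
  case/and3P: cc => /andP[_ cu] _ _; rewrite ltnS -[X in _ <= X]card_ord.
  by rewrite -(card_uniqP cu) max_card.
have [/existsP[t0 Qt0]|noQ] := boolP [exists t : 'I_n.+1, Q t]; last first.
  have nocyc c : ~~ induced_cycle (Gedge_compl I) c.
    apply: contra noQ => /Qcycle Qc; apply/existsP.
    by exists (Ordinal (Qbound _ Qc)).
  have i30 : i3 = 0.
    by apply: first_index_eq0 => i _; apply: betti_chordal => //; lia.
  have nQ t : ~ (5 <= t /\ cycles t != set0).
    move=> [t5 tc]; case/negP: noQ; apply/existsP.
    have Qt : Q t by rewrite /Q t5.
    by exists (Ordinal (Qbound _ Qt)).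
  rewrite i30 p0; split; first by split.
  split; first by split=> //; split=> // -[_ [t /nQ]].
  split=> [|_ i j ij].
    split=> // _; split=> // t t4; apply/eqP; apply: contraT => tc.
    have /(induced_cycles_neq0P _ t4)[c cc _] := tc.
    by have := nocyc c; rewrite cc.
  (* Both sides of the linear strand vanish: below it by degree, above it by the absence of pairs
     and of induced cycles. *)
  have [lt|ge] := ltnP j (i + 2); first exact: betti_low.
  by apply: betti_chordal => //; lia.
have [r /andP[r5 rc] rmin] := ex_minnP (ex_intro Q (val t0) Qt0).
have girth c : induced_cycle (Gedge_compl I) c -> r <= size c by move/Qcycle/rmin.
have brE : beta (r - 3) r = #|cycles r| by apply: betti_cycles.
(* The girth bound empties the strand [j = i + 3] before index [r - 3], where the number of shortest
   cycles is nonzero. As [r >= 5], this index exceeds 1. *)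
have i3E : i3 = r - 3.
  apply: first_index_eq; first by lia.
    have -> : r - 3 + 3 = r by lia.
    by rewrite [betti _ _ _]brE cards_eq0.
  move=> i ir; apply: (betti_girth HI F p0 r5 girth); rewrite ?xpair_eqE; lia.
have i3r : i3 + 3 = r by lia.
rewrite p0; split; first by split; [split=> //|]; lia.
split; last first.
  split; last by lia.
  split; first by lia.
  move=> [_ /(_ r)]; rewrite (ltnW r5) => /(_ isT) r0.
  by move: rc; rewrite [cycles r]r0 eqxx.
split; first by split=> _; [split=> //; exists r|lia].
move=> _; exists r; split; first by split=> // t [t5 tc]; apply: rmin; rewrite /Q t5.
split=> //; rewrite i3r i3E; split=> // i j ir rj.
apply: (betti_girth HI F p0 r5 girth) => //; first by lia.
by rewrite xpair_eqE; lia.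
Qed.
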